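(* Let $\mathfrak g$ be one of the types $A_n^{(1)}\,(n\ge2)$, $B_n^{(1)}\,(n\ge3)$, $C_n^{(1)}\,(n\ge2)$, $D_n^{(1)}\,(n\ge4)$, $A_{2n-1}^{(2)}\,(n\ge3)$, $D_{n+1}^{(2)}\,(n\ge2)$, $A_{2n}^{(2)\dagger}\,(n\ge2)$, and let $\mathfrak g^L$ be its Langlands dual, i.e. respectively $A_n^{(1)}$, $A_{2n-1}^{(2)}$, $D_{n+1}^{(2)}$, $D_n^{(1)}$, $B_n^{(1)}$, $C_n^{(1)}$, $A_{2n}^{(2)}$. Let $\mathcal V(\mathfrak g)$ be the affine geometric crystal described in the context, with its positive structure $\Theta:(\mathbb C^\times)^k\to\mathcal V(\mathfrak g)$, $x\mapsto v(x)$, let $\mathcal{UD}(\mathcal V(\mathfrak g))$ be its ultra-discretization, and let $B_\infty(\mathfrak g^L)$ be the limit of perfect crystals described in the context. Then there is an isomorphism of crystals $$\mathcal{UD}(\mathcal V(\mathfrak g))\cong B_\infty(\mathfrak g^L).$$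
   Context: **Cartan matrices.** $I=\{0,1,\dots,n\}$, $a_{ij}=\langle\alpha_i^\vee,\alpha_j\rangle$, $a_{ii}=2$. For adjacent $i,j$ one has $a_{ij}=-1$ except for the listed entries; for non-adjacent $i\neq j$, $a_{ij}=0$. - $A_n^{(1)}$: $i,j$ adjacent iff $i\equiv j\pm1 \bmod n+1$; no exceptions. - $B_n^{(1)}$: adjacent pairs $\{0,2\}$, $\{i,i+1\}$ ($1\le i\le n-1$); exception $a_{n,n-1}=-2$. - $A_{2n-1}^{(2)}$: adjacent pairs as for $B_n^{(1)}$; exception $a_{n-1,n}=-2$. - $D_n^{(1)}$: adjacent pairs $\{0,2\}$, $\{i,i+1\}$ ($1\le i\le n-2$), $\{n-2,n\}$; no exceptions. - $C_n^{(1)}$, $D_{n+1}^{(2)}$, $A_{2n}^{(2)\dagger}$, $A_{2n}^{(2)}$: adjacent pairs $\{i,i+1\}$ ($0\le i\le n-1$); exceptions $a_{1,0}=a_{n-1,n}=-2$ for $C_n^{(1)}$; $a_{0,1}=a_{n,n-1}=-2$ for $D_{n+1}^{(2)}$; $a_{1,0}=a_{n,n-1}=-2$ for $A_{2n}^{(2)\dagger}$; $a_{0,1}=a_{n-1,n}=-2$ for $A_{2n}^{(2)}$. The Cartan matrix of $\mathfrak g^L$ is the transpose of that of $\mathfrak g$. **The module $W(\varpi_1)$ of $\mathfrak g$** (the fundamental representation specialized at $q=1$). It is the complex vector space with the basis below; each basis vector is a weight vector, weights being written in the fundamental weights $\Lambda_i$ ($\langle\alpha_i^\vee,\Lambda_j\rangle=\delta_{ij}$),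 and $f_i$ kills every basis vector for which no value is listed. Always $\mathrm{wt}(v_{\bar i})=-\mathrm{wt}(v_i)$. - $A_n^{(1)}$: basis $v_1,\dots,v_{n+1}$; $\mathrm{wt}(v_i)=\Lambda_i-\Lambda_{i-1}$ with $\Lambda_{n+1}=\Lambda_0$; $f_iv_i=v_{i+1}$ ($1\le i\le n$), $f_0v_{n+1}=v_1$. - All other types: the basis contains $v_1,\dots,v_n,v_{\bar n},\dots,v_{\bar1}$, and $f_iv_i=v_{i+1}$, $f_iv_{\overline{i+1}}=v_{\bar i}$ for $1\le i\le n-1$. Moreover $\mathrm{wt}(v_i)=\Lambda_i-\Lambda_{i-1}$ unless stated otherwise. In addition: - $B_n^{(1)}$: one more basis vector $v_0$ of weight $0$; $\mathrm{wt}(v_2)=\Lambda_2-\Lambda_1-\Lambda_0$, $\mathrm{wt}(v_n)=2\Lambda_n-\Lambda_{n-1}$; $f_nv_n=v_0$, $f_nv_0=2v_{\bar n}$, $f_0v_{\bar2}=v_1$, $f_0v_{\bar1}=v_2$. - $C_n^{(1)}$: $f_nv_n=v_{\bar n}$, $f_0v_{\bar1}=v_1$. - $D_n^{(1)}$: $\mathrm{wt}(v_2)=\Lambda_2-\Lambda_1-\Lambda_0$, $\mathrm{wt}(v_{n-1})=\Lambda_{n-1}+\Lambda_n-\Lambda_{n-2}$; $f_nv_n=v_{\overline{n-1}}$, $f_nv_{n-1}=v_{\bar n}$, $f_0v_{\bar2}=v_1$, $f_0v_{\bar1}=v_2$. - $A_{2n-1}^{(2)}$: $\mathrm{wt}(v_2)=\Lambda_2-\Lambda_1-\Lambda_0$;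 $f_nv_n=v_{\bar n}$, $f_0v_{\bar2}=v_1$, $f_0v_{\bar1}=v_2$. - $D_{n+1}^{(2)}$: two more basis vectors $v_0,\phi$ of weight $0$; $\mathrm{wt}(v_1)=\Lambda_1-2\Lambda_0$, $\mathrm{wt}(v_n)=2\Lambda_n-\Lambda_{n-1}$; $f_nv_n=v_0$, $f_nv_0=2v_{\bar n}$, $f_0v_{\bar1}=\phi$, $f_0\phi=2v_1$. - $A_{2n}^{(2)\dagger}$: one more basis vector $v_0$ of weight $0$; $\mathrm{wt}(v_n)=2\Lambda_n-\Lambda_{n-1}$; $f_nv_n=v_0$, $f_nv_0=2v_{\bar n}$, $f_0v_{\bar1}=v_1$. For $c\in\mathbb C^\times$ let $\alpha_i^\vee(c)$ act on a weight vector $u$ by $c^{\langle\alpha_i^\vee,\mathrm{wt}(u)\rangle}$, and set $Y_i(c)=\exp(c^{-1}f_i)\,\alpha_i^\vee(c)$ on $W(\varpi_1)$. **Words.** $\mathbf i_1=(n,n-1,\dots,1)$ for $A_n^{(1)}$; $(1,2,\dots,n,n-1,\dots,1)$ for $B_n^{(1)},A_{2n-1}^{(2)}$; $(1,2,\dots,n-1,n,n-2,n-3,\dots,1)$ for $D_n^{(1)}$; $(0,1,\dots,n,n-1,\dots,1)$ for $C_n^{(1)},D_{n+1}^{(2)},A_{2n}^{(2)\dagger}$. For $A_{2n}^{(2)\dagger}$ also $\mathbf i_2=(n,n-1,\dots,1,0,1,\dots,n-1)$. **The geometric crystal $\mathcal V(\mathfrak g)$.** With $\mathbf i_1=(i_1,\dots,i_k)$,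 $\mathcal V(\mathfrak g)=\{v(x)=Y_{i_1}(x_1)\cdots Y_{i_k}(x_k)v_1: x\in(\mathbb C^\times)^k\}\subset W(\varpi_1)$. For $A_{2n}^{(2)\dagger}$, writing $v_1(x)$ for $v(x)$ and $\mathbf i_2=(j_1,\dots,j_{2n})$, $\mathcal V_2(\mathfrak g)=\{v_2(y)=Y_{j_1}(y_1)\cdots Y_{j_{2n}}(y_{2n})v_{\bar n}: y\in(\mathbb C^\times)^{2n}\}$. The parametrizations by tori are birational. For a word $(i_1,\dots,i_k)$ put, for $i\in I$, $$P_m=\frac{1}{x_1^{a_{i_1,i}}\cdots x_{m-1}^{a_{i_{m-1},i}}x_m}\ (\text{for } i_m=i),\quad \varepsilon_i=\sum_{m:\,i_m=i}P_m,\quad \gamma_i=x_1^{a_{i_1,i}}\cdots x_k^{a_{i_k,i}},$$ and $e_i^c:(x_1,\dots,x_k)\mapsto(x_1',\dots,x_k')$ with $$x_j'=x_j\cdot\frac{c\sum_{m\le j,\,i_m=i}P_m+\sum_{m>j,\,i_m=i}P_m}{c\sum_{m<j,\,i_m=i}P_m+\sum_{m\ge j,\,i_m=i}P_m}.$$ On $\mathcal V(\mathfrak g)$ these formulas for $\mathbf i_1$ define $e_i,\gamma_i,\varepsilon_i$ for $i\in I\setminus\{0\}$; on $\mathcal V_2(\mathfrak g)$ the formulas for $\mathbf i_2$ define $e_i,\gamma_i,\varepsilon_i$ for $i\in I\setminus\{n\}$. For $\mathfrak g\ne A_{2n}^{(2)\dagger}$ let $\sigma$ be the diagram automorphism: $\sigma(i)=i+1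 \bmod (n+1)$ for $A_n^{(1)}$; $0\leftrightarrow1$, others fixed, for $B_n^{(1)},D_n^{(1)},A_{2n-1}^{(2)}$; $\sigma(i)=n-i$ for $C_n^{(1)},D_{n+1}^{(2)}$; it acts linearly on $W(\varpi_1)$ by $v_i\mapsto v_{i+1}$, $v_{n+1}\mapsto v_1$ for $A_n^{(1)}$; by $v_1\leftrightarrow v_{\bar1}$, other basis vectors fixed, for $B_n^{(1)},D_n^{(1)},A_{2n-1}^{(2)}$; by $v_i\leftrightarrow v_{\overline{n+1-i}}$ ($1\le i\le n$) (and $v_0\leftrightarrow\phi$ for $D_{n+1}^{(2)}$) for $C_n^{(1)},D_{n+1}^{(2)}$. For generic $x$ there are a unique $y$ and scalar $a(x)$ with $v(y)=a(x)\sigma(v(x))$ and $\varepsilon_{\sigma(i)}(v(y))=\varepsilon_i(v(x))$ for all $i$ with $i,\sigma(i)\ne0$; $\overline\sigma:\mathcal V(\mathfrak g)\to\mathcal V(\mathfrak g)$, $v(x)\mapsto v(y)$, is birational. Put $e_0^c=\overline\sigma^{-1}\circ e_{\sigma(0)}^c\circ\overline\sigma$, $\varepsilon_0=\varepsilon_{\sigma(0)}\circ\overline\sigma$, $\gamma_0=\gamma_{\sigma(0)}\circ\overline\sigma$. For $\mathfrak g=A_{2n}^{(2)\dagger}$: for generic $x$ there are a unique $y$ and scalar $a(x)$ with $v_2(y)=a(x)v_1(x)$; $\overline\sigma:\mathcal V(\mathfrak g)\to\mathcal V_2(\mathfrak g)$, $v_1(x)\mapsto v_2(y)$, is birational, and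 $e_0^c=\overline\sigma^{-1}\circ e_0^c\circ\overline\sigma$, $\varepsilon_0=\varepsilon_0\circ\overline\sigma$, $\gamma_0=\gamma_0\circ\overline\sigma$, the right-hand $e_0,\varepsilon_0,\gamma_0$ being those of $\mathcal V_2(\mathfrak g)$. With these data $\mathcal V(\mathfrak g)$ is a $\mathfrak g$-geometric crystal, and in the coordinates $x$ all $e_i,\gamma_i,\varepsilon_i$ ($i\in I$) are positive rational (ratios of polynomials with positive coefficients). **Ultra-discretization.** For a positive rational map $f:T\to T'$ of algebraic tori (i.e. $\chi\circ f$ is a ratio of positive combinations of characters for each character $\chi$ of $T'$), $\hat f:X_*(T)\to X_*(T')$ is the map on cocharacter lattices with $\langle\chi,\hat f(\xi)\rangle=\deg(\chi\circ f\circ\xi)$, where $\deg$ of a rational function of $c$ is the degree of its pole at $c=\infty$. Concretely one replaces $\times,/,+$ by $+,-,\max$. $\mathcal{UD}(\mathcal V(\mathfrak g))$ is the set $\mathbb Z^k$ with $\tilde e_i(x)=\widehat{e_i}(1,x)$, $\tilde f_i=\tilde e_i^{-1}$, $\mathrm{wt}_i=\widehat{\gamma_i}$, $\varepsilon_i=\widehat{\varepsilon_i}$, $\varphi_i=\varepsilon_i+\mathrm{wt}_i$ ($i\in I$), where $\mathrm{wt}_i$ is the coefficient of $\Lambda_i$ in $\mathrm{wt}=\sum_i\mathrm{wt}_i\Lambda_i$. An isomorphism of crystals is a bijection commuting with all $\tilde e_i,\tilde f_i$ and preserving $\mathrm{wt},\varepsilon_i,\varphi_i$. **The crystals $B_\infty$.**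 Below $(u)_+=\max(u,0)$, $\tilde f_i=\tilde e_i^{-1}$, $\varphi_i=\varepsilon_i+\mathrm{wt}_i$; only changed coordinates are indicated. - $B_\infty(A_n^{(1)})=\{(b_1,\dots,b_{n+1})\in\mathbb Z^{n+1}:\sum b_i=0\}$; $\tilde e_0$: $b_1\to b_1-1$, $b_{n+1}\to b_{n+1}+1$; $\tilde e_i$ ($1\le i\le n$): $b_i\to b_i+1$, $b_{i+1}\to b_{i+1}-1$; $\mathrm{wt}_0=b_{n+1}-b_1$, $\mathrm{wt}_i=b_i-b_{i+1}$; $\varepsilon_0=b_1$, $\varepsilon_i=b_{i+1}$. For the other types $b=(b_1,\dots,b_n,\bar b_n,\dots,\bar b_1)$ (for $D_n^{(1)}$ there is no $\bar b_n$), $l(b)=\sum_{i=1}^n(b_i+\bar b_i)$, and for $1\le i\le n-1$ (for $D_n^{(1)}$: $1\le i\le n-2$) $\tilde e_i$: $b_i\to b_i+1$, $b_{i+1}\to b_{i+1}-1$ if $b_{i+1}>\bar b_{i+1}$; $\bar b_{i+1}\to\bar b_{i+1}+1$, $\bar b_i\to\bar b_i-1$ if $b_{i+1}\le\bar b_{i+1}$; $\mathrm{wt}_i=b_i-\bar b_i+\bar b_{i+1}-b_{i+1}$; $\varepsilon_i=\bar b_i+(b_{i+1}-\bar b_{i+1})_+$. For $B_n^{(1)},D_n^{(1)},A_{2n-1}^{(2)}$: $\tilde e_0$: $b_2\to b_2-1$, $\bar b_1\to\bar b_1+1$ if $b_2>\bar b_2$; $b_1\to b_1-1$, $\bar b_2\to\bar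 b_2+1$ if $b_2\le\bar b_2$; $\mathrm{wt}_0=\bar b_1-b_1+\bar b_2-b_2$; $\varepsilon_0=b_1+(b_2-\bar b_2)_+$. For $D_{n+1}^{(2)},A_{2n}^{(2)}$: $\tilde e_0$: $b_1\to b_1-1$ if $b_1>\bar b_1$; $\bar b_1\to\bar b_1+1$ if $b_1\le\bar b_1$; $\mathrm{wt}_0=2(\bar b_1-b_1)$; $\varepsilon_0=-l(b)+2(b_1-\bar b_1)_+$. Underlying sets and remaining data: - $B_\infty(B_n^{(1)})$: $b_i,\bar b_i\in\mathbb Z$ ($i<n$), $b_n,\bar b_n\in\frac12\mathbb Z$, $b_n+\bar b_n\in\mathbb Z$, $l(b)=0$; $\tilde e_n$: $b_n\to b_n+\frac12$, $\bar b_n\to\bar b_n-\frac12$; $\mathrm{wt}_n=2(b_n-\bar b_n)$, $\varepsilon_n=2\bar b_n$. - $B_\infty(D_{n+1}^{(2)})$: as for $B_n^{(1)}$ without the condition $l(b)=0$; same $\tilde e_n,\mathrm{wt}_n,\varepsilon_n$. - $B_\infty(A_{2n-1}^{(2)})$: $b\in\mathbb Z^{2n}$, $l(b)=0$; $\tilde e_n$: $b_n\to b_n+1$, $\bar b_n\to\bar b_n-1$; $\mathrm{wt}_n=b_n-\bar b_n$, $\varepsilon_n=\bar b_n$. - $B_\infty(A_{2n}^{(2)})$: $b\in\mathbb Z^{2n}$; $\tilde e_n,\mathrm{wt}_n,\varepsilon_n$ as for $A_{2n-1}^{(2)}$. - $B_\infty(C_n^{(1)})$: $b\in\mathbb Z^{2n}$,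 $l(b)\in2\mathbb Z$; $\tilde e_n,\mathrm{wt}_n,\varepsilon_n$ as for $A_{2n-1}^{(2)}$; $\tilde e_0$: $b_1\to b_1-2$ if $b_1>\bar b_1+1$; $b_1\to b_1-1,\ \bar b_1\to\bar b_1+1$ if $b_1=\bar b_1+1$; $\bar b_1\to\bar b_1+2$ if $b_1\le\bar b_1$; $\mathrm{wt}_0=\bar b_1-b_1$; $\varepsilon_0=-\frac12l(b)+(b_1-\bar b_1)_+$. - $B_\infty(D_n^{(1)})$: $(b_1,\dots,b_n,\bar b_{n-1},\dots,\bar b_1)\in\mathbb Z^{2n-1}$ with $\sum_{i=1}^nb_i+\sum_{i=1}^{n-1}\bar b_i=0$; $\tilde e_{n-1}$: $b_{n-1}\to b_{n-1}+1$, $b_n\to b_n-1$; $\tilde e_n$: $b_n\to b_n+1$, $\bar b_{n-1}\to\bar b_{n-1}-1$; $\mathrm{wt}_{n-1}=b_{n-1}-\bar b_{n-1}-b_n$, $\mathrm{wt}_n=b_{n-1}-\bar b_{n-1}+b_n$; $\varepsilon_{n-1}=b_n+\bar b_{n-1}$, $\varepsilon_n=\bar b_{n-1}$. *)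

(* Defs.v *)
From HB Require Import structures.
From mathcomp Require Import all_boot all_order all_algebra.
From mathcomp Require Import boolp classical_sets functions reals.
From mathcomp Require Import complex mpoly.

Set Implicit Arguments.
Unset Strict Implicit.
Unset Printing Implicit Defensive.

Import Order.TTheory GRing.Theory Num.Theory.

Local Open Scope ring_scope.

(* A_n^(1), B_n^(1), C_n^(1), D_n^(1), A_{2n-1}^(2), D_{n+1}^(2),
   A_{2n}^(2)-dagger and A_{2n}^(2); the index set is I = {0, ..., n}. *)
Inductive affine_type := A1 | B1 | C1 | D1 | A2odd | D2 | A2dag | A2even.

(* A_{2n}^(2) occurs only as the dual of A_{2n}^(2)-dagger. *)
Definition admissible (t : affine_type) (n : nat) : bool :=
  match t with
  | A1 => (2 <= n)%N
  | B1 => (3 <= n)%N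
  | C1 => (2 <= n)%N
  | D1 => (4 <= n)%N
  | A2odd => (3 <= n)%N
  | D2 => (2 <= n)%N
  | A2dag => (2 <= n)%N
  | A2even => false
  end.

Definition langlands (t : affine_type) : affine_type :=
  match t with
  | A1 => A1
  | B1 => A2odd
  | C1 => D2
  | D1 => D1
  | A2odd => B1
  | D2 => C1
  | A2dag => A2even
  | A2even => A2dag
  end.

(* The edges of the Dynkin diagram, each listed in one direction only. *)
Definition edge (t : affine_type) (n i j : nat) : bool :=
  match t with
  | A1 => [&& (i <= n)%N, (j <= n)%N & j == (i.+1 %% n.+1)%N]
  | B1 | A2odd =>
      ((i, j) == (0, 2)%N) || [&& (1 <= i)%N, (i <= n.-1)%N & j == i.+1]
  | D1 =>
      [|| (i, j) == (0, 2)%N, [&& (1 <= i)%N, (i <= n.-2)%N & j == i.+1]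
        | (i, j) == (n.-2, n)]
  | C1 | D2 | A2dag | A2even => (i <= n.-1)%N && (j == i.+1)
  end.

Definition minus_two_entries (t : affine_type) (n : nat) : seq (nat * nat) :=
  match t with
  | A1 | D1 => [::]
  | B1 => [:: (n, n.-1)]
  | A2odd => [:: (n.-1, n)]
  | C1 => [:: (1, 0); (n.-1, n)]%N
  | D2 => [:: (0, 1); (n, n.-1)]%N
  | A2dag => [:: (1, 0); (n, n.-1)]%N
  | A2even => [:: (0, 1); (n.-1, n)]%N
  end.

Definition cartan (t : affine_type) (n i j : nat) : int :=
  if i == j then 2
  else if edge t n i j || edge t n j i then
    (if (i, j) \in minus_two_entries t n then -2 else -1)
  else 0.

(* For the module, [V i], [Vb i], [V 0], [Phi] are the basis vectors v_i,
   v_{bar i}, v_0, phi; for B_infinity, [V i] and [Vb i] are the coordinates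
   b_i and bar b_i. *)
Inductive label := V of nat | Vb of nat | Phi.

Definition label_code (l : label) : nat + nat + unit :=
  match l with V i => inl (inl i) | Vb i => inl (inr i) | Phi => inr tt end.

Definition label_decode (s : nat + nat + unit) : label :=
  match s with inl (inl i) => V i | inl (inr i) => Vb i | inr _ => Phi end.

Lemma label_codeK : cancel label_code label_decode.
Proof. by case. Qed.

HB.instance Definition _ := Countable.copy label (can_type label_codeK).

Definition basis_labels (t : affine_type) (n : nat) : seq label :=
  let up := [seq V i | i <- iota 1 n] in
  let down := [seq Vb i | i <- rev (iota 1 n)] in
  match t with
  | A1 => [seq V i | i <- iota 1 n.+1]
  | B1 | A2dag => up ++ V 0 :: down
  | D2 => up ++ [:: V 0, Phi & down]
  | C1 | D1 | A2odd => up ++ down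
  | A2even => [::]
  end.

(* The coefficient of Lambda_i in Lambda_j, that is <alpha_i^vee, Lambda_j>. *)
Definition Lambda (j i : nat) : int := (i == j)%:R.

(* <alpha_i^vee, wt(v_k)> for k >= 1 *)
Definition wtV (t : affine_type) (n k i : nat) : int :=
  let std := Lambda k i - Lambda k.-1 i in
  match t with
  | A1 => if k == n.+1 then Lambda 0 i - Lambda n i else std
  | B1 => if k == 2%N then Lambda 2 i - Lambda 1 i - Lambda 0 i
          else if k == n then 2 * Lambda n i - Lambda n.-1 i else std
  | D1 => if k == 2%N then Lambda 2 i - Lambda 1 i - Lambda 0 i
          else if k == n.-1
               then Lambda n.-1 i + Lambda n i - Lambda n.-2 i else std
  | A2odd => if k == 2%N then Lambda 2 i - Lambda 1 i - Lambda 0 i else std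
  | D2 => if k == 1%N then Lambda 1 i - 2 * Lambda 0 i
          else if k == n then 2 * Lambda n i - Lambda n.-1 i else std
  | A2dag => if k == n then 2 * Lambda n i - Lambda n.-1 i else std
  | C1 | A2even => std
  end.

(* <alpha_i^vee, wt(v_l)> *)
Definition wt_label (t : affine_type) (n : nat) (l : label) (i : nat) : int :=
  match l with
  | V 0 | Phi => 0
  | V k => wtV t n k i
  | Vb k => - wtV t n k i
  end.

(* [Some (k, l')] stands for f_i v_l = k v_{l'}, [None] for f_i v_l = 0. *)
Definition f0_label (t : affine_type) (l : label) : option (nat * label) :=
  match t, l with
  | (B1 | D1 | A2odd), Vb 2 => Some (1%N, V 1)
  | (B1 | D1 | A2odd), Vb 1 => Some (1%N, V 2)
  | (C1 | A2dag), Vb 1 => Some (1%N, V 1)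
  | D2, Vb 1 => Some (1%N, Phi)
  | D2, Phi => Some (2%N, V 1)
  | _, _ => None
  end.

Definition fn_label (t : affine_type) (n : nat) (l : label) :
    option (nat * label) :=
  match t with
  | B1 | D2 | A2dag =>
      if l == V n then Some (1%N, V 0)
      else if l == V 0 then Some (2%N, Vb n) else None
  | C1 | A2odd => if l == V n then Some (1%N, Vb n) else None
  | D1 => if l == V n then Some (1%N, Vb n.-1)
          else if l == V n.-1 then Some (1%N, Vb n) else None
  | A1 | A2even => None
  end.

Definition f_label (t : affine_type) (n i : nat) (l : label) :
    option (nat * label) :=
  match t with
  | A1 => if i == 0%N then (if l == V n.+1 then Some (1%N, V 1) else None)
          else if l == V i then Some (1%N, V i.+1) else None
  | _ => if i == 0%N then f0_label t l
         else if i == n then fn_label t n l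
         else if l == V i then Some (1%N, V i.+1)
         else if l == Vb i.+1 then Some (1%N, Vb i) else None
  end.

(* the coefficient of v_{l'} in f_i v_l *)
Definition f_coef (t : affine_type) (n i : nat) (l l' : label) : nat :=
  if f_label t n i l is Some (k, l1) then (if l1 == l' then k else 0%N)
  else 0%N.

Definition word1 (t : affine_type) (n : nat) : seq nat :=
  match t with
  | A1 => rev (iota 1 n)
  | B1 | A2odd => iota 1 n ++ rev (iota 1 n.-1)
  | D1 => iota 1 n ++ rev (iota 1 n.-2)
  | C1 | D2 | A2dag => iota 0 n.+1 ++ rev (iota 1 n.-1)
  | A2even => [::]
  end.

(* The codomain of sigma-bar is V(g), parametrized through i_1, except for
   A_{2n}^(2)-dagger, where it is V_2(g), parametrized through i_2. *)
Definition word2 (t : affine_type) (n : nat) : seq nat :=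
  match t with
  | A2dag => rev (iota 0 n.+1) ++ iota 1 n.-1
  | _ => word1 t n
  end.

Definition start2 (t : affine_type) (n : nat) : label :=
  match t with A2dag => Vb n | _ => V 1 end.

(* For A_{2n}^(2)-dagger, where there is no automorphism, both [sigma] and
   [sigma_label] are the identity. *)
Definition sigma (t : affine_type) (n i : nat) : nat :=
  match t with
  | A1 => (i.+1 %% n.+1)%N
  | B1 | D1 | A2odd => match i with 0 => 1%N | 1 => 0%N | _ => i end
  | C1 | D2 => (n - i)%N
  | A2dag | A2even => i
  end.

Definition sigma_label (t : affine_type) (n : nat) (l : label) : label :=
  match t, l with
  | A1, V i => if i == n.+1 then V 1 else V i.+1
  | (B1 | D1 | A2odd), V 1 => Vb 1
  | (B1 | D1 | A2odd), Vb 1 => V 1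
  | (C1 | D2), V 0 => Phi
  | (C1 | D2), Phi => V 0
  | (C1 | D2), V i => Vb (n.+1 - i)
  | (C1 | D2), Vb i => V (n.+1 - i)
  | _, _ => l
  end.

Section Module.

Context (C : numClosedFieldType) (t : affine_type) (n : nat).

Definition basis : finType := seq_sub (basis_labels t n).

Definition W : Type := {ffun basis -> C^o}.

Definition vect (l : label) : W := [ffun b => (ssval b == l)%:R].

Definition f_op (i : nat) (u : W) : W :=
  [ffun b => \sum_b' (f_coef t n i (ssval b') (ssval b))%:R * u b'].

(* exp (a f_i); the f_i are nilpotent, so the exponential series stops before
   the dimension of W. *)
Definition exp_f (i : nat) (a : C) (u : W) : W :=
  \sum_(k < #|basis|) (a ^+ k / (k`!)%:R) *: iter k (f_op i) u.

Definition coroot (i : nat) (c : C) (u : W) : W :=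
  [ffun b => c ^ wt_label t n (ssval b) i * u b].

Definition Y (i : nat) (c : C) (u : W) : W := exp_f i c^-1 (coroot i c u).

Definition sigma_W (u : W) : W :=
  [ffun b => \sum_(b' | sigma_label t n (ssval b') == ssval b) u b'].

(* Y_{i_1}(x_1) ... Y_{i_k}(x_k) v_l for the word w = (i_1, ..., i_k) *)
Definition orbit_point (w : seq nat) (l : label) (x : 'I_(size w) -> C) : W :=
  foldr (fun m u => Y (tnth (in_tuple w) m) (x m) u) (vect l)
    (enum 'I_(size w)).

End Module.

Definition cons_pt (T : Type) (k : nat) (a : T) (x : 'I_k -> T) :
    'I_k.+1 -> T :=
  fun j => oapp x a (unlift ord0 j).

Definition head_pt (T : Type) (k : nat) (z : 'I_k.+1 -> T) : T := z ord0.

Definition tail_pt (T : Type) (k : nat) (z : 'I_k.+1 -> T) : 'I_k -> T :=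
  fun j => z (lift ord0 j).

Section RationalMaps.

Context (C : numClosedFieldType).

Definition torus (k : nat) (x : 'I_k -> C) : Prop := forall j, x j != 0.

Definition generically (k : nat) (P : ('I_k -> C) -> Prop) : Prop :=
  exists2 h : {mpoly C[k]}, h != 0
    & forall x, torus x -> h.@[x] != 0 -> P x.

(* Rational functions and rational maps on tori are given by graphs, which are
   only meaningful up to a proper Zariski closed subset of the source. *)
Definition ratfun (k : nat) : Type := ('I_k -> C) -> C -> Prop.
Definition ratmap (k m : nat) : Type := ('I_k -> C) -> ('I_m -> C) -> Prop.

(* the composite of f with the character chi of the target torus *)
Definition char_comp (k m : nat) (chi : 'I_m -> int) (f : ratmap k m) :
    ratfun k :=
  fun x z => exists2 y, f x y & z = \prod_j y j ^ chi j.

Definition pos_mpoly (k : nat) (P : {mpoly C[k]}) : Prop :=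
  P != 0 /\ forall m, 0 <= P@_m.

(* P / Q is an expression of g as a ratio of polynomials with positive
   coefficients *)
Definition pos_expr (k : nat) (g : ratfun k) (P Q : {mpoly C[k]}) : Prop :=
  [/\ pos_mpoly P, pos_mpoly Q
    & generically (fun x => forall z, g x z <-> z = P.@[x] / Q.@[x])].

(* g is a nonzero rational function of one variable, with a pole of order d at
   infinity; it is given by its values outside a finite set. *)
Definition pole_degree (g : C -> C) (d : int) : Prop :=
  exists p q : {poly C}, [/\ p != 0, q != 0,
    exists s : seq C, forall c, c \notin s -> g c = p.[c] / q.[c]
    & d = (size p)%:Z - (size q)%:Z].

(* A cocharacter xi is given by its exponents: xi(c) = (c^xi_1, ..., c^xi_k). *)
Definition cochar_pt (k : nat) (xi : 'I_k -> int) (c : C) : 'I_k -> C :=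
  fun j => c ^ xi j.

(* g is positive and deg (g o xi) = d *)
Definition is_ud (k : nat) (g : ratfun k) (xi : 'I_k -> int) (d : int) :
    Prop :=
  exists P Q : {mpoly C[k]}, pos_expr g P Q /\
    pole_degree (fun c => P.@[cochar_pt xi c] / Q.@[cochar_pt xi c]) d.

(* [xget] selects an element of the set; its first argument is the value taken
   on the empty set, which is irrelevant when g and f are positive rational. *)
Definition ud_fun (k : nat) (g : ratfun k) (xi : 'I_k -> int) : int :=
  xget 0 [set d | is_ud g xi d]%classic.

Definition ud_map (k m : nat) (f : ratmap k m) (xi : 'I_k -> int) :
    'I_m -> int :=
  xget (fun=> 0) [set eta | forall chi : 'I_m -> int,
    is_ud (char_comp chi f) xi (\sum_j chi j * eta j)]%classic.

End RationalMaps.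

Section GeometricCrystal.

Context (C : numClosedFieldType) (t : affine_type) (n : nat).

Section Word.

Context (w : seq nat).
Local Notation k := (size w).
Local Notation letter m := (tnth (in_tuple w) m).

Definition P_term (i : nat) (x : 'I_k -> C) (m : 'I_k) : C :=
  ((\prod_(l < k | (l < m)%N) x l ^ cartan t n (letter l) i) * x m)^-1.

Definition P_sum (i : nat) (x : 'I_k -> C) (A : pred 'I_k) : C :=
  \sum_(m < k | (letter m == i) && A m) P_term i x m.

Definition eps_word (i : nat) (x : 'I_k -> C) : C := P_sum i x xpredT.

Definition gamma_word (i : nat) (x : 'I_k -> C) : C :=
  \prod_(l < k) x l ^ cartan t n (letter l) i.

Definition e_num (i : nat) (c : C) (x : 'I_k -> C) (j : 'I_k) : C :=
  c * P_sum i x (fun m => (m <= j)%N) + P_sum i x (fun m => (j < m)%N).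

Definition e_den (i : nat) (c : C) (x : 'I_k -> C) (j : 'I_k) : C :=
  c * P_sum i x (fun m => (m < j)%N) + P_sum i x (fun m => (j <= m)%N).

(* (c, x) |-> e_i^c(x) *)
Definition e_word (i : nat) : ratmap C k.+1 k := fun z x' =>
  let c := head_pt z in let x := tail_pt z in
  [/\ torus z, torus x' & forall j,
    e_den i c x j != 0 /\ x' j = x j * (e_num i c x j / e_den i c x j)].

End Word.

Definition v1_pt (x : 'I_(size (word1 t n)) -> C) : W C t n :=
  orbit_point t n (V 1) x.

Definition v2_pt (y : 'I_(size (word2 t n)) -> C) : W C t n :=
  orbit_point t n (start2 t n) y.

(* The condition on the eps_i is absent for A_{2n}^(2)-dagger. *)
Definition sigma_bar : ratmap C (size (word1 t n)) (size (word2 t n)) :=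
  fun x y => [/\ torus x, torus y,
    exists a : C, v2_pt y = a *: sigma_W (v1_pt x)
    & t <> A2dag -> forall i, (1 <= i <= n)%N -> sigma t n i != 0%N ->
        eps_word (sigma t n i) y = eps_word i x].

Definition e_rat (i : nat) :
    ratmap C (size (word1 t n)).+1 (size (word1 t n)) :=
  if i == 0%N then fun z x' => exists y y',
    [/\ sigma_bar (tail_pt z) y,
        e_word (sigma t n 0) (cons_pt (head_pt z) y) y'
      & sigma_bar x' y']
  else e_word (w := word1 t n) i.

Definition gamma_rat (i : nat) : ratfun C (size (word1 t n)) :=
  if i == 0%N then
    fun x a => exists2 y, sigma_bar x y & a = gamma_word (sigma t n 0) y
  else fun x a => a = gamma_word i x.

Definition eps_rat (i : nat) : ratfun C (size (word1 t n)) :=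
  if i == 0%N then
    fun x a => exists2 y, sigma_bar x y & a = eps_word (sigma t n 0) y
  else fun x a => a = eps_word i x.

End GeometricCrystal.

(* Crystals with bijective e_i. The underlying set is a subset of an ambient
   type, and wt_i, eps_i are allowed to be rational so that half-integral
   coordinates need no coercion. *)
Record crystal (n : nat) := Crystal {
  cr_type : choiceType;
  cr_set : set cr_type;
  cr_e : 'I_n.+1 -> cr_type -> cr_type;
  cr_wt : 'I_n.+1 -> cr_type -> rat;
  cr_eps : 'I_n.+1 -> cr_type -> rat }.

(* f_i is the inverse of e_i on the underlying set *)
Definition cr_f (n : nat) (B : crystal n) (i : 'I_n.+1) :
    cr_type B -> cr_type B :=
  fun b => xget b [set b' | cr_set b' /\ cr_e i b' = b]%classic.

Definition cr_phi (n : nat) (B : crystal n) (i : 'I_n.+1) (b : cr_type B) :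
    rat :=
  cr_eps i b + cr_wt i b.

Definition crystal_iso (n : nat) (B B' : crystal n) : Prop :=
  exists2 Psi : cr_type B -> cr_type B', set_bij (@cr_set n B) (@cr_set n B') Psi
    & forall (i : 'I_n.+1) (b : cr_type B), cr_set b ->
      [/\ Psi (cr_e i b) = cr_e i (Psi b),
          Psi (cr_f i b) = cr_f i (Psi b),
          cr_wt i (Psi b) = cr_wt i b,
          cr_eps i (Psi b) = cr_eps i b
        & cr_phi i (Psi b) = cr_phi i b].

Definition UD_V (C : numClosedFieldType) (t : affine_type) (n : nat) :
    crystal n :=
  {| cr_type := ('I_(size (word1 t n)) -> int);
     cr_set := setT;
     cr_e := fun i xi => ud_map (@e_rat C t n i) (cons_pt 1 xi);
     cr_wt := fun i xi => (ud_fun (@gamma_rat C t n i) xi)%:~R;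
     cr_eps := fun i xi => (ud_fun (@eps_rat C t n i) xi)%:~R |}.

Definition coords : Type := label -> rat.

Definition add_at (b : coords) (l : label) (d : rat) : coords :=
  fun l' => b l' + (if l' == l then d else 0).

Definition posp (u : rat) : rat := Num.max u 0.

Definition coord_labels (t : affine_type) (n : nat) : seq label :=
  match t with
  | A1 => [seq V i | i <- iota 1 n.+1]
  | D1 => [seq V i | i <- iota 1 n] ++ [seq Vb i | i <- rev (iota 1 n.-1)]
  | _ => [seq V i | i <- iota 1 n] ++ [seq Vb i | i <- rev (iota 1 n)]
  end.

Definition len (n : nat) (b : coords) : rat :=
  \sum_(1 <= i < n.+1) (b (V i) + b (Vb i)).

Definition all_int (b : coords) : Prop := forall l, b l \is a Num.int.

Definition half_int_at (n : nat) (b : coords) : Prop :=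
  [/\ forall i, (1 <= i < n)%N ->
        b (V i) \is a Num.int /\ b (Vb i) \is a Num.int,
      2 * b (V n) \is a Num.int, 2 * b (Vb n) \is a Num.int
    & b (V n) + b (Vb n) \is a Num.int].

(* Coordinates that do not occur are set to 0; for D_n^(1) this gives
   bar b_n = 0, so that [len] is the sum of all coordinates. There is no
   B_infinity for A_{2n}^(2)-dagger here, since it is not the dual of one of
   the types considered. *)
Definition Binf_set (t : affine_type) (n : nat) (b : coords) : Prop :=
  (forall l, l \notin coord_labels t n -> b l = 0) /\
  match t with
  | A1 => all_int b /\ \sum_(1 <= i < n.+2) b (V i) = 0
  | B1 => half_int_at n b /\ len n b = 0
  | D2 => half_int_at n b
  | D1 | A2odd => all_int b /\ len n b = 0
  | A2even => all_int b
  | C1 => all_int b /\ len n b / 2 \is a Num.int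
  | A2dag => False
  end.

Definition Binf_e0 (t : affine_type) (b : coords) : coords :=
  match t with
  | B1 | D1 | A2odd =>
      if b (Vb 2) < b (V 2) then add_at (add_at b (V 2) (-1)) (Vb 1) 1
      else add_at (add_at b (V 1) (-1)) (Vb 2) 1
  | D2 | A2even =>
      if b (Vb 1) < b (V 1) then add_at b (V 1) (-1) else add_at b (Vb 1) 1
  | C1 =>
      if b (Vb 1) + 1 < b (V 1) then add_at b (V 1) (-2)
      else if b (V 1) == b (Vb 1) + 1
           then add_at (add_at b (V 1) (-1)) (Vb 1) 1
      else add_at b (Vb 1) 2
  | A1 | A2dag => b
  end.

Definition Binf_en (t : affine_type) (n : nat) (b : coords) : coords :=
  match t with
  | B1 | D2 => add_at (add_at b (V n) (1 / 2)) (Vb n) (- (1 / 2))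
  | C1 | A2odd | A2even => add_at (add_at b (V n) 1) (Vb n) (-1)
  | D1 => add_at (add_at b (V n) 1) (Vb n.-1) (-1)
  | A1 | A2dag => b
  end.

Definition Binf_ei (t : affine_type) (n i : nat) (b : coords) : coords :=
  match t with
  | A1 => if i == 0%N then add_at (add_at b (V 1) (-1)) (V n.+1) 1
          else add_at (add_at b (V i) 1) (V i.+1) (-1)
  | _ => if i == 0%N then Binf_e0 t b
         else if i == n then Binf_en t n b
         else if (if t is D1 then i == n.-1 else false)
              then add_at (add_at b (V n.-1) 1) (V n) (-1)
         else if b (Vb i.+1) < b (V i.+1)
              then add_at (add_at b (V i) 1) (V i.+1) (-1)
         else add_at (add_at b (Vb i.+1) 1) (Vb i) (-1)
  end.

Definition Binf_wt0 (t : affine_type) (b : coords) : rat :=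
  match t with
  | B1 | D1 | A2odd => b (Vb 1) - b (V 1) + b (Vb 2) - b (V 2)
  | D2 | A2even => 2 * (b (Vb 1) - b (V 1))
  | C1 => b (Vb 1) - b (V 1)
  | A1 | A2dag => 0
  end.

Definition Binf_wtn (t : affine_type) (n : nat) (b : coords) : rat :=
  match t with
  | B1 | D2 => 2 * (b (V n) - b (Vb n))
  | C1 | A2odd | A2even => b (V n) - b (Vb n)
  | D1 => b (V n.-1) - b (Vb n.-1) + b (V n)
  | A1 | A2dag => 0
  end.

Definition Binf_wt (t : affine_type) (n i : nat) (b : coords) : rat :=
  match t with
  | A1 => if i == 0%N then b (V n.+1) - b (V 1) else b (V i) - b (V i.+1)
  | _ => if i == 0%N then Binf_wt0 t b
         else if i == n then Binf_wtn t n b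
         else if (if t is D1 then i == n.-1 else false)
              then b (V n.-1) - b (Vb n.-1) - b (V n)
         else b (V i) - b (Vb i) + b (Vb i.+1) - b (V i.+1)
  end.

Definition Binf_eps0 (t : affine_type) (n : nat) (b : coords) : rat :=
  match t with
  | B1 | D1 | A2odd => b (V 1) + posp (b (V 2) - b (Vb 2))
  | D2 | A2even => - len n b + 2 * posp (b (V 1) - b (Vb 1))
  | C1 => - (1 / 2) * len n b + posp (b (V 1) - b (Vb 1))
  | A1 | A2dag => 0
  end.

Definition Binf_epsn (t : affine_type) (n : nat) (b : coords) : rat :=
  match t with
  | B1 | D2 => 2 * b (Vb n)
  | C1 | A2odd | A2even => b (Vb n)
  | D1 => b (Vb n.-1)
  | A1 | A2dag => 0
  end.

Definition Binf_eps (t : affine_type) (n i : nat) (b : coords) : rat :=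
  match t with
  | A1 => if i == 0%N then b (V 1) else b (V i.+1)
  | _ => if i == 0%N then Binf_eps0 t n b
         else if i == n then Binf_epsn t n b
         else if (if t is D1 then i == n.-1 else false)
              then b (V n) + b (Vb n.-1)
         else b (Vb i) + posp (b (V i.+1) - b (Vb i.+1))
  end.

Definition Binf (t : affine_type) (n : nat) : crystal n :=
  {| cr_type := (label -> rat);
     cr_set := Binf_set t n : set (label -> rat);
     cr_e := fun i b => Binf_ei t n i b;
     cr_wt := fun i b => Binf_wt t n i b;
     cr_eps := fun i b => Binf_eps t n i b |}.

(* Main.v *)
(** Label the occurrences of a letter i in the word by [V i] and [Vb i]; a point
    of the torus is then a function g of labels. With X_i = g (V i) g (Vb i)
    (suitably modified at the end nodes), the vector v(x) has the coordinates
    (X_{i-1} + X_i) / g (V (i-1)) and g (V (i-1)), from which sigma-bar, and hence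
    e_0, eps_0 and gamma_0, are computed in closed form. At an inner node e_i^c
    multiplies g (V i) by rho = (c X_i + X_{i+1}) / (X_i + X_{i+1}) and g (Vb i) by
    c / rho.

    Everything is free of subtractions, so it can be tropicalized term by term.
    Writing u_i and ub_i for the tropical coordinates, normalized such that
    u_i + ub_i is the tropical X_i, the isomorphism is b_i = ub_i - ub_{i-1},
    bar b_i = u_{i-1} - u_i: the branch of e_i on B_infinity is decided by the sign
    of b_{i+1} - bar b_{i+1} = X_{i+1} - X_i, as it is for the tropical rho. For
    A_n^(1) one takes b_i = u_i - u_{i-1} instead. *)

(* Outside A_n^(1) there are two kinds of diagrams, told apart by [p0]: a fork at node 0, where
   sigma-bar divides the coordinates by powers of X_1, and a line, where it reverses the diagram or,
   in the dagger case, passes to the second word. The vector v(x) yields only the sums X_{i-1} +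
   X_i, and these up to the square of an unknown scalar a. One single X_j has to be found
   separately; the others then follow by subtraction, which occurs only in proving uniqueness of the
   image, never in a formula to be tropicalized. For a line, e_0 is not obtained by inverting
   sigma-bar: the ratio r of the scalars before and after e_0^c satisfies a linear equation, and r
   determines everything. The dual type is visible in the lattice. The length l(b) equals u_0, which
   is [p0] times an integer, hence zero, arbitrary or even for [p0] = 0, 1, 2; and splitting the
   tropical X_n, which is [pn] times an integer, evenly between u_n and ub_n produces half-integers
   exactly when [pn] = 1. *)
From HB Require Import structures.
From mathcomp Require Import all_boot all_order all_algebra.
From mathcomp Require Import boolp classical_sets functions reals.
From mathcomp Require Import complex mpoly zify ring lra.
Require Import Defs.

Set Implicit Arguments.
Unset Strict Implicit.
Unset Printing Implicit Defensive.

Import Order.TTheory GRing.Theory Num.Theory.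

Local Open Scope ring_scope.

(** * Positive rational functions and their degrees *)

Section PoleDegree.

Context (C : numClosedFieldType).

Lemma lead_coef_add_gt0 (p q : {poly C}) :
  0 < lead_coef p -> 0 < lead_coef q ->
  0 < lead_coef (p + q) /\ size (p + q) = maxn (size p) (size q).
Proof.
move=> p0 q0; case: (ltngtP (size p) (size q)) => H.
- by rewrite addrC lead_coefDl // size_polyDl.
- by rewrite lead_coefDl // size_polyDl.
have pn0 : p != 0 by rewrite -lead_coef_eq0 gt_eqF.
have E : (p + q)`_(size q).-1 = lead_coef p + lead_coef q.
  by rewrite coefD /lead_coef H.
have S : size (p + q) = size q.
  apply/eqP; rewrite eqn_leq; apply/andP; split.
    by rewrite (leq_trans (size_polyD _ _)) // H maxnn.
  rewrite leqNgt; apply/negP => L.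
  have := addr_gt0 p0 q0; rewrite -E nth_default ?ltxx //.
  by case: (size q) L => //.
by split; [rewrite /lead_coef S E addr_gt0 | rewrite S H; lia].
Qed.

Lemma poly_neq0_cofinite (p : {poly C}) : p != 0 ->
  exists s : seq C, forall c, c \notin s -> p.[c] != 0.
Proof.
move=> p0; have [r E] := closed_field_poly_normal p.
exists r => c cr; rewrite -/(root p c) E rootZ ?lead_coef_eq0 //.
by rewrite root_prod_XsubC.
Qed.

Lemma notin_seq_ex (s : seq C) : exists c, c \notin s.
Proof.
(* This number is nonnegative and exceeds the absolute value of every member of [s]. *)
exists (1 + \sum_(x <- s) `|x|); apply/negP => cs.
have P0 : 0 <= \sum_(x <- s) `|x| by apply: sumr_ge0.
have : `|1 + \sum_(x <- s) `|x| | <= \sum_(x <- s) `|x|.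
  by rewrite [leRHS](big_rem _ cs) /= lerDl sumr_ge0.
by rewrite ger0_norm ?addr_ge0 // gerDr ler10.
Qed.

Lemma poly_cofinite_eq (p q : {poly C}) (s : seq C) :
  (forall c, c \notin s -> p.[c] = q.[c]) -> p = q.
Proof.
move=> H; apply/eqP; rewrite -subr_eq0; apply: contraT => pq.
have [r E] := poly_neq0_cofinite pq.
have [c] := notin_seq_ex (s ++ r); rewrite mem_cat negb_or => /andP[cs cr].
by have := E _ cr; rewrite hornerD hornerN H // subrr eqxx.
Qed.

(* The lead coefficients are positive, so that no cancellation occurs at
   infinity. *)
Definition pos_pole_degree (g : C -> C) (d : int) : Prop :=
  exists p q : {poly C}, [/\ 0 < lead_coef p, 0 < lead_coef q,
    exists s : seq C, forall c, c \notin s -> g c = p.[c] / q.[c]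
    & d = (size p)%:Z - (size q)%:Z].

Lemma lead_gt0_neq0 (p : {poly C}) : 0 < lead_coef p -> p != 0.
Proof. by move=> p0; rewrite -lead_coef_eq0 gt_eqF. Qed.

Lemma pole_degree_neq0 g d : pole_degree g d ->
  exists s : seq C, forall c, c \notin s -> g c != 0.
Proof.
case=> p [q [p0 q0 [s E] _]].
have [r1 E1] := poly_neq0_cofinite p0; have [r2 E2] := poly_neq0_cofinite q0.
exists (s ++ r1 ++ r2) => c; rewrite !mem_cat !negb_or => /and3P[cs c1 c2].
by rewrite E // mulf_neq0 ?invr_eq0 ?E1 ?E2.
Qed.

Lemma pos_pole_degreeW g d : pos_pole_degree g d -> pole_degree g d.
Proof.
by case=> p [q [p0 q0 S D]]; exists p, q; split=> //; exact: lead_gt0_neq0.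
Qed.

(** Off a finite set the two fractions agree, so cross-multiplication is an identity of polynomials,
    and comparing sizes gives an identity of degrees. The order of the pole is thus independent of
    the fraction chosen. *)
Lemma pole_degree_uniq g g' (s : seq C) d d' :
  (forall c, c \notin s -> g c = g' c) ->
  pole_degree g d -> pole_degree g' d' -> d = d'.
Proof.
move=> E [p [q [p0 q0 [r H] ->]]] [p' [q' [p'0 q'0 [r' H'] ->]]].
have [t Et] := poly_neq0_cofinite q0; have [t' Et'] := poly_neq0_cofinite q'0.
have : p * q' = p' * q.
  apply: (@poly_cofinite_eq _ _ (s ++ r ++ r' ++ t ++ t')) => c.
  rewrite !mem_cat !negb_or => /and5P[cs cr cr' ct ct'].
  have := E _ cs; rewrite H // H' // !hornerM => /eqP.
  by rewrite eqr_div ?Et ?Et' // => /eqP.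
move/(congr1 (fun p : {poly C} => size p)); rewrite !size_mul //.
move: p0 q0 p'0 q'0; rewrite -!size_poly_eq0 -!lt0n.
move: (size p) (size q) (size p') (size q') => a b a' b'.
by lia.
Qed.

Lemma pos_pole_degree_ext g g' d (s : seq C) :
  (forall c, c \notin s -> g c = g' c) ->
  pos_pole_degree g d -> pos_pole_degree g' d.
Proof.
move=> E [p [q [p0 q0 [r H] D]]]; exists p, q; split=> //.
by exists (s ++ r) => c; rewrite mem_cat negb_or => /andP[cs cr]; rewrite -E ?H.
Qed.

Lemma pos_pole_degree1 : pos_pole_degree (fun=> 1) 0.
Proof.
exists 1, 1; rewrite lead_coef1 ltr01 subrr; split=> //.
by exists [::] => c _; rewrite hornerC divr1.
Qed.

Lemma pos_pole_degreeV g d :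
  pos_pole_degree g d -> pos_pole_degree (fun c => (g c)^-1) (- d).
Proof.
case=> p [q [p0 q0 [s E] ->]]; exists q, p; split=> //; last by rewrite opprB.
by exists s => c cs; rewrite E // invf_div.
Qed.

Lemma pos_pole_degreeM g d g' d' :
  pos_pole_degree g d -> pos_pole_degree g' d' ->
  pos_pole_degree (fun c => g c * g' c) (d + d').
Proof.
case=> p [q [p0 q0 [s E] ->]] [p' [q' [p'0 q'0 [s' E'] ->]]].
exists (p * p'), (q * q'); rewrite !lead_coefM !mulr_gt0 //; split=> //.
  exists (s ++ s') => c; rewrite mem_cat negb_or => /andP[cs cs'].
  by rewrite E // E' // !hornerM mulf_div.
rewrite !size_mul ?lead_gt0_neq0 //.
move: (lead_gt0_neq0 p0) (lead_gt0_neq0 q0) (lead_gt0_neq0 p'0).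
move: (lead_gt0_neq0 q'0); rewrite -!size_poly_eq0 -!lt0n.
by move: (size p) (size q) (size p') (size q') => a b a' b'; lia.
Qed.

Lemma pos_pole_degreeD g d g' d' :
  pos_pole_degree g d -> pos_pole_degree g' d' ->
  pos_pole_degree (fun c => g c + g' c) (Num.max d d').
Proof.
case=> p [q [p0 q0 [s E] ->]] [p' [q' [p'0 q'0 [s' E'] ->]]].
have [t Et] := poly_neq0_cofinite (lead_gt0_neq0 q0).
have [t' Et'] := poly_neq0_cofinite (lead_gt0_neq0 q'0).
have [L S] : 0 < lead_coef (p * q' + p' * q) /\
    size (p * q' + p' * q) = maxn (size (p * q')) (size (p' * q)).
  by apply: lead_coef_add_gt0; rewrite lead_coefM mulr_gt0.
exists (p * q' + p' * q), (q * q'); rewrite lead_coefM mulr_gt0 //; split=> //.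
  exists (s ++ s' ++ t ++ t') => c.
  rewrite !mem_cat !negb_or => /and4P[cs cs' ct ct'].
  by rewrite E // E' // !hornerD !hornerM addf_div ?Et ?Et'.
rewrite S !size_mul ?lead_gt0_neq0 //.
move: (lead_gt0_neq0 p0) (lead_gt0_neq0 q0) (lead_gt0_neq0 p'0).
move: (lead_gt0_neq0 q'0); rewrite -!size_poly_eq0 -!lt0n.
by move: (size p) (size q) (size p') (size q') => a b a' b'; lia.
Qed.

Lemma pos_pole_degree_expz (a : int) : pos_pole_degree (fun c => c ^ a) a.
Proof.
have N (m : nat) : pos_pole_degree (fun c => c ^+ m) m%:Z.
  exists 'X^m, 1; rewrite lead_coefXn lead_coef1 ltr01 size_polyXn size_poly1.
  split=> //; last lia.
  by exists [::] => c _; rewrite hornerXn hornerC divr1.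
case: a => m; first exact: N.
by rewrite NegzE; apply: (pos_pole_degreeV (N m.+1)).
Qed.

End PoleDegree.

(** The lowest digit in base N is the remainder mod N, and induction treats the rest. This keeps
    distinct monomials apart when the powers c^(N^j) are substituted for the variables. *)
Lemma digits_inj (N k : nat) (a b : 'I_k -> nat) :
  (forall j, a j < N)%N -> (forall j, b j < N)%N ->
  (\sum_j a j * N ^ j = \sum_j b j * N ^ j)%N -> forall j, a j = b j.
Proof.
elim: k a b => [|k IH] a b aN bN; first by move=> _ [].
have E (d : 'I_k.+1 -> nat) :
  (\sum_j d j * N ^ j = (\sum_(j < k) d (lift ord0 j) * N ^ j) * N + d ord0)%N.
  rewrite big_ord_recl /= muln1 addnC big_distrl; congr (_ + _)%N.
  by apply: eq_bigr => j _; rewrite /bump /= add1n expnS -mulnA (mulnC N).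
rewrite !E => H; have N0 : (0 < N)%N by case: N aN {bN IH E H} => // /(_ ord0).
have H0 : a ord0 = b ord0.
  by move/(congr1 (modn^~ N)): (H); rewrite /= !modnMDl !modn_small.
move=> j; case: (unliftP ord0 j) => [i|] ->; last exact: H0.
apply: (IH (fun i => a (lift ord0 i)) (fun i => b (lift ord0 i))) => //.
by apply/eqP; rewrite -(eqn_pmul2r N0); apply/eqP; move: H; rewrite H0 => /addIn.
Qed.

(* Kronecker substitution. *)
Lemma mpoly_eval0 (C : numClosedFieldType) (k : nat) (P : {mpoly C[k]}) :
  (forall x, P.@[x] = 0) -> P = 0.
Proof.
(* [msize P] is larger than every exponent occurring in P, so [wt] is injective on the support and
   each coefficient of P reappears alone in [p]. *)
move=> H; pose N := msize P; pose wt (m : 'X_{1..k}) := (\sum_j m j * N ^ j)%N.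
pose p : {poly C} := \sum_(m <- msupp P) P@_m *: 'X^(wt m).
have p0 : p = 0.
  apply: (@poly_cofinite_eq _ _ _ [::]) => c _; rewrite horner0.
  rewrite -(H (fun j => c ^+ (N ^ j))) mevalE horner_sum; apply: eq_bigr => m _.
  rewrite hornerZ hornerXn /wt; congr (_ * _).
  rewrite -prodrXr; apply: eq_bigr => j _.
  by rewrite -exprM mulnC.
apply/mpolyP => m; rewrite mcoeff0.
case: (boolP (m \in msupp P)) => mP; last by rewrite memN_msupp_eq0.
have D m' j : m' \in msupp P -> (m' j < N)%N.
  move=> /msize_mdeg_lt; apply: leq_ltn_trans.
  by rewrite mdegE (bigD1 j) //= leq_addr.
have := congr1 (fun q : {poly C} => q`_(wt m)) p0.
rewrite coef0 coef_sum (big_rem _ mP) /= coefZ coefXn eqxx mulr1 big_seq big1.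
  by rewrite addr0.
move=> m'; rewrite mem_rem_uniq ?msupp_uniq // inE => /andP[m'm m'P].
rewrite coefZ coefXn; case: eqP => [W|]; last by rewrite mulr0.
case/eqP: m'm; apply/mnmP => j.
by apply: (digits_inj (N := N) (a := fun j => m' j) (b := fun j => m j)) => // i; exact: D.
Qed.

(** * Positive rational functions carried together with their tropicalizations *)

Section PositiveRational.

Context (C : numClosedFieldType).

Lemma generically_and k (P Q : ('I_k -> C) -> Prop) :
  generically P -> generically Q -> generically (fun x => P x /\ Q x).
Proof.
case=> h h0 HP [h' h'0 HQ]; exists (h * h'); first exact: mulf_neq0.
move=> x tx; rewrite mevalM mulf_eq0 negb_or => /andP[hx h'x].
by split; [exact: HP|exact: HQ].
Qed.

Lemma generically_impl k (P Q : ('I_k -> C) -> Prop) :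
  (forall x, torus x -> P x -> Q x) -> generically P -> generically Q.
Proof. by move=> PQ [h h0 HP]; exists h => // x tx hx; apply: PQ; auto. Qed.

Lemma generically_all k (P : ('I_k -> C) -> Prop) :
  (forall x, torus x -> P x) -> generically P.
Proof. by move=> H; exists 1; [exact: oner_neq0|auto]. Qed.

(** A function rather than a graph, with its degree [tau] along every cocharacter attached. Each
    closure property below then performs one step of the tropicalization: product to sum, inverse to
    opposite, sum to maximum. Numerator and denominator are generically nonzero, so that fractions
    can be inverted and added pointwise. *)
Definition posrat k (g : ('I_k -> C) -> C) (tau : ('I_k -> int) -> int) : Prop :=
  exists P Q : {mpoly C[k]}, [/\ pos_mpoly P, pos_mpoly Q,
    generically (fun x => [/\ P.@[x] != 0, Q.@[x] != 0 & g x = P.@[x] / Q.@[x]])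
    & forall xi, pos_pole_degree
        (fun c => P.@[cochar_pt xi c] / Q.@[cochar_pt xi c]) (tau xi)].

Lemma posrat_ext k (g g' : ('I_k -> C) -> C) (tau tau' : ('I_k -> int) -> int) :
  generically (fun x => g x = g' x) -> tau =1 tau' ->
  posrat g tau -> posrat g' tau'.
Proof.
move=> gg' tt' [P [Q [PP PQ G D]]]; exists P, Q; split=> //; last first.
  by move=> xi; rewrite -tt'.
by apply: generically_impl (generically_and gg' G) => x _ [<-].
Qed.

Lemma posrat_neq0 k g tau : @posrat k g tau -> generically (fun x => g x != 0).
Proof.
case=> P [Q [_ _ G _]]; apply: generically_impl G => x _ [P0 Q0 ->].
by rewrite mulf_neq0 ?invr_eq0.
Qed.

Lemma pos_mpolyD k (P Q : {mpoly C[k]}) :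
  pos_mpoly P -> pos_mpoly Q -> pos_mpoly (P + Q).
Proof.
move=> [P0 HP] [Q0 HQ]; split; last by move=> m; rewrite mcoeffD addr_ge0.
apply: contra P0 => /eqP PQ; apply/eqP/mpolyP => m; rewrite mcoeff0.
apply/eqP; rewrite eq_le HP andbT.
have := congr1 (mcoeff m) PQ; rewrite mcoeffD mcoeff0 => /eqP.
by rewrite addr_eq0 => /eqP ->; rewrite oppr_le0 HQ.
Qed.

Lemma pos_mpolyM k (P Q : {mpoly C[k]}) :
  pos_mpoly P -> pos_mpoly Q -> pos_mpoly (P * Q).
Proof.
move=> [P0 HP] [Q0 HQ]; split; first exact: mulf_neq0.
by move=> m; rewrite mcoeffM sumr_ge0 // => i _; rewrite mulr_ge0.
Qed.

Lemma pos_mpoly1 k : pos_mpoly (1 : {mpoly C[k]}).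
Proof. by split; [exact: oner_neq0|move=> m; rewrite mcoeff1 ler0n]. Qed.

Lemma pos_mpolyX k (j : 'I_k) : pos_mpoly ('X_j : {mpoly C[k]}).
Proof.
split; last by move=> m; rewrite mcoeffX ler0n.
by apply/eqP => /(congr1 (mcoeff U_(j))); rewrite mcoeffX eqxx mcoeff0 => /eqP;
  rewrite oner_eq0.
Qed.

Lemma posrat1 k : @posrat k (fun=> 1) (fun=> 0).
Proof.
exists 1, 1; split; try exact: pos_mpoly1.
  by apply: generically_all => x _; rewrite meval1 divr1 oner_neq0.
move=> xi; apply: (@pos_pole_degree_ext _ _ _ _ [::]) (pos_pole_degree1 C).
by move=> c _; rewrite meval1 divr1.
Qed.

Lemma posrat_var k (j : 'I_k) : posrat (fun x => x j) (fun xi => xi j).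
Proof.
exists 'X_j, 1; split; try by [exact: pos_mpoly1|exact: pos_mpolyX].
  by apply: generically_all => x tx; rewrite meval1 divr1 oner_neq0 mevalXU tx.
move=> xi; apply: (@pos_pole_degree_ext _ _ _ _ [::]) (pos_pole_degree_expz _ _).
by move=> c _; rewrite meval1 divr1 mevalXU.
Qed.

Lemma posratV k g tau : @posrat k g tau ->
  posrat (fun x => (g x)^-1) (fun xi => - tau xi).
Proof.
case=> P [Q [PP PQ G D]]; exists Q, P; split=> //.
  by apply: generically_impl G => x _ [P0 Q0 ->]; rewrite invf_div.
move=> xi; apply: (@pos_pole_degree_ext _ _ _ _ [::]) (pos_pole_degreeV (D xi)).
by move=> c _; rewrite invf_div.
Qed.

Lemma posratM k g tau g' tau' : @posrat k g tau -> @posrat k g' tau' ->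
  posrat (fun x => g x * g' x) (fun xi => tau xi + tau' xi).
Proof.
case=> P [Q [PP PQ G D]] [P' [Q' [PP' PQ' G' D']]].
exists (P * P'), (Q * Q'); split; try exact: pos_mpolyM.
  apply: generically_impl (generically_and G G') => x _ [[P0 Q0 ->] [P'0 Q'0 ->]].
  by rewrite !mevalM !mulf_neq0 // mulf_div.
move=> xi; apply: (@pos_pole_degree_ext _ _ _ _ [::]) (pos_pole_degreeM (D xi) (D' xi)).
by move=> c _; rewrite !mevalM mulf_div.
Qed.

Lemma posratD k g tau g' tau' : @posrat k g tau -> @posrat k g' tau' ->
  posrat (fun x => g x + g' x) (fun xi => Num.max (tau xi) (tau' xi)).
Proof.
case=> P [Q [PP PQ G D]] [P' [Q' [PP' PQ' G' D']]].
exists (P * Q' + P' * Q), (Q * Q'); split.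
- by apply: pos_mpolyD; apply: pos_mpolyM.
- exact: pos_mpolyM.
- have : generically (fun x => P.@[x] * Q'.@[x] + P'.@[x] * Q.@[x] != 0).
    exists (P * Q' + P' * Q).
      by case: (pos_mpolyD (pos_mpolyM PP PQ') (pos_mpolyM PP' PQ)).
    by move=> x _; rewrite mevalD !mevalM.
  move/generically_and/(_ (generically_and G G')); apply: generically_impl.
  move=> x _ [S [[P0 Q0 ->] [P'0 Q'0 ->]]].
  by rewrite !mevalD !mevalM addf_div // mulf_neq0.
(* Adding fractions needs nonzero denominators along the cocharacter. Since 0^-1 = 0, a vanishing
   denominator would make the fraction vanish, which happens for finitely many c only. *)
move=> xi; have [s Es] := pole_degree_neq0 (pos_pole_degreeW (D xi)).
have [s' Es'] := pole_degree_neq0 (pos_pole_degreeW (D' xi)).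
apply: (@pos_pole_degree_ext _ _ _ _ (s ++ s')) (pos_pole_degreeD (D xi) (D' xi)).
move=> c; rewrite mem_cat negb_or => /andP[/Es E /Es' E'].
rewrite !mevalD !mevalM addf_div //.
  by apply: contraNneq E => ->; rewrite invr0 mulr0.
by apply: contraNneq E' => ->; rewrite invr0 mulr0.
Qed.

Lemma posrat_expz k g tau (a : int) : @posrat k g tau ->
  posrat (fun x => g x ^ a) (fun xi => a * tau xi).
Proof.
move=> H.
have N (m : nat) : posrat (fun x => g x ^+ m) (fun xi => m%:Z * tau xi).
  elim: m => [|m IH].
    by apply: posrat_ext (posrat1 k) => [|xi]; [exact: generically_all|rewrite mul0r].
  apply: posrat_ext (posratM H IH) => [|xi].
    by apply: generically_all => x _; rewrite exprS.
  by rewrite intS mulrDl mul1r.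
case: a => m; first exact: N.
apply: posrat_ext (posratV (N m.+1)) => [|xi]; first exact: generically_all.
by rewrite NegzE mulNr.
Qed.

Lemma posrat_prod k (I : finType) (g : I -> ('I_k -> C) -> C) tau :
  (forall i, posrat (g i) (tau i)) ->
  posrat (fun x => \prod_i g i x) (fun xi => \sum_i tau i xi).
Proof.
move=> H; elim: (index_enum I) => [|i s IH].
  by apply: posrat_ext (posrat1 k) => [|xi];
    [apply: generically_all => x _|]; rewrite big_nil.
by apply: posrat_ext (posratM (H i) IH) => [|xi];
    [apply: generically_all => x _|]; rewrite big_cons.
Qed.

(** [is_ud] allows any positive expression of the function. Two expressions P / Q and P' / Q' agree
    generically, hence P' Q = P Q' as polynomials, and then they have the same degree along every
    cocharacter, even one that stays inside the exceptional locus of the generic statements. *)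
Lemma is_ud_posrat k (f : ratfun C k) g tau xi d : posrat g tau ->
  generically (fun x => forall z, f x z <-> z = g x) ->
  is_ud f xi d <-> d = tau xi.
Proof.
move=> [P [Q [PP PQ G D]]] F; split=> [|->]; last first.
  exists P, Q; split; last exact: pos_pole_degreeW.
  by split=> //; apply: generically_impl (generically_and G F) => x _ [[_ _ <-]].
case=> P' [Q' [[PP' PQ' [h h0 H]] D']].
have [h1 h10 H1] := generically_and G F.
have PQE : P' * Q = P * Q'.
  apply/eqP; rewrite -subr_eq0.
  (* Multiplication by the exceptional polynomials, by Q' and by the product of all variables
     reduces the check to generic points of the torus: at every other point one of these factors
     vanishes. *)
  pose X : {mpoly C[k]} := \prod_j 'X_j.
  have X0 : X != 0.
    apply/prodf_neq0 => j _; exact: (pos_mpolyX j).1.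
  suff : h * h1 * X * Q' * (P' * Q - P * Q') == 0.
    by rewrite !mulf_eq0 (negPf h0) (negPf h10) (negPf X0) (negPf PQ'.1).
  apply/eqP/mpoly_eval0 => x; rewrite !mevalM mevalB !mevalM.
  have [->|hx] := eqVneq h.@[x] 0; first by rewrite !mul0r.
  have [->|h1x] := eqVneq h1.@[x] 0; first by rewrite mulr0 !mul0r.
  have [->|Xx] := eqVneq X.@[x] 0; first by rewrite mulr0 !mul0r.
  have [->|Qx] := eqVneq Q'.@[x] 0; first by rewrite mulr0 !mul0r.
  have tx : torus x.
    move=> j; apply: contraNneq Xx => xj.
    by rewrite /X (bigD1 j) //= mevalM mevalXU xj mul0r.
  have [[P0 Q0 E] /(_ (g x)) [_ /(_ erefl)]] := H1 _ tx h1x.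
  move/(H _ tx hx); rewrite E => /eqP; rewrite eqr_div // => /eqP ->.
  by rewrite subrr mulr0.
have [s Es] := pole_degree_neq0 D'.
have [s' Es'] := pole_degree_neq0 (pos_pole_degreeW (D xi)).
apply: (pole_degree_uniq (s := s ++ s')) D' (pos_pole_degreeW (D xi)).
move=> c; rewrite mem_cat negb_or => /andP[/Es E /Es' E'].
apply/eqP; rewrite eqr_div.
- by rewrite -!mevalM PQE.
- by apply: contraNneq E => ->; rewrite invr0 mulr0.
- by apply: contraNneq E' => ->; rewrite invr0 mulr0.
Qed.

Lemma ud_funE k (f : ratfun C k) g tau xi : posrat g tau ->
  generically (fun x => forall z, f x z <-> z = g x) ->
  ud_fun f xi = tau xi.
Proof.
move=> G F; rewrite /ud_fun; apply: xget_unique.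
  by apply/(is_ud_posrat xi _ G F).
by move=> d /(is_ud_posrat xi _ G F).
Qed.

Lemma ud_mapE k m (f : ratmap C k m) (F : ('I_k -> C) -> 'I_m -> C)
    (T : ('I_k -> int) -> 'I_m -> int) xi :
  (forall j, posrat (fun x => F x j) (fun xi => T xi j)) ->
  generically (fun x => forall y, f x y <-> y = F x) ->
  ud_map f xi = T xi.
Proof.
move=> PF G.
have U chi d : is_ud (char_comp chi f) xi d <-> d = \sum_j chi j * T xi j.
  apply: (is_ud_posrat (g := fun x => \prod_j F x j ^ chi j)
                      (tau := fun xi => \sum_j chi j * T xi j)).
    by apply: posrat_prod => j; exact: posrat_expz.
  apply: generically_impl G => x _ E z; split=> [[y /E -> //]|->].
  by exists (F x) => //; apply/E.
rewrite /ud_map; apply: xget_unique => [chi|eta H]; first by apply/U.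
(* The coordinate characters already determine [eta]. *)
apply: funext => j; have /U := H (fun i => (i == j)%:Z).
rewrite (bigD1 j) //= eqxx mul1r big1 => [|i /negPf ->]; last by rewrite mul0r.
rewrite (bigD1 j) //= eqxx mul1r big1 => [|i /negPf ->]; last by rewrite mul0r.
by rewrite !addr0.
Qed.

End PositiveRational.

(** * Words and labels *)

(* The points of a torus indexed by the positions of a word are described as
   functions of labels: for a letter i of the word, [V i] is its first
   occurrence and [Vb i] its second one. *)
Definition lidx (l : label) : nat :=
  match l with V i | Vb i => i | Phi => 0%N end.

Definition pt (labs : seq label) (w : seq nat) (T : Type) (g : label -> T) :
    'I_(size w) -> T :=
  fun j => g (nth Phi labs j).

(** The default [d] is the value at labels outside the word: 1 on the torus and 0 after
    tropicalization, so that formulas may mention neighbours that do not occur. *)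
Definition coord (labs : seq label) (w : seq nat) (T : Type) (d : T)
    (x : 'I_(size w) -> T) (l : label) : T :=
  oapp x d (insub (index l labs)).

Lemma tail_cons_pt (T : Type) (k : nat) (a : T) (x : 'I_k -> T) :
  tail_pt (cons_pt a x) = x.
Proof. by apply: funext => j; rewrite /tail_pt /cons_pt liftK. Qed.

Lemma head_cons_pt (T : Type) (k : nat) (a : T) (x : 'I_k -> T) :
  head_pt (cons_pt a x) = a.
Proof. by rewrite /head_pt /cons_pt unlift_none. Qed.

Lemma cons_head_tail (T : Type) (k : nat) (z : 'I_k.+1 -> T) :
  cons_pt (head_pt z) (tail_pt z) = z.
Proof.
apply: funext => j; rewrite /cons_pt /head_pt /tail_pt.
by case: unliftP => [i|] ->.
Qed.

Lemma posrat_head (C : numClosedFieldType) (k : nat) :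
  posrat (@head_pt C k) (@head_pt int k).
Proof. exact: posrat_var. Qed.

Section Labels.

Context (labs : seq label) (w : seq nat).
Hypothesis labs_uniq : uniq labs.
Hypothesis wE : w = map lidx labs.

Lemma size_wordE : size w = size labs.
Proof. by rewrite wE size_map. Qed.

Lemma coordK (T : Type) (d : T) (x : 'I_(size w) -> T) : pt labs (coord labs d x) = x.
Proof.
apply: funext => j; rewrite /pt /coord index_uniq // -?size_wordE //.
by rewrite insubT //= => ?; congr x; apply: val_inj.
Qed.

Lemma coord_pt (T : Type) (d : T) (g : label -> T) l : l \in labs ->
  coord labs d (@pt labs w T g) l = g l.
Proof.
move=> ll; rewrite /coord /pt insubT ?size_wordE ?index_mem //= => ?.
by rewrite nth_index.
Qed.

Lemma coord_out (T : Type) (d : T) (x : 'I_(size w) -> T) l : l \notin labs ->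
  coord labs d x l = d.
Proof.
move=> ll; rewrite /coord insubF // size_wordE.
by move: ll; rewrite -index_mem => /negPf.
Qed.

Lemma pt_eq (T : Type) (g h : label -> T) :
  @pt labs w T g = pt labs h <-> {in labs, g =1 h}.
Proof.
split=> [E l ll|E]; first by rewrite -(coord_pt (g l) g ll) E coord_pt.
by apply: funext => j; apply: E; rewrite mem_nth // -size_wordE.
Qed.

Lemma torus_pt (C : numClosedFieldType) (g : label -> C) :
  torus (@pt labs w C g) <-> {in labs, forall l, g l != 0}.
Proof.
split=> [tg l ll|H j]; last by apply: H; rewrite mem_nth // -size_wordE.
by rewrite -(coord_pt 0 g ll) /coord insubT ?size_wordE ?index_mem //= => ?; exact: tg.
Qed.

Lemma torus_coord (C : numClosedFieldType) (x : 'I_(size w) -> C) :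
  torus x -> forall l, coord labs 1 x l != 0.
Proof.
move=> tx l; case: (boolP (l \in labs)) => ll; last by rewrite coord_out ?oner_neq0.
by move: tx; rewrite -{1}(coordK 1 x) => /torus_pt; apply.
Qed.

Lemma letterE (j : 'I_(size w)) : tnth (in_tuple w) j = lidx (nth Phi labs j).
Proof.
have jl : (j < size labs)%N by rewrite -size_wordE.
by rewrite (tnth_nth 0%N) /= -(nth_map _ 0%N) // -wE.
Qed.

Lemma posrat_coord (C : numClosedFieldType) l :
  posrat (fun x : 'I_(size w) -> C => coord labs 1 x l)
         (fun xi => coord labs 0 xi l).
Proof.
rewrite /coord; case: insubP => [j _ _|_]; [exact: posrat_var|exact: posrat1].
Qed.

Lemma posrat_coord_tail (C : numClosedFieldType) l :
  posrat (fun z : 'I_(size w).+1 -> C => coord labs 1 (tail_pt z) l)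
         (fun zeta => coord labs 0 (tail_pt zeta) l).
Proof.
rewrite /coord; case: insubP => [j _ _|_]; [exact: posrat_var|exact: posrat1].
Qed.

Context (C : numClosedFieldType) (t : affine_type) (n : nat).
Implicit Type g : label -> C.

Definition P_lab g (i : nat) (l : label) : C :=
  ((\prod_(l' <- take (index l labs) labs) g l' ^ cartan t n (lidx l') i) * g l)^-1.

Lemma P_termE g (i : nat) (j : 'I_(size w)) :
  P_term t n i (pt labs g) j = P_lab g i (nth Phi labs j).
Proof.
have jl : (j < size labs)%N by rewrite -size_wordE.
rewrite /P_term /P_lab index_uniq //; congr (_ * _)^-1.
transitivity (\prod_(0 <= l < size w | (l < j)%N)
  g (nth Phi labs l) ^ cartan t n (lidx (nth Phi labs l)) i).
  by rewrite big_mkord; apply: eq_bigr => l _; rewrite letterE.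
rewrite (big_nth Phi) size_takel ?(ltnW jl) // [RHS](big_nat_widen _ _ (size w)) ?(ltnW (ltn_ord j)) //.
by apply: eq_bigr => l lj; rewrite nth_take.
Qed.

Lemma P_sumE g (i : nat) (A : pred nat) :
  P_sum t n i (@pt labs w C g) (fun m => A m) =
  \sum_(l <- [seq l <- labs | lidx l == i] | A (index l labs)) P_lab g i l.
Proof.
rewrite /P_sum big_filter_cond [RHS](big_nth Phi) -size_wordE big_mkord.
apply: eq_big => [m|m _]; last exact: P_termE.
by rewrite letterE index_uniq // -size_wordE.
Qed.

Lemma eps_wordE g (i : nat) :
  eps_word t n i (@pt labs w C g) =
  \sum_(l <- [seq l <- labs | lidx l == i]) P_lab g i l.
Proof. exact: (P_sumE g i xpredT). Qed.

Lemma gamma_wordE g (i : nat) :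
  gamma_word t n i (@pt labs w C g) =
  \prod_(l <- labs) g l ^ cartan t n (lidx l) i.
Proof.
rewrite /gamma_word [RHS](big_nth Phi) -size_wordE big_mkord.
by apply: eq_bigr => j _; rewrite letterE.
Qed.

Lemma P_lab_neq0 g (i : nat) (l : label) :
  {in labs, forall l, g l != 0} -> l \in labs -> P_lab g i l != 0.
Proof.
move=> H ll; rewrite invr_eq0 mulf_neq0 ?H //.
rewrite prodf_seq_neq0; apply/allP => l' /mem_take l'l.
by rewrite expfz_neq0 ?H.
Qed.

Lemma torus_cons_pt (k : nat) (c : C) (x : 'I_k -> C) :
  torus (cons_pt c x) <-> c != 0 /\ torus x.
Proof.
split=> [T|[c0 T] j]; last by rewrite /cons_pt; case: (unlift _ _).
split=> [|j]; first by have := T ord0; rewrite /cons_pt unlift_none.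
by have := T (lift ord0 j); rewrite /cons_pt liftK.
Qed.

Lemma e_wordE g h (i : nat) (c : C) (x' : 'I_(size w) -> C) :
  {in labs, forall l, g l != 0} -> c != 0 -> {in labs, forall l, h l != 0} ->
  (forall j : 'I_(size w), let l := nth Phi labs j in
    [/\ e_den t n i c (@pt labs w C g) j != 0 &
     e_num t n i c (@pt labs w C g) j =
     h l * e_den t n i c (@pt labs w C g) j]) ->
  e_word t n i (cons_pt c (pt labs g)) x' <-> x' = pt labs (fun l => g l * h l).
Proof.
move=> g0 c0 h0 H; rewrite /e_word head_cons_pt tail_cons_pt; split=> [[_ _ E]|->].
  apply: funext => j; have [D ->] := E j; have [_ ->] := H j.
  by rewrite mulfK.
split=> [||j]; first by apply/torus_cons_pt; split=> //; exact/torus_pt.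
  by apply/torus_pt => l ll; rewrite mulf_neq0 ?g0 ?h0.
by have [D N] := H j; split=> //; rewrite N mulfK.
Qed.

Lemma e_word_one g (i : nat) (a : label) (c : C) (x' : 'I_(size w) -> C) :
  {in labs, forall l, g l != 0} -> c != 0 ->
  [seq l <- labs | lidx l == i] = [:: a] ->
  e_word t n i (cons_pt c (pt labs g)) x' <->
  x' = pt labs (fun l => g l * (if l == a then c else 1)).
Proof.
move=> g0 c0 F; have al : a \in labs.
  by have := mem_head a [::]; rewrite -F mem_filter => /andP[].
have P0 := P_lab_neq0 i g0 al.
apply: (e_wordE (h := fun l => if l == a then c else 1)) => //.
  by move=> l _; case: ifP => // _; rewrite oner_neq0.
move=> j l; rewrite /e_num /e_den.
rewrite (P_sumE g i (fun m => m <= j)%N) (P_sumE g i (fun m => m < j)%N).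
rewrite (P_sumE g i (fun m => j < m)%N) (P_sumE g i (fun m => j <= m)%N).
rewrite F !big_cons !big_nil !addr0.
have -> : (l == a) = (nat_of_ord j == index a labs).
  rewrite /l; apply/eqP/eqP => [<-|->]; last by rewrite nth_index.
  by rewrite index_uniq // -size_wordE.
case: (ltngtP j (index a labs)) => H;
  rewrite ?mulr0 ?addr0 ?add0r ?mul1r //; split=> //; by rewrite mulf_neq0.
Qed.

(** At the first occurrence the quotient of [e_num] by [e_den] is (c P + P') / (P + P'), at the
    second it is c (P + P') / (c P + P'). At any other position both are P + P', c P + P' or c (P +
    P'), so the quotient is 1. *)
Lemma e_word_two g (i : nat) (a b : label) (c : C) (x' : 'I_(size w) -> C) :
  let P := P_lab g i a in let P' := P_lab g i b in
  {in labs, forall l, g l != 0} -> c != 0 ->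
  [seq l <- labs | lidx l == i] = [:: a; b] ->
  (index a labs < index b labs)%N ->
  P + P' != 0 -> c * P + P' != 0 ->
  e_word t n i (cons_pt c (pt labs g)) x' <->
  x' = pt labs (fun l => g l * (if l == a then (c * P + P') / (P + P')
     else if l == b then c / ((c * P + P') / (P + P')) else 1)).
Proof.
move=> P P' g0 c0 F ab S1 S2.
have L l : l \in [:: a; b] -> l \in labs by rewrite -F mem_filter => /andP[].
have al := L a (mem_head _ _); have bl : b \in labs by apply: L; rewrite !inE eqxx orbT.
apply: (e_wordE (h := fun l => if l == a then (c * P + P') / (P + P')
     else if l == b then c / ((c * P + P') / (P + P')) else 1)) => //.
  move=> l _; case: ifP => _; last case: ifP => _; last exact: oner_neq0.
    by rewrite mulf_neq0 ?invr_eq0.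
  by rewrite mulf_neq0 ?invr_eq0 // mulf_neq0 ?invr_eq0.
move=> j l; rewrite /e_num /e_den.
rewrite (P_sumE g i (fun m => m <= j)%N) (P_sumE g i (fun m => m < j)%N).
rewrite (P_sumE g i (fun m => j < m)%N) (P_sumE g i (fun m => j <= m)%N).
rewrite F !big_cons !big_nil -/P -/P'.
have E l0 : l0 \in labs -> (l == l0) = (nat_of_ord j == index l0 labs).
  move=> ll; rewrite /l; apply/eqP/eqP => [<-|->]; last by rewrite nth_index.
  by rewrite index_uniq // -size_wordE.
rewrite !E //.
case: (ltngtP j (index a labs)) => H; case: (ltngtP j (index b labs)) => H' /=;
  rewrite ?addr0 ?mulr0 ?add0r ?mul1r -?mulrDr;
  try (exfalso; lia); split=> //.
- by rewrite mulf_neq0.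
- by field; rewrite S1 S2.
- by field.
Qed.

End Labels.

(** * Equality and membership of labels *)

Lemma V_inj : injective V. Proof. by move=> i j []. Qed.
Lemma Vb_inj : injective Vb. Proof. by move=> i j []. Qed.

Lemma eqV i j : (V i == V j) = (i == j). Proof. exact: (inj_eq V_inj). Qed.
Lemma eqVb i j : (Vb i == Vb j) = (i == j). Proof. exact: (inj_eq Vb_inj). Qed.
Lemma eqVVb i j : (V i == Vb j) = false. Proof. by []. Qed.
Lemma eqVbV i j : (Vb i == V j) = false. Proof. by []. Qed.
Lemma eqVPhi i : (V i == Phi) = false. Proof. by []. Qed.
Lemma eqVbPhi i : (Vb i == Phi) = false. Proof. by []. Qed.
Lemma eqPhiV i : (Phi == V i) = false. Proof. by []. Qed.
Lemma eqPhiVb i : (Phi == Vb i) = false. Proof. by []. Qed.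
Definition eq_label := (eqV, eqVb, eqVVb, eqVbV, eqVPhi, eqVbPhi, eqPhiV, eqPhiVb).

Lemma memVV i s : (V i \in [seq V j | j <- s]) = (i \in s).
Proof. exact: mem_map V_inj _ _. Qed.
Lemma memVbVb i s : (Vb i \in [seq Vb j | j <- s]) = (i \in s).
Proof. exact: mem_map Vb_inj _ _. Qed.
Lemma memVVb i s : (V i \in [seq Vb j | j <- s]) = false.
Proof. by apply/mapP => -[]. Qed.
Lemma memVbV i s : (Vb i \in [seq V j | j <- s]) = false.
Proof. by apply/mapP => -[]. Qed.
Lemma memPhiV s : (Phi \in [seq V j | j <- s]) = false.
Proof. by apply/mapP => -[]. Qed.
Lemma memPhiVb s : (Phi \in [seq Vb j | j <- s]) = false.
Proof. by apply/mapP => -[]. Qed.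
Definition mem_label :=
  (memVV, memVbVb, memVVb, memVbV, memPhiV, memPhiVb, mem_rev, mem_iota).

Lemma basis_labelsE t n l : l \in basis_labels t n =
  match l with
  | V 0 => if t is (B1 | A2dag | D2) then true else false
  | V i => if t is A2even then false else (i < n.+1 + (if t is A1 then 1 else 0))%N
  | Vb 0 => false
  | Vb i => if t is (A1 | A2even) then false else (i < n.+1)%N
  | Phi => if t is D2 then true else false
  end.
Proof.
case: t; case: l => [[|i]|[|i]|]; rewrite /basis_labels ?mem_cat ?inE ?mem_cat;
  rewrite ?mem_label ?eq_label //=; lia.
Qed.

Lemma uniq_basis_labels t n : uniq (basis_labels t n).
Proof.
have U a b : uniq [seq V i | i <- iota a b] by rewrite map_inj_uniq ?iota_uniq //; exact: V_inj.
have Ub a b : uniq [seq Vb i | i <- rev (iota a b)].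
  by rewrite map_inj_uniq ?rev_uniq ?iota_uniq //; exact: Vb_inj.
have D a b c d : has (in_mem^~ (mem [seq V i | i <- iota a b])) [seq Vb i | i <- rev (iota c d)] = false.
  by apply/hasP => -[l /mapP[i _ ->]]; rewrite /= memVbV.
case: t; rewrite /basis_labels ?U // ?cat_uniq ?U /= ?D ?Ub ?andbT //;
  rewrite ?mem_label /= ?inE ?mem_label //=; lia.
Qed.

(** * Exponentials of f_i in coordinates *)

Section LabelledVectors.

Context (C : numClosedFieldType) (t : affine_type) (n : nat).
Implicit Types F G : label -> C.
Local Notation B := (basis_labels t n).

Definition vec F : W C t n := [ffun b => F (ssval b)].

Lemma vec_eq F G : vec F = vec G <-> {in B, F =1 G}.
Proof.
split=> [E l lB|E]; last by apply/ffunP => b; rewrite !ffunE E ?(valP b).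
by have /ffunP/(_ (SeqSub lB)) := E; rewrite !ffunE.
Qed.

Lemma vectE l : @vect C t n l = vec (fun l' => (l' == l)%:R).
Proof. by []. Qed.

Lemma scale_vec (a : C) F : a *: vec F = vec (fun l => a * F l).
Proof. by apply/ffunP => b; rewrite !ffunE. Qed.

Lemma card_basis : #|basis t n| = size B.
Proof. by rewrite card_seq_sub // uniq_basis_labels. Qed.

Context (i : nat) (pre : label -> option (nat * label)).

(* f_i v_{l1} = k v_l for pre l = Some (k, l1), and v_l does not occur in the
   image of f_i for pre l = None. *)
Hypothesis preP : {in B &, forall l l', f_coef t n i l' l =
  if pre l is Some (k, l1) then if l1 == l' then k else 0%N else 0%N}.
Hypothesis pre_in : forall l k l1, l \in B -> pre l = Some (k, l1) -> l1 \in B.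

Let step F l : C := if pre l is Some (k, l1) then k%:R * F l1 else 0.

Lemma f_op_vec F : f_op i (vec F) = vec (step F).
Proof.
apply/ffunP => b; rewrite !ffunE /step; have bB := valP b : ssval b \in B.
under eq_bigr => b' _ do rewrite ffunE preP ?(valP b') //.
case E: (pre (ssval b)) => [[k l1]|]; last by rewrite big1 // => b' _; rewrite mul0r.
have l1B := pre_in bB E.
rewrite (bigD1 (SeqSub l1B)) //= eqxx big1 ?addr0 // => b' Hb.
case: eqP => [l1E|]; last by rewrite mul0r.
by move: Hb; rewrite -(inj_eq val_inj) /= -l1E eqxx.
Qed.

Hypothesis pre3 : forall l k l1 k' l2, l \in B ->
  pre l = Some (k, l1) -> pre l1 = Some (k', l2) -> pre l2 = None.
Hypothesis size3 : (3 <= size B)%N.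

(** By [pre3] the cube of f_i is 0, so the exponential stops at its quadratic term; [size3] ensures
    that the sum in [exp_f], cut off at the dimension of the module, still contains that term. *)
Lemma Y_vec (c : C) F : Y i c (vec F) = vec (fun l =>
  let G l := c ^ wt_label t n l i * F l in
  G l + if pre l is Some (k, l1) then
    c^-1 * k%:R * G l1 + (if pre l1 is Some (k', l2) then
    c ^- 2 * (k%:R * k'%:R / 2) * G l2 else 0) else 0).
Proof.
have -> : Y i c (vec F) = exp_f i c^-1 (vec (fun l => c ^ wt_label t n l i * F l)).
  by rewrite /Y; congr exp_f; apply/ffunP => b; rewrite !ffunE.
set G := fun l => _ * _.
have it k : iter k (f_op i) (vec G) = vec (iter k step G).
  by elim: k => //= k ->; rewrite f_op_vec.
apply/ffunP => b; rewrite /exp_f sum_ffunE !ffunE.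
have bB := valP b : ssval b \in B; set l := ssval b in bB *.
under eq_bigr => k _ do rewrite it scale_vec !ffunE -/l.
rewrite -(big_mkord xpredT (fun k => c^-1 ^+ k / k`!%:R * iter k step G l)).
rewrite (big_cat_nat (n := 3)) ?card_basis //= [X in _ + X]big1_seq ?addr0; last first.
  move=> k; rewrite mem_index_iota => /andP[_ /andP[k3 _]].
  suff : forall F', step (step (step F')) l = 0.
    move=> H; rewrite -(subnKC k3) !addSn add0n.
    by rewrite (_ : iter _ _ _ = step (step (step (iter (k - 3) step G)))) // H mulr0.
  move=> F'; rewrite /step; case E: (pre l) => [[k1 l1]|] //.
  case E1: (pre l1) => [[k2 l2]|]; last by rewrite mulr0.
  by rewrite (pre3 bB E E1) !mulr0.
rewrite !big_nat_recl // big_geq // addr0 /= /step expr0 !fact0 divr1 mul1r.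
congr (_ + _); case: (pre l) => [[k1 l1]|]; last by rewrite !mulr0 addr0.
rewrite expr1 divr1 mulrA; congr (_ + _).
case: (pre l1) => [[k2 l2]|]; last by rewrite !mulr0.
by rewrite exprVn (_ : 2`! = 2%N) //; ring.
Qed.

End LabelledVectors.

(** * The points v(x) *)

Definition classical_type (t : affine_type) : bool :=
  match t with A1 | A2even => false | _ => true end.

Lemma wt_inner t n i l : classical_type t -> admissible t n -> (1 <= i < n)%N ->
  l \in basis_labels t n ->
  wt_label t n l i = match l with
    | V j => (j == i)%:Z - (j == i.+1)%:Z
    | Vb j => (j == i.+1)%:Z - (j == i)%:Z
    | Phi => 0
    end.
Proof.
move=> ct ad ni; rewrite basis_labelsE.
case: l => [[|j]|[|j]|] lB //; rewrite /wt_label /wtV /Lambda; case: t ct ad lB => //= _ ad lB;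
  rewrite ?natz; repeat case: ifP => ?; lia.
Qed.

Lemma size_basis_ge3 t n : admissible t n -> (3 <= size (basis_labels t n))%N.
Proof.
by case: t => // ad; rewrite /basis_labels ?size_cat /= ?size_map ?size_rev ?size_iota //;
  move: ad => /=; lia.
Qed.

(* [p0] and [pn] are the entries -a_{01} and -a_{n,n-1}; [p0 = 0] marks the
   types whose nodes 0 and 1 form a fork. *)
Definition p0 (t : affine_type) : nat :=
  match t with D2 => 2 | C1 | A2dag => 1 | _ => 0 end.
Definition pn (t : affine_type) : nat :=
  match t with C1 | A2odd => 1 | _ => 2 end.
Definition is_D1 (t : affine_type) : bool := if t is D1 then true else false.

Lemma isD1P t : is_D1 t -> t = D1.
Proof. by case: t. Qed.

Lemma wt_last t n l : classical_type t -> ~~ is_D1 t -> admissible t n ->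
  l \in basis_labels t n ->
  wt_label t n l n = match l with
    | V j => (pn t)%:Z * (j == n)%:Z | Vb j => - (pn t)%:Z * (j == n)%:Z | Phi => 0
    end.
Proof.
move=> ct nD ad; rewrite basis_labelsE.
case: l => [[|j]|[|j]|] lB //; rewrite /wt_label /wtV /Lambda; case: t ct nD ad lB => //= _ _ ad lB;
  rewrite ?natz; repeat case: ifP => ?; lia.
Qed.

Lemma wt_last_D1 n l : admissible D1 n -> l \in basis_labels D1 n ->
  wt_label D1 n l n = match l with
    | V j => (j == n)%:Z + (j == n.-1)%:Z
    | Vb j => - (j == n)%:Z - (j == n.-1)%:Z
    | Phi => 0
    end.
Proof.
move=> ad; rewrite basis_labelsE.
case: l => [[|j]|[|j]|] lB //; rewrite /wt_label /wtV /Lambda; move: ad lB => /= ad lB;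
  rewrite ?natz; repeat case: ifP => ?; lia.
Qed.

Lemma wt_zero t n l : (0 < p0 t)%N -> admissible t n -> l \in basis_labels t n ->
  wt_label t n l 0 = match l with
    | V j => - (p0 t)%:Z * (j == 1%N)%:Z | Vb j => (p0 t)%:Z * (j == 1%N)%:Z | Phi => 0
    end.
Proof.
move=> ct ad; rewrite basis_labelsE.
case: l => [[|j]|[|j]|] lB //; rewrite /wt_label /wtV /Lambda; case: t ct ad lB => //= _ ad lB;
  rewrite ?natz; repeat case: ifP => ?; lia.
Qed.

Lemma wt_A1 n i l : (1 <= i <= n)%N -> l \in basis_labels A1 n ->
  wt_label A1 n l i = match l with
    | V j => (j == i)%:Z - (j == i.+1)%:Z | _ => 0
    end.
Proof.
move=> ad; rewrite basis_labelsE.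
case: l => [[|j]|[|j]|] lB //; rewrite /wt_label /wtV /Lambda; move: ad lB => /= ad lB;
  rewrite ?natz; repeat case: ifP => ?; lia.
Qed.

(** * The operators Y_i(c) in coordinates *)

Section Steps.

Context (C : numClosedFieldType) (t : affine_type) (n : nat).
Hypothesis ad : admissible t n.
Implicit Types F : label -> C.
Implicit Type c : C.
Local Notation B := (basis_labels t n).

(** Here every i-string has at most two vectors, a vector of weight 1 going to one of weight -1. The
    factor c produced by the coroot on the source cancels the c^-1 of the exponential. *)
Lemma Y_string1 (i : nat) (pre : label -> option label) c F : c != 0 ->
  {in B &, forall l l', f_coef t n i l' l = (pre l == Some l')} ->
  {in B, forall l l1, pre l = Some l1 ->
    [/\ l1 \in B, pre l1 = None, wt_label t n l i = -1 & wt_label t n l1 i = 1]} ->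
  Y i c (vec t n F) = vec t n (fun l => if pre l is Some l1
    then c^-1 * F l + F l1 else c ^ wt_label t n l i * F l).
Proof.
move=> c0 H1 H2; pose pre' l := omap (pair 1%N) (pre l).
rewrite (@Y_vec _ _ _ i pre'); last exact: size_basis_ge3.
- apply/vec_eq => l lB /=; rewrite /pre'; case E: (pre l) => [l1|] /=.
    have [_ -> -> ->] := H2 _ lB _ E.
    by rewrite addr0 exprN1 expr1z mulr1 mulrA mulVf // mul1r.
  by rewrite addr0.
- by move=> l l' lB l'B; rewrite H1 // /pre'; case: (pre l) => [l1|].
- by move=> l k l1 lB; rewrite /pre'; case E: (pre l) => [l2|] //= [_ <-]; case: (H2 _ lB _ E).
- move=> l k l1 k' l2 lB; rewrite /pre'; case E: (pre l) => [l3|] //= [_ <-].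
  by have [_ -> _ _] := H2 _ lB _ E.
Qed.

(** The only nontrivial i-string is a, b, d, of weights 2, 0, -2, with f_i a = b and f_i b = 2 d.
    The coefficient of [F a] at d is c^-2 (1 . 2 / 2!) c^2 = 1. *)
Lemma Y_string2 (i : nat) (a b d : label) c F : c != 0 ->
  a \in B -> b \in B -> a != b -> b != d -> a != d ->
  {in B &, forall l l', f_coef t n i l' l =
    if (l == b) && (l' == a) then 1%N else if (l == d) && (l' == b) then 2%N else 0%N} ->
  {in B, forall l, wt_label t n l i = 2 * (l == a)%:Z - 2 * (l == d)%:Z} ->
  Y i c (vec t n F) = vec t n (fun l =>
    if l == a then c ^+ 2 * F l else if l == b then F l + c * F a
    else if l == d then c ^- 2 * F l + 2 * c^-1 * F b + F a else F l).
Proof.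
move=> c0 aB bB ab bd ad' H1 H2.
pose pre l := if l == b then Some (1%N, a) else if l == d then Some (2%N, b) else None.
have ba : b == a = false by rewrite eq_sym (negPf ab).
have da : d == a = false by rewrite eq_sym (negPf ad').
have db : d == b = false by rewrite eq_sym (negPf bd).
have Ec : c ^ (2 * 1 - 2 * 0) = c ^+ 2 by [].
have Ed : c ^ (2 * 0 - 2 * 1) = c ^- 2 by [].
have Eb : c ^ (2 * 0 - 2 * 0) = 1 by [].
rewrite (@Y_vec _ _ _ i pre); last exact: size_basis_ge3.
- apply/vec_eq => l lB /=; rewrite /pre !H2 //.
  case: (eqVneq l a) => [->|la]; first by rewrite (negPf ab) (negPf ad') Ec addr0.
  case: (eqVneq l b) => [->|lb].
    rewrite !H2 // (negPf ab) (negPf ad') eqxx (negPf bd) Ec Eb addr0.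
    by field.
  case: (eqVneq l d) => [->|ld]; last by rewrite Eb mul1r addr0.
  rewrite eqxx !H2 // ba (negPf bd) (negPf ad') eqxx Ec Ed Eb.
  by field.
- move=> l l' lB l'B; rewrite H1 // /pre (eq_sym l' a) (eq_sym l' b).
  case: (eqVneq l b) => [->|lb] /=; first by rewrite (negPf bd); case: eqP.
  by case: (eqVneq l d) => //= _; case: eqP.
- by move=> l k l1 lB; rewrite /pre; case: ifP => _ [] //; last case: ifP => _ // []; move=> _ <-.
- move=> l k l1 k' l2 lB; rewrite /pre.
  case: (eqVneq l b) => _ => [[_ <-]|]; first by rewrite (negPf ab) (negPf ad').
  by case: ifP => _ // [_ <-]; rewrite eqxx => -[_ <-]; rewrite (negPf ab) (negPf ad').
Qed.

Definition Y_inner (i : nat) c F l : C :=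
  match l with
  | V j => if j == i then c * F l else
           if j == i.+1 then c^-1 * F l + F (V i) else F l
  | Vb j => if j == i.+1 then c * F l else
            if j == i then c^-1 * F l + F (Vb i.+1) else F l
  | Phi => F l
  end.

Definition pre_inner (i : nat) l : option label :=
  match l with
  | V j => if j == i.+1 then Some (V i) else None
  | Vb j => if j == i then Some (Vb i.+1) else None
  | Phi => None
  end.

Lemma expz_eq c (b b' : bool) : c ^ (b%:Z - b'%:Z) =
  if b then (if b' then 1 else c) else if b' then c^-1 else 1.
Proof. by case: b; case: b'. Qed.

Lemma Y_innerE i c F : c != 0 -> classical_type t -> (1 <= i < n)%N ->
  Y i c (vec t n F) = vec t n (Y_inner i c F).
Proof.
move=> c0 ct ni; have W := wt_inner ct ad ni.
rewrite (@Y_string1 i (pre_inner i)) //.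
- apply/vec_eq => l lB; rewrite W // /pre_inner /Y_inner.
  case: l {lB} => [j|j|]; last by rewrite expr0z mul1r.
    by rewrite expz_eq; case: (eqVneq j i.+1) => [->|_]; [rewrite ifF //; lia|case: eqP; rewrite // mul1r].
  by rewrite expz_eq; case: (eqVneq j i) => [->|_]; [rewrite ifF //; lia|case: eqP; rewrite // mul1r].
- move=> l l' lB l'B; rewrite /f_coef.
  have -> : f_label t n i l' = if l' == V i then Some (1%N, V i.+1)
         else if l' == Vb i.+1 then Some (1%N, Vb i) else None.
    by case: t ct => // _; rewrite /f_label; do 2!(case: ifP => ?; first by lia).
  case: l {lB} => [j|j|]; case: l' {l'B} => [j'|j'|]; rewrite /pre_inner ?eq_label //=;
    repeat case: eqP => //; by intros; congruence.
- move=> l lB l1; rewrite W // /pre_inner.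
  have ViB : V i \in B by rewrite basis_labelsE; case: t ct => //; case: (i) ni => //; lia.
  have VbiB : Vb i.+1 \in B by rewrite basis_labelsE; case: t ct => //; lia.
  case: l lB => [j|j|] // lB; case: eqP => // jE [<-]; rewrite W //; subst j; split=> //;
    by rewrite ?ifF //; lia.
Qed.

Definition Y_last1 c F l : C :=
  if l == V n then c * F l else if l == Vb n then c^-1 * F l + F (V n) else F l.

Definition Y_last2 c F l : C :=
  if l == V n then c ^+ 2 * F l else if l == V 0 then F l + c * F (V n)
  else if l == Vb n then c ^- 2 * F l + 2 * c^-1 * F (V 0) + F (V n) else F l.

Definition Y_lastD c F l : C :=
  if l == V n then c * F l else if l == V n.-1 then c * F l
  else if l == Vb n then c^-1 * F l + F (V n.-1)
  else if l == Vb n.-1 then c^-1 * F l + F (V n) else F l.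

Definition Y_zero1 c F l : C :=
  if l == Vb 1 then c * F l else if l == V 1 then c^-1 * F l + F (Vb 1) else F l.

Definition Y_zero2 c F l : C :=
  if l == Vb 1 then c ^+ 2 * F l else if l == Phi then F l + c * F (Vb 1)
  else if l == V 1 then c ^- 2 * F l + 2 * c^-1 * F Phi + F (Vb 1) else F l.

Definition Y_A1 (i : nat) c F l : C :=
  if l == V i then c * F l else if l == V i.+1 then c^-1 * F l + F (V i) else F l.

Lemma n_ge2 : (2 <= n)%N.
Proof. by case: t ad => //=; lia. Qed.

Lemma Y_last1E c F : c != 0 -> classical_type t -> ~~ is_D1 t -> pn t = 1%N ->
  Y n c (vec t n F) = vec t n (Y_last1 c F).
Proof.
move=> c0 ct nD pt1; have W := wt_last ct nD ad; have n2 := n_ge2.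
have VnB : V n \in B by rewrite basis_labelsE; case: t ct => //; case: (n) n2 => //; lia.
rewrite (@Y_string1 n (fun l => if l == Vb n then Some (V n) else None)) //.
- apply/vec_eq => l lB; rewrite W // pt1 /Y_last1.
  case: l {lB} => [j|j|]; rewrite ?eq_label ?expr0z ?mul1r //.
    by case: eqP => _; rewrite ?mulr1 ?expr1z // expr0z mul1r.
  by case: eqP => [->//|_]; rewrite ?mulr0 ?expr0z ?mul1r.
- move=> l l' lB l'B; rewrite /f_coef.
  have -> : f_label t n n l' = if l' == V n then Some (1%N, Vb n) else None.
    by case: t ct pt1 nD => //= _ _ _; rewrite eqxx; case: (n) n2.
  case: l {lB} => [j|j|]; case: l' {l'B} => [j'|j'|]; rewrite ?eq_label //=;
    repeat case: eqP => //; by intros; congruence.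
- move=> l lB l1; case: eqP => // lE [<-]; subst l; rewrite !W // pt1 eqxx.
  by split.
Qed.

Lemma Y_last2E c F : c != 0 -> classical_type t -> ~~ is_D1 t -> pn t = 2%N ->
  Y n c (vec t n F) = vec t n (Y_last2 c F).
Proof.
move=> c0 ct nD pt2; have W := wt_last ct nD ad; have n2 := n_ge2.
have VnB : V n \in B by rewrite basis_labelsE; case: t ct => //; case: (n) n2 => //; lia.
have V0B : V 0 \in B by rewrite basis_labelsE; case: t ct nD pt2.
rewrite (@Y_string2 n (V n) (V 0) (Vb n)) //.
- by rewrite eq_label; lia.
- move=> l l' lB l'B; rewrite /f_coef.
  have -> : f_label t n n l' = if l' == V n then Some (1%N, V 0)
      else if l' == V 0 then Some (2%N, Vb n) else None.
    by case: t ct pt2 nD => //= _ _ _; case: (n) n2 => // m _; rewrite eqxx.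
  case: l {lB} => [j|j|]; case: l' {l'B} => [j'|j'|]; rewrite ?eq_label //=;
    repeat case: eqP => //; by intros; (congruence || lia).
- move=> l lB; rewrite W // pt2.
  by case: l {lB} => [j|j|]; rewrite ?eq_label //=; case: eqP.
Qed.

Lemma Y_lastDE c F : c != 0 -> is_D1 t -> Y n c (vec t n F) = vec t n (Y_lastD c F).
Proof.
move=> c0 /isD1P tD; have n4 : (4 <= n)%N by move: ad; rewrite tD.
have W : {in B, forall l, wt_label t n l n = match l with
    | V j => (j == n)%:Z + (j == n.-1)%:Z
    | Vb j => - (j == n)%:Z - (j == n.-1)%:Z
    | Phi => 0
    end} by rewrite tD => l; exact: wt_last_D1.
have VnB : V n \in B.
  by rewrite tD basis_labelsE; case: (n) n4 => // m _ /=; lia.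
have Vn1B : V n.-1 \in B.
  by rewrite tD basis_labelsE; case: (n) n4 => [|[|m]] // _ /=; lia.
pose pre l := if l == Vb n then Some (V n.-1) else
  if l == Vb n.-1 then Some (V n) else None.
have nn : (n == n.-1) = false by lia.
have nn' : (n.-1 == n) = false by lia.
rewrite (@Y_string1 n pre) //.
- apply/vec_eq => l lB; rewrite W // /Y_lastD /pre.
  case: l {lB} => [j|j|]; rewrite ?eq_label ?expr0z ?mul1r //.
    case: (eqVneq j n) => [->|_]; first by rewrite nn.
    by case: (eqVneq j n.-1) => _; rewrite // expr0z mul1r.
  case: (eqVneq j n) => [->|_] //.
  by case: (eqVneq j n.-1) => [->|_] //; rewrite expr0z mul1r.
- move=> l l' lB l'B; rewrite /f_coef.
  have -> : f_label t n n l' = if l' == V n then Some (1%N, Vb n.-1)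
      else if l' == V n.-1 then Some (1%N, Vb n) else None.
    by rewrite tD /f_label eqxx ifF //; lia.
  rewrite /pre; case: l {lB} => [j|j|]; case: l' {l'B} => [j'|j'|]; rewrite ?eq_label //=;
    repeat case: eqP => //; by intros; (congruence || lia).
- move=> l lB l1; rewrite /pre; case: eqP => [lE|_]; last case: eqP => // lE;
    by move=> [<-]; subst l; rewrite !W // !eqxx ?nn ?nn'; split.
Qed.

Lemma Y_zero1E c F : c != 0 -> p0 t = 1%N ->
  Y 0 c (vec t n F) = vec t n (Y_zero1 c F).
Proof.
move=> c0 pt1; have ct : (0 < p0 t)%N by rewrite pt1.
have W := wt_zero ct ad; have n2 := n_ge2.
have VnB : Vb 1 \in B by rewrite basis_labelsE; case: t pt1 ct => //; case: (n) n2 => //; lia.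
rewrite (@Y_string1 0 (fun l => if l == V 1 then Some (Vb 1) else None)) //.
- apply/vec_eq => l lB; rewrite W // pt1 /Y_zero1.
  case: l {lB} => [j|j|]; rewrite ?eq_label ?expr0z ?mul1r //.
    by case: eqP => [->//|_]; rewrite ?mulr0 ?expr0z ?mul1r.
  by case: eqP => _; rewrite ?mulr1 ?expr1z // expr0z mul1r.
- move=> l l' lB l'B; rewrite /f_coef.
  have -> : f_label t n 0 l' = if l' == Vb 1 then Some (1%N, V 1) else None.
    by case: t pt1 ct => //= _ _; case: l' {l'B} => [j'|[|[|j']]|].
  case: l {lB} => [j|j|]; case: l' {l'B} => [j'|j'|]; rewrite ?eq_label //=;
    repeat case: eqP => //; by intros; congruence.
- move=> l lB l1; case: eqP => // lE [<-]; subst l; rewrite !W // pt1 eqxx.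
  by split.
Qed.

Lemma Y_zero2E c F : c != 0 -> p0 t = 2%N ->
  Y 0 c (vec t n F) = vec t n (Y_zero2 c F).
Proof.
move=> c0 pt2; have ct : (0 < p0 t)%N by rewrite pt2.
have W := wt_zero ct ad; have n2 := n_ge2.
have VnB : Vb 1 \in B by rewrite basis_labelsE; case: t pt2 ct => //; case: (n) n2 => //; lia.
have V0B : Phi \in B by rewrite basis_labelsE; case: t ct pt2.
rewrite (@Y_string2 0 (Vb 1) Phi (V 1)) //.
- move=> l l' lB l'B; rewrite /f_coef.
  have -> : f_label t n 0 l' = if l' == Vb 1 then Some (1%N, Phi)
      else if l' == Phi then Some (2%N, V 1) else None.
    by case: t pt2 ct => //= _ _; case: l' {l'B} => [j'|[|[|j']]|].
  case: l {lB} => [j|j|]; case: l' {l'B} => [j'|j'|]; rewrite ?eq_label //=;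
    repeat case: eqP => //; by intros; (congruence || lia).
- move=> l lB; rewrite W // pt2.
  by case: l {lB} => [j|j|]; rewrite ?eq_label //=; case: eqP.
Qed.

End Steps.

Lemma Y_A1E (C : numClosedFieldType) n i (c : C) F : c != 0 ->
  admissible A1 n -> (1 <= i <= n)%N ->
  Y i c (vec A1 n F) = vec A1 n (Y_A1 i c F).
Proof.
move=> c0 ad ni; have W := wt_A1 ni.
have ViB : V i \in basis_labels A1 n by rewrite basis_labelsE; case: (i) ni => //; lia.
rewrite (@Y_string1 _ _ _ ad i (fun l => if l == V i.+1 then Some (V i) else None)) //.
- apply/vec_eq => l lB; rewrite W // /Y_A1.
  case: l {lB} => [j|j|]; rewrite ?eq_label ?expr0z ?mul1r // expz_eq.
  case: (eqVneq j i.+1) => [->|_]; first by rewrite ifF //; lia.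
  by case: eqP => _ //; rewrite mul1r.
- move=> l l' lB l'B; rewrite /f_coef.
  have -> : f_label A1 n i l' = if l' == V i then Some (1%N, V i.+1) else None.
    by rewrite /f_label ifF //; lia.
  case: l {lB} => [j|j|]; case: l' {l'B} => [j'|j'|]; rewrite ?eq_label //=;
    repeat case: eqP => //; by intros; congruence.
- move=> l lB l1; case: eqP => // lE [<-]; subst l; rewrite !W //.
  by rewrite ?eq_label; split; rewrite ?ifF //; lia.
Qed.

(** * Words as lists of labels *)

Definition labels1 (t : affine_type) (n : nat) : seq label :=
  match t with
  | A1 => [seq V i | i <- rev (iota 1 n)]
  | B1 | A2odd => [seq V i | i <- iota 1 n] ++ [seq Vb i | i <- rev (iota 1 n.-1)]
  | D1 => [seq V i | i <- iota 1 n] ++ [seq Vb i | i <- rev (iota 1 n.-2)]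
  | C1 | D2 | A2dag =>
      [seq V i | i <- iota 0 n.+1] ++ [seq Vb i | i <- rev (iota 1 n.-1)]
  | A2even => [::]
  end.

Definition labels2 (t : affine_type) (n : nat) : seq label :=
  match t with
  | A2dag => [seq V i | i <- rev (iota 0 n.+1)] ++ [seq Vb i | i <- iota 1 n.-1]
  | _ => labels1 t n
  end.

Lemma map_lidx_V s : [seq lidx l | l <- [seq V i | i <- s]] = s.
Proof. by rewrite -map_comp map_id. Qed.

Lemma map_lidx_Vb s : [seq lidx l | l <- [seq Vb i | i <- s]] = s.
Proof. by rewrite -map_comp map_id. Qed.

Lemma word1E t n : word1 t n = map lidx (labels1 t n).
Proof. by case: t; rewrite /= ?map_cat /= ?map_lidx_V ?map_lidx_Vb. Qed.

Lemma word2E t n : word2 t n = map lidx (labels2 t n).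
Proof.
by case: t; try exact: word1E; rewrite /labels2 map_cat map_lidx_V map_lidx_Vb.
Qed.

Lemma uniq_VVb s s' : uniq ([seq V i | i <- s] ++ [seq Vb i | i <- s']) = uniq s && uniq s'.
Proof.
rewrite cat_uniq (map_inj_uniq V_inj) (map_inj_uniq Vb_inj).
by rewrite (_ : has _ _ = false) //; apply/hasP => -[l /mapP[i _ ->]]; rewrite memVbV.
Qed.

Lemma uniq_labels1 t n : uniq (labels1 t n).
Proof.
case: t; rewrite /labels1 ?uniq_VVb ?rev_uniq ?iota_uniq //.
by rewrite (map_inj_uniq V_inj) rev_uniq iota_uniq.
Qed.

Lemma uniq_labels2 t n : uniq (labels2 t n).
Proof.
case: t; try exact: uniq_labels1.
by rewrite /labels2 uniq_VVb ?rev_uniq ?iota_uniq.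
Qed.

Lemma iotaS_last m r : iota m r.+1 = rcons (iota m r) (m + r)%N.
Proof. by rewrite -[r.+1]addn1 iotaD cats1. Qed.

Lemma rev_iotaS m r : rev (iota m r.+1) = (m + r)%N :: rev (iota m r).
Proof. by rewrite iotaS_last rev_rcons. Qed.

Lemma orbit_pointE (C : numClosedFieldType) t n (labs : seq label) (w : seq nat)
    (wE : w = map lidx labs) l (g : label -> C) :
  orbit_point t n l (@pt labs w C g) =
  foldr (fun l' u => Y (lidx l') (g l') u) (vect C t n l) labs.
Proof.
have E : [seq nth Phi labs (nat_of_ord j) | j <- enum 'I_(size w)] = labs.
  rewrite (map_comp (nth Phi labs) (@nat_of_ord _)) val_enum_ord (size_wordE wE).
  by rewrite map_nth_iota0 // take_size.
rewrite -[in RHS]E foldr_map /orbit_point; elim: (enum _) => //= j s ->.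
by rewrite (letterE wE).
Qed.

Ltac nat_lia := lazymatch goal with
  | |- context [GRing.mul] => fail
  | _ => repeat match goal with
    | H : context [GRing.mul] |- _ => clear H
    | H : context [GRing.zero] |- _ => clear H
    end; lia
  end.

Ltac decide_ifs := repeat match goal with
  |- context [if ?b then _ else _] =>
    first [rewrite (_ : b = true); last nat_lia | rewrite (_ : b = false); last nat_lia]
  | |- context [nat_of_bool ?b] =>
    match b with true => fail 1 | false => fail 1 | _ =>
    first [rewrite (_ : b = true); last nat_lia | rewrite (_ : b = false); last nat_lia] end
  end.

(** * Coordinates of v(x) outside type A *)

Section Points.

Context (C : numClosedFieldType) (t : affine_type) (n : nat) (g : label -> C).

(* For D_n^(1), the coordinate of the letter n plays the role of the second
   coordinate of the letter n-1. *)
Definition xb (i : nat) : C :=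
  if is_D1 t && (i == n.-1) then g (V n) else g (Vb i).

(** The exponents at the ends are the weights with which the coroots of 0 and n act on v_{bar 1} and
    v_n; at a fork [p0] = 0 gives X_0 = 1. For D_n^(1) one has X_n = 0 because f_n does not lead to
    v_n, which only Y_{n-1} reaches. *)
Definition XX (i : nat) : C :=
  if i == 0%N then g (V 0) ^+ p0 t
  else if i == n then if is_D1 t then 0 else g (V n) ^+ pn t
  else g (V i) * xb i.

Definition UU (i : nat) : C := if i == 0%N then g (V 0) ^+ p0 t else g (V i).

Definition v1_coef (l : label) : C :=
  match l with
  | V 0 => g (V n)
  | V 1 => if p0 t == 0%N then XX 1 else (XX 0 + XX 1) / UU 0
  | V i => (XX i.-1 + XX i) / UU i.-1
  | Vb i => UU i.-1
  | Phi => g (V 0)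
  end.

Hypothesis ad : admissible t n.
Hypothesis ct : classical_type t.
Hypothesis g0 : forall l, g l != 0.
Local Notation foldY := (foldr (fun l' u => Y (lidx l') (g l') u)).

Let n2 : (2 <= n)%N. Proof. exact: n_ge2 ad. Qed.

Lemma foldY_down r : (r < n)%N ->
  foldY (vect C t n (V 1)) [seq Vb i | i <- rev (iota 1 r)] =
  vec t n (fun l => if l is V j then
    if (1 <= j <= r)%N then g (Vb j) else (j == r.+1)%:R else 0).
Proof.
elim: r => [|r IH] rn.
  rewrite /= vectE; apply/vec_eq => l lB; case: l {lB} => [j|j|] //.
  by rewrite eq_label; case: j => [|[]].
rewrite rev_iotaS /= IH ?(ltnW rn) // add1n Y_innerE //.
apply/vec_eq => l; rewrite basis_labelsE /Y_inner.
case: l => [j|j|] _ //; last by do 2?case: ifP => _; rewrite ?mulr0 ?addr0.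
case: j => [|j] //; case: (ltngtP j r) => [jr|jr|->]; decide_ifs; rewrite ?mulr1 //.
by case: (eqVneq j r.+1) => [->|jr2]; decide_ifs; rewrite //= mulr0 add0r.
Qed.

(** The vector after Y_i, ..., Y_n have acted on the result of the descending half. The coordinates
    of v_j and v_{bar j} with j > i already have their final values. *)
Definition up_state (i : nat) (l : label) : C :=
  match l with
  | V 0 => g (V n)
  | V j => if (j < i)%N then xb j else if j == i then XX i
           else (XX j.-1 + XX j) / UU j.-1
  | Vb j => if (j < i)%N then 0 else if j == i then 1 else UU j.-1
  | Phi => 0
  end.

Lemma xb_lt i : (i < n.-1)%N -> xb i = g (Vb i).
Proof. by rewrite /xb => ni; rewrite (_ : _ == _ = false) ?andbF //; lia. Qed.

Definition down_rank : nat := if is_D1 t then n.-2 else n.-1.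

Lemma labels1E : labels1 t n = (if p0 t == 0%N then [::] else [:: V 0]) ++
  [seq V i | i <- iota 1 (n - 1)] ++ V n :: [seq Vb i | i <- rev (iota 1 down_rank)].
Proof.
have E : iota 1 n = rcons (iota 1 (n - 1)) n.
  by rewrite -[in LHS](subnK (ltnW n2)) addn1 iotaS_last subnKC // ltnW.
have E0 : iota 0 n.+1 = 0%N :: iota 1 n by [].
rewrite /down_rank; case: t ct => //= _; by rewrite /labels1 ?E0 ?E ?map_cons ?map_rcons ?cat_rcons.
Qed.

Lemma foldY_last :
  foldY (vect C t n (V 1)) (V n :: [seq Vb i | i <- rev (iota 1 down_rank)]) =
  vec t n (up_state n).
Proof.
rewrite /= foldY_down /down_rank; last by case: ifP; lia.
case: (boolP (is_D1 t)) => [tD|tD].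
  have n4 : (4 <= n)%N by move: ad; rewrite (isD1P tD).
  rewrite Y_lastDE //; apply/vec_eq => l; rewrite basis_labelsE /Y_lastD (isD1P tD).
  case: l => [[|j]|[|j]|] // jn; rewrite ?eq_label /up_state.
  - have jn' : (j < n)%N by lia.
    case: (eqVneq j.+1 n) => [->|jn1].
      by decide_ifs; rewrite /XX tD; decide_ifs; rewrite /= mulr0.
    case: (eqVneq j.+1 n.-1) => [->|jn2]; decide_ifs.
      by rewrite /xb tD eqxx /= mulr1.
    by rewrite xb_lt //; lia.
  - have jn' : (j < n)%N by lia.
    case: (eqVneq j.+1 n) => [->|jn1].
      by decide_ifs; rewrite mulr0 add0r.
    by case: (eqVneq j.+1 n.-1) => [->|jn2]; decide_ifs; rewrite ?mulr0 ?add0r.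
have pnE : pn t = 1%N \/ pn t = 2%N by case: t; auto.
have S l : (if l is V j then if (0 < j <= n.-1)%N then g (Vb j) else (j == n.-1.+1)%:R else 0) =
   match l with V j => if (0 < j < n)%N then xb j else (j == n)%:R | _ => 0 end.
  rewrite (prednK (ltnW n2)); case: l => [[|j]|j|] //.
  rewrite /xb (negPf tD); have -> : (j.+1 <= n.-1)%N = (j.+1 < n)%N by lia.
  by [].
rewrite (funext S).
case: pnE => pE.
  rewrite Y_last1E //; apply/vec_eq => l; rewrite basis_labelsE /Y_last1.
  case: l => [[|j]|[|j]|] // jn; rewrite ?eq_label /up_state.
  - by move: jn tD pE; case: t.
  - have jn' : (j < n)%N by case: t ct jn => //=; lia.
    case: (eqVneq j.+1 n) => [->|jn1]; last by decide_ifs.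
    by decide_ifs; rewrite /XX (negPf tD) pE; decide_ifs; rewrite mulr1.
  - have jn' : (j < n)%N by case: t ct jn => //=; lia.
    case: (eqVneq j.+1 n) => [->|jn1]; last by decide_ifs.
    by decide_ifs; rewrite mulr0 add0r.
rewrite Y_last2E //; apply/vec_eq => l; rewrite basis_labelsE /Y_last2.
case: l => [[|j]|[|j]|] // jn; rewrite ?eq_label /up_state.
- by decide_ifs; rewrite /= add0r mulr1.
- have jn' : (j < n)%N by case: t ct jn => //=; lia.
  case: (eqVneq j.+1 n) => [->|jn1]; last by decide_ifs.
  by decide_ifs; rewrite /XX (negPf tD) pE; decide_ifs; rewrite mulr1.
- have jn' : (j < n)%N by case: t ct jn => //=; lia.
  case: (eqVneq j.+1 n) => [->|jn1]; last by decide_ifs.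
  by decide_ifs; rewrite /= !mulr0 !add0r.
Qed.

(** Passing from i+1 to i, the operator Y_i turns the coordinate X_{i+1} of v_{i+1} into X_{i+1} / g
    (V i) + [xb i], which is (X_i + X_{i+1}) / g (V i) because X_i = g (V i) [xb i]. This is the
    source of the sums of neighbouring X. *)
Lemma foldY_up k : (k < n)%N ->
  foldY (vec t n (up_state n)) [seq V j | j <- iota (n - k) k] =
  vec t n (up_state (n - k)).
Proof.
elim: k => [|k IH] kn; first by rewrite subn0.
have nk : (n - k = (n - k.+1).+1)%N by lia.
move: IH; rewrite nk /= => -> //; last exact: ltnW.
have i0 : (0 < n - k.+1)%N by lia.
move: (n - k.+1)%N nk i0 => i nk i0; rewrite Y_innerE //; last by lia.
apply/vec_eq => l lB; rewrite /Y_inner /up_state.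
case: l lB => [[|j]|j|] lB //.
- by decide_ifs.
- case: (ltngtP j.+1 i) => [ji|ji|->]; decide_ifs => //.
    case: (eqVneq j i) => [->|ji']; decide_ifs => //.
    case: (i) i0 nk => // m _ nk; decide_ifs.
    have XE : XX m.+1 = g (V m.+1) * xb m.+1 by rewrite /XX; decide_ifs.
    by rewrite /= XE /UU /=; field; exact: g0.
  by rewrite /XX; decide_ifs.
- case: (ltngtP j i) => [ji|ji|->]; decide_ifs => //; last by rewrite mulr0 add0r.
  case: (eqVneq j i.+1) => [->|ji']; decide_ifs => //.
  by rewrite mulr1 /UU; decide_ifs.
Qed.

Lemma v1_ptE : orbit_point t n (V 1) (@pt (labels1 t n) (word1 t n) C g) =
  vec t n v1_coef.
Proof.
rewrite (orbit_pointE _ _ (word1E t n)) labels1E !foldr_cat foldY_last.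
have := @foldY_up (n - 1)%N; rewrite subKn ?(ltnW n2) // => ->; last by lia.
have p0E : p0 t = 0%N \/ p0 t = 1%N \/ p0 t = 2%N by case: t; auto.
(* At a fork the word has no letter 0 and Y_1 is the last operator. Otherwise Y_0 still replaces X_1
   by (X_0 + X_1) / U_0 at v_1. *)
case: p0E => [pE|pE].
  rewrite pE /=; apply/vec_eq => l; rewrite basis_labelsE /up_state /v1_coef.
  case: l => [[|[|j]]|[|[|j]]|] // jn; rewrite ?pE ?expr0 //; decide_ifs => //.
    by rewrite /UU /= pE.
  by move: jn pE; case: t.
have -> : (p0 t == 0%N) = false by case: pE => ->.
rewrite /=; case: pE => pE.
  rewrite Y_zero1E //; apply/vec_eq => l; rewrite basis_labelsE /up_state /v1_coef.
  case: l => [[|[|j]]|[|[|j]]|] // jn; rewrite /Y_zero1 ?eq_label //=; decide_ifs => //.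
  - rewrite (_ : XX 0 = g (V 0) ^+ p0 t) // /UU /= pE; field; exact: g0.
  - by rewrite mulr1 /UU pE.
  - by move: jn pE; case: t.
rewrite Y_zero2E //; apply/vec_eq => l; rewrite basis_labelsE /up_state /v1_coef.
case: l => [[|[|j]]|[|[|j]]|] // jn; rewrite /Y_zero2 ?eq_label //=; decide_ifs => //.
- rewrite (_ : XX 0 = g (V 0) ^+ p0 t) // /UU /= pE; field; exact: g0.
- by rewrite mulr1 /UU pE.
- by rewrite add0r mulr1.
Qed.

End Points.

(** * The points for A_n^(1) and for the second word of the dagger type *)

Section OtherPoints.

Context (C : numClosedFieldType) (n : nat) (g : label -> C).
Hypothesis g0 : forall l, g l != 0.
Local Notation foldY := (foldr (fun l' u => Y (lidx l') (g l') u)).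

Lemma v1_pt_A1 : admissible A1 n ->
  orbit_point A1 n (V 1) (@pt (labels1 A1 n) (word1 A1 n) C g) =
  vec A1 n (fun l => if l is V j then if j == n.+1 then 1 else g (V j) else 0).
Proof.
move=> ad; rewrite (orbit_pointE _ _ (word1E A1 n)) /labels1.
suff H r : (r <= n)%N ->
    foldY (vect C A1 n (V 1)) [seq V i | i <- rev (iota 1 r)] =
    vec A1 n (fun l => if l is V j then
      if (1 <= j <= r)%N then g (V j) else (j == r.+1)%:R else 0).
  rewrite H //; apply/vec_eq => l; rewrite basis_labelsE.
  case: l => [[|j]|[|j]|] //= jn; rewrite eqSS.
  by case: (eqVneq j n) => jn'; decide_ifs.
elim: r => [|r IH] rn.
  by rewrite /= vectE; apply/vec_eq => l lB; case: l {lB} => [[|j]|j|].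
rewrite rev_iotaS /= IH ?(ltnW rn) // add1n Y_A1E //.
apply/vec_eq => l; rewrite basis_labelsE /Y_A1.
case: l => [[|j]|[|j]|] // jn; rewrite ?eq_label.
case: (ltngtP j r) => [jr|jr|->]; decide_ifs; rewrite ?mulr1 //.
by case: (eqVneq j r.+1) => [->|jr2]; decide_ifs; rewrite //= mulr0 add0r.
Qed.

(** The mirror image of [v1_coef]: the second word runs through the diagram in the opposite
    direction, so the sums of neighbouring X now sit at v_{bar i} and the simple coordinates at
    v_i. *)
Definition v2_coef (l : label) : C :=
  match l with
  | V 0 => g (V n)
  | V i => if i == n then XX A2dag n g n else g (V i)
  | Vb i => (XX A2dag n g i.-1 + XX A2dag n g i) /
            (if i == n then XX A2dag n g n else g (V i))
  | Phi => 0
  end.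

Local Notation X := (XX A2dag n g).

Let XE i : (0 < i < n)%N -> X i = g (V i) * g (Vb i).
Proof. by move=> ni; rewrite /XX /xb; decide_ifs. Qed.

Lemma v2_ptE : admissible A2dag n ->
  orbit_point A2dag n (Vb n) (@pt (labels2 A2dag n) (word2 A2dag n) C g) =
  vec A2dag n v2_coef.
Proof.
move=> ad; rewrite (orbit_pointE _ _ (word2E A2dag n)) /labels2.
have n2 : (2 <= n)%N by [].
have -> : iota 0 n.+1 = 0%N :: rcons (iota 1 (n - 1)) n.
  rewrite /=; congr cons.
  by rewrite -[in LHS](subnK (ltnW n2)) addn1 iotaS_last subnKC // ltnW.
rewrite rev_cons rev_rcons -cats1 /= map_cat -!catA !foldr_cat.
(* [G i] is the vector after Y_i, ..., Y_{n-1} have acted on v_{bar n}. *)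
pose G i l : C := if l is Vb j then
  if (j < i)%N then 0 else if j == i then 1 else g (Vb j.-1) else 0.
have H1 k : (k < n)%N -> foldY (vect C A2dag n (Vb n)) [seq Vb i | i <- iota (n - k) k] =
    vec A2dag n (G (n - k)%N).
  elim: k => [|k IH] kn.
    rewrite subn0 /= vectE; apply/vec_eq => l; rewrite basis_labelsE /G.
    case: l => [j|[|j]|] // jn; rewrite eq_label.
    by case: (ltngtP j.+1 n) => // jn'; lia.
  have nk : (n - k = (n - k.+1).+1)%N by lia.
  move: IH; rewrite nk /= => -> //; last exact: ltnW.
  have i0 : (0 < n - k.+1)%N by lia.
  move: (n - k.+1)%N nk i0 => i nk i0; rewrite Y_innerE //; last by lia.
  apply/vec_eq => l lB; rewrite /Y_inner /G.
  case: l lB => [j|j|] lB //; first by do 2?case: ifP => _; rewrite ?mulr0 ?addr0.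
  case: (ltngtP j i) => [ji|ji|->]; decide_ifs => //; last by rewrite mulr0 add0r.
  case: (eqVneq j i.+1) => [->|ji']; decide_ifs => //.
  by rewrite mulr1.
have := H1 (n - 1)%N; rewrite subKn ?(ltnW n2) // -subn1 => ->; last by lia.
(* [D r] is the vector after Y_0 and then Y_1, ..., Y_r have acted on [G 1]. *)
pose D r l : C := match l with
  | V j => if (0 < j <= r)%N then g (V j) else (j == r.+1)%:R
  | Vb j => if (j <= r)%N then (X j.-1 + X j) / g (V j)
            else if j == r.+1 then X r else g (Vb j.-1)
  | Phi => 0 end.
have -> : foldY (vec A2dag n (G 1%N)) [:: V 0] = vec A2dag n (D 0%N).
  rewrite /= Y_zero1E //; apply/vec_eq => l; rewrite basis_labelsE /Y_zero1 /G /D.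
  case: l => [[|j]|[|j]|] // jn; rewrite ?eq_label //=.
    by case: j {jn} => [|j] /=; rewrite ?mulr0 ?add0r.
  by case: j {jn} => [|j] /=; rewrite ?mulr1.
have H2 r : (r < n)%N -> foldY (vec A2dag n (D 0%N)) [seq V i | i <- rev (iota 1 r)] =
    vec A2dag n (D r).
  elim: r => [|r IH] rn //.
  rewrite rev_iotaS /= IH ?(ltnW rn) // add1n Y_innerE //.
  apply/vec_eq => l; rewrite basis_labelsE /Y_inner /D.
  case: l => [[|j]|[|j]|] // jn.
    case: (ltngtP j r) => [jr|jr|->]; decide_ifs; rewrite ?mulr1 //.
    by case: (eqVneq j r.+1) => [->|jr2]; decide_ifs; rewrite //= mulr0 add0r.
  case: (ltngtP j r) => [jr|jr|->]; decide_ifs => //.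
    case: (eqVneq j r.+1) => [->|jr2]; decide_ifs => //.
    by rewrite XE //; lia.
  by rewrite /= (@XE r.+1); [field; exact: g0|lia].
rewrite H2; last by lia.
rewrite /= Y_last2E //; apply/vec_eq => l; rewrite basis_labelsE /Y_last2 /D /v2_coef.
have Xn : X n = g (V n) ^+ 2 by rewrite /XX; decide_ifs.
case: l => [[|j]|[|j]|] // jn; rewrite ?eq_label.
- by decide_ifs; rewrite /= add0r mulr1.
- case: (eqVneq j.+1 n) => [->|jn1]; decide_ifs => //.
  by rewrite mulr1 Xn.
- case: (eqVneq j.+1 n) => [->|jn1]; decide_ifs => //.
  by rewrite /= mulr0 addr0 Xn (_ : n - 1 = n.-1)%N ?subn1 //; field; exact: g0.
Qed.

End OtherPoints.

(** * Cartan entries around a node *)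

Lemma cartan_inner t n j i : classical_type t -> admissible t n ->
  (1 <= i <= down_rank t n)%N -> (p0 t == 0%N <= j <= n)%N ->
  cartan t n j i =
    if j == i then 2
    else if j.+1 == i then (if j == 0%N then - (p0 t)%:Z else -1)
    else if j == i.+1 then (if j == n then - (pn t)%:Z else -1)
    else if is_D1 t && (j == n) && (i == n.-2) then -1 else 0.
Proof.
rewrite /cartan /edge /minus_two_entries /down_rank.
by case: t => //= _ ad ir jr; rewrite ?inE ?xpair_eqE /=; repeat case: ifP => ?; lia.
Qed.

(** Outside D_n^(1) one has a_{n-1,n} a_{n,n-1} = 2, so when one entry is -[pn] the other is -(3 -
    [pn]). The difference 3 - [p0] plays the same part at the other end of a line. *)
Lemma cartan_last t n j : classical_type t -> ~~ is_D1 t -> admissible t n ->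
  (p0 t == 0%N <= j <= n)%N ->
  cartan t n j n =
    if j == n then 2 else if j == n.-1 then - (3 - pn t)%N%:Z else 0.
Proof.
rewrite /cartan /edge /minus_two_entries.
by case: t => //= _ _ ad jr; rewrite ?inE ?xpair_eqE /=; repeat case: ifP => ?; lia.
Qed.

Lemma cartan_D1 n j i : admissible D1 n -> (1 <= j <= n)%N -> i = n \/ i = n.-1 ->
  cartan D1 n j i = if j == i then 2 else if j == n.-2 then -1 else 0.
Proof.
rewrite /cartan /edge /minus_two_entries.
by move=> /= ad jr [] ->; rewrite ?inE ?xpair_eqE /=; repeat case: ifP => ?; lia.
Qed.

Lemma cartan_zero n j : admissible A2dag n -> (j <= n)%N ->
  cartan A2dag n j 0 = if j == 0%N then 2 else if j == 1%N then -2 else 0.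
Proof.
rewrite /cartan /edge /minus_two_entries.
by move=> /= ad jr; rewrite ?inE ?xpair_eqE /=; repeat case: ifP => ?; lia.
Qed.

Lemma cartan_A1 n j i : admissible A1 n -> (1 <= j <= n)%N -> (1 <= i <= n)%N ->
  cartan A1 n j i = if j == i then 2 else if j == i.+1 then -1 else
    if j == i.-1 then -1 else 0.
Proof.
move=> /= ad jr ir; rewrite /cartan /edge /minus_two_entries in_nil.
have E a b : (1 <= a <= n)%N -> (1 <= b <= n)%N -> (b == a.+1 %% n.+1)%N = (b == a.+1).
  move=> an bn; case: (ltnP a n) => an'; first by rewrite modn_small.
  have -> : a = n by lia.
  by rewrite modnn; lia.
by rewrite !E //; repeat case: ifP => ?; lia.
Qed.

(** Reduces a product over the whole word to the few letters adjacent to i; the side condition on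
    membership decides which of them really occur. *)
Lemma prod_supp (R : comRingType) (T : eqType) (s S : seq T) (f : T -> R) :
  uniq s -> uniq S -> (forall x, x \in s -> x \notin S -> f x = 1) ->
  \prod_(x <- s) f x = \prod_(x <- S | x \in s) f x.
Proof.
move=> us uS H; rewrite (bigID (fun x => x \in S)) /=.
have -> : \prod_(x <- s | x \notin S) f x = 1.
  by rewrite big_seq_cond big1 // => x /andP[xs xS]; apply: H.
rewrite mulr1 -[LHS]big_filter -[RHS]big_filter; apply: perm_big.
by apply: uniq_perm; rewrite ?filter_uniq // => x; rewrite !mem_filter andbC.
Qed.

Lemma P_lab_split (C : numClosedFieldType) labs t n (g : label -> C) i s1 l s2 :
  labs = s1 ++ l :: s2 -> l \notin s1 ->
  P_lab labs t n g i l =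
  ((\prod_(l' <- s1) g l' ^ cartan t n (lidx l') i) * g l)^-1.
Proof.
move=> -> ls1; rewrite /P_lab index_cat (negPf ls1) /= eqxx addn0.
by rewrite take_size_cat.
Qed.

Lemma filter_V s i : uniq s ->
  [seq l <- [seq V j | j <- s] | lidx l == i] = if i \in s then [:: V i] else [::].
Proof.
move=> us; rewrite filter_map /=; case: (boolP (i \in s)) => iS.
  by rewrite (filter_pred1_uniq us iS).
rewrite (_ : [seq _ <- s | _] = [::]) //; apply/eqP; rewrite -[_ == _]negbK -has_filter.
by apply/hasPn => j js /=; apply: contraNneq iS => <-.
Qed.

Lemma filter_Vb s i : uniq s ->
  [seq l <- [seq Vb j | j <- s] | lidx l == i] = if i \in s then [:: Vb i] else [::].
Proof.
move=> us; rewrite filter_map /=; case: (boolP (i \in s)) => iS.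
  by rewrite (filter_pred1_uniq us iS).
rewrite (_ : [seq _ <- s | _] = [::]) //; apply/eqP; rewrite -[_ == _]negbK -has_filter.
by apply/hasPn => j js /=; apply: contraNneq iS => <-.
Qed.

(** * The functions eps_i and gamma_i on a word *)

Section Formulas.

Context (C : numClosedFieldType) (t : affine_type) (n : nat) (g : label -> C).
Hypothesis ad : admissible t n.
Hypothesis ct : classical_type t.
Hypothesis g0 : forall l, g l != 0.
Local Notation L := (labels1 t n).
Local Notation P := (P_lab L t n g).
Local Notation X := (XX t n g).
Local Notation U := (UU t g).
Local Notation dr := (down_rank t n).
Local Notation b0 := (nat_of_bool (p0 t == 0%N)).

Let n2 : (2 <= n)%N. Proof. exact: n_ge2 ad. Qed.

Lemma down_rank_lt : (dr < n)%N.
Proof. by rewrite /down_rank; case: ifP; lia. Qed.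

Lemma labels1E' : L = [seq V i | i <- iota b0 (n.+1 - b0)] ++ [seq Vb i | i <- rev (iota 1 dr)].
Proof. by rewrite /down_rank; case: t ct => //= _; rewrite subn1. Qed.

Lemma mem_labels1 l : l \in L = match l with
  | V i => (b0 <= i <= n)%N | Vb i => (1 <= i <= dr)%N | Phi => false end.
Proof. by rewrite labels1E' mem_cat; case: l => [i|i|]; rewrite !mem_label //=; lia. Qed.

Lemma split_V i : (b0 <= i <= n)%N ->
  L = [seq V j | j <- iota b0 (i - b0)] ++ V i ::
      ([seq V j | j <- iota i.+1 (n - i)] ++ [seq Vb j | j <- rev (iota 1 dr)]).
Proof.
move=> ni; rewrite labels1E' (_ : n.+1 - b0 = (i - b0) + (n - i).+1)%N; last by lia.
by rewrite iotaD subnKC ?map_cat -?catA //; lia.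
Qed.

Lemma split_Vb i : (1 <= i <= dr)%N ->
  L = ([seq V j | j <- iota b0 (n.+1 - b0)] ++ [seq Vb j | j <- rev (iota i.+1 (dr - i))])
      ++ Vb i :: [seq Vb j | j <- rev (iota 1 i.-1)].
Proof.
move=> ni; rewrite labels1E' -catA; congr (_ ++ _).
rewrite (_ : dr = i.-1 + (dr - i).+1)%N; last by lia.
rewrite iotaD rev_cat map_cat (_ : 1 + i.-1 = i)%N; last by lia.
by rewrite [iota i _]/= rev_cons map_rcons cat_rcons (_ : _ - i = dr - i)%N //; lia.
Qed.

Lemma filter_inner i : (1 <= i <= dr)%N ->
  [seq l <- L | lidx l == i] = [:: V i; Vb i].
Proof.
move=> ni; have dn := down_rank_lt; rewrite labels1E' filter_cat.
rewrite filter_V ?iota_uniq // filter_Vb ?rev_uniq ?iota_uniq // mem_rev !mem_iota.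
by decide_ifs.
Qed.

Lemma filter_single i : (dr < i <= n)%N -> [seq l <- L | lidx l == i] = [:: V i].
Proof.
move=> ni; rewrite labels1E' filter_cat.
rewrite filter_V ?iota_uniq // filter_Vb ?rev_uniq ?iota_uniq // mem_rev !mem_iota.
by decide_ifs.
Qed.

Lemma index_V_Vb i : (1 <= i <= dr)%N -> (index (V i) L < index (Vb i) L)%N.
Proof.
move=> ni; have dn := down_rank_lt; rewrite labels1E' !index_cat !mem_label.
by decide_ifs; rewrite ltn_addr // index_mem memVV mem_iota; lia.
Qed.

Lemma prod_V a m i S : uniq S ->
  (forall j, (a <= j < a + m)%N -> j \notin S -> cartan t n j i = 0) ->
  \prod_(l <- [seq V j | j <- iota a m]) g l ^ cartan t n (lidx l) i =
  \prod_(j <- S | (a <= j < a + m)%N) g (V j) ^ cartan t n j i.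
Proof.
move=> uS H; rewrite big_map (prod_supp (iota_uniq a m) uS) => [|j].
  by apply: eq_bigl => j; rewrite mem_iota.
by rewrite mem_iota => jr jS; rewrite H.
Qed.

Lemma prod_Vb a m i S : uniq S ->
  (forall j, (a <= j < a + m)%N -> j \notin S -> cartan t n j i = 0) ->
  \prod_(l <- [seq Vb j | j <- rev (iota a m)]) g l ^ cartan t n (lidx l) i =
  \prod_(j <- S | (a <= j < a + m)%N) g (Vb j) ^ cartan t n j i.
Proof.
move=> uS H; rewrite big_map (prod_supp _ uS) ?rev_uniq ?iota_uniq // => [|j].
  by apply: eq_bigl => j; rewrite mem_rev mem_iota.
by rewrite mem_rev mem_iota => jr jS; rewrite H.
Qed.

Lemma prod_V_below i : (1 <= i <= dr)%N ->
  \prod_(l <- [seq V j | j <- iota b0 (i - b0)]) g l ^ cartan t n (lidx l) i =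
  (U i.-1)^-1.
Proof.
move=> ni; have dn := down_rank_lt.
rewrite (@prod_V _ _ _ [:: i.-1]) // => [|j jr]; last first.
  rewrite inE => ji; rewrite cartan_inner //; last lia.
  by decide_ifs.
rewrite big_cons big_nil mulr1; case: (eqVneq i 1%N) => [iE|i1].
  subst i; case: (posnP (p0 t)) => pE; first by rewrite /UU pE /= expr0 invr1.
  rewrite /UU /=; decide_ifs; rewrite cartan_inner //; last lia.
  by rewrite /= -exprnN.
decide_ifs; rewrite cartan_inner //; try lia.
by decide_ifs; rewrite /UU; decide_ifs; rewrite exprN1.
Qed.

Lemma P_inner1 i : (1 <= i <= dr)%N -> P i (V i) = U i.-1 / g (V i).
Proof.
move=> ni; have dn := down_rank_lt; have ni' : (b0 <= i <= n)%N by lia.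
rewrite (P_lab_split _ _ _ _ (split_V ni')); last by rewrite memVV mem_iota; lia.
by rewrite prod_V_below // invfM invrK.
Qed.

(** To the right of i only the letter i+1 contributes, except at i = [dr]: there it is the letter n
    with exponent -[pn], or for D_n^(1) both letters n-1 and n. In either case the contribution is
    the inverse of X_{i+1}. *)
Lemma prod_V_full i : (1 <= i <= dr)%N ->
  \prod_(l <- [seq V j | j <- iota b0 (n.+1 - b0)]) g l ^ cartan t n (lidx l) i =
  (U i.-1)^-1 * (g (V i) ^+ 2 *
   (if i == dr then (X i.+1)^-1 else (g (V i.+1))^-1)).
Proof.
move=> ni; have dn := down_rank_lt.
have E : (n.+1 - b0 = (i - b0) + (n.+1 - i))%N by lia.
rewrite E iotaD map_cat big_cat prod_V_below //= (_ : b0 + (i - b0) = i)%N; last lia.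
congr (_ * _); case: (boolP (is_D1 t && (i == dr))) => [/andP[tD iE]|nD].
  have iE' : i = n.-2 by move: iE; rewrite /down_rank tD => /eqP.
  rewrite (@prod_V _ _ _ [:: i; i.+1; n]) => [||j jr]; last first.
  - by rewrite !inE !negb_or => ji; exfalso; lia.
  - by rewrite /= !inE; lia.
  have n4 : (4 <= n)%N by move: ad; rewrite (isD1P tD).
  rewrite iE !big_cons big_nil; decide_ifs; rewrite !cartan_inner //; try lia.
  decide_ifs; rewrite !exprN1 mulr1 -[g (V i) ^ 2]/(g (V i) ^+ 2).
  by congr (_ * _); rewrite /XX /xb tD; decide_ifs; rewrite invfM.
rewrite (@prod_V _ _ _ [:: i; i.+1]) => [||j jr]; last first.
- rewrite !inE !negb_or => ji; rewrite cartan_inner //; last lia.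
  rewrite /down_rank in nD ni dn; case: (is_D1 t) nD ni dn => nD ni dn; by decide_ifs.
- by rewrite /= !inE; lia.
rewrite !big_cons big_nil; decide_ifs; rewrite !cartan_inner //; try lia.
rewrite mulr1 eqxx (_ : i.+1 == i = false); last lia.
rewrite (_ : i.+2 == i = false); last lia.
rewrite eqxx -[g (V i) ^ 2]/(g (V i) ^+ 2); congr (_ * _).
case: (eqVneq i dr) => iE.
  move: nD; rewrite iE eqxx andbT => nD.
  have -> : dr.+1 = n by rewrite /down_rank (negPf nD) prednK // ltnW.
  by rewrite eqxx /XX eqxx (negPf nD); decide_ifs; rewrite -exprnN.
by rewrite ifF ?exprN1 //; lia.
Qed.

Lemma X_inner i : (1 <= i <= dr)%N -> X i = g (V i) * g (Vb i).
Proof.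
move=> ni; have dn := down_rank_lt; rewrite /XX; decide_ifs; congr (_ * _).
rewrite /xb; case: (boolP (is_D1 t)) => tD; last by [].
have n4 : (4 <= n)%N by move: ad; rewrite (isD1P tD).
by move: ni; rewrite /down_rank tD => ni; decide_ifs.
Qed.

(** Together with [P_inner1], the two terms of eps_i are in the ratio X_i : X_{i+1}. This turns the
    quotients of [e_word_two] into rho and c / rho. *)
Lemma P_inner2 i : (1 <= i <= dr)%N ->
  P i (Vb i) = U i.-1 * X i.+1 / (g (V i) * X i).
Proof.
move=> ni; have dn := down_rank_lt; rewrite (P_lab_split _ _ _ _ (split_Vb ni)); last first.
  by rewrite mem_cat memVbV memVbVb mem_rev mem_iota; lia.
rewrite big_cat /= prod_V_full // (@prod_Vb _ _ _ [:: i.+1]) => [||j jr]; last first.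
- rewrite !inE => ji; rewrite cartan_inner //; last by lia.
  rewrite /down_rank in ni jr; case: (is_D1 t) ni jr => ni jr; by decide_ifs.
- by [].
rewrite big_cons big_nil; case: (eqVneq i dr) => iE.
  decide_ifs; rewrite mulr1 (X_inner ni) !invfM !invrK; field.
  by rewrite !g0.
decide_ifs; rewrite cartan_inner //; try lia.
decide_ifs; rewrite mulr1 exprN1 (X_inner ni) (@X_inner i.+1); last lia.
rewrite !invfM !invrK; field.
by rewrite !g0.
Qed.

Lemma gamma_inner i : (1 <= i <= dr)%N ->
  \prod_(l <- L) g l ^ cartan t n (lidx l) i = X i ^+ 2 / (X i.-1 * X i.+1).
Proof.
move=> ni; have dn := down_rank_lt.
rewrite labels1E' big_cat /= prod_V_full // (@prod_Vb _ _ _ [:: i.-1; i; i.+1]) => [||j jr]; last first.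
- rewrite !inE !negb_or => ji; rewrite cartan_inner //; last by lia.
  rewrite /down_rank in ni jr; case: (is_D1 t) ni jr => ni jr; by decide_ifs.
- by rewrite /= !inE; lia.
rewrite !big_cons big_nil.
have Ci : cartan t n i i = 2 by rewrite cartan_inner ?eqxx //; lia.
have Cm : (1 < i)%N -> cartan t n i.-1 i = -1.
  by move=> i1; rewrite cartan_inner //; [decide_ifs|lia].
have Cp : (i < dr)%N -> cartan t n i.+1 i = -1.
  by move=> i1; rewrite cartan_inner //; [decide_ifs|lia].
have Xm : (1 < i)%N -> X i.-1 = g (V i.-1) * g (Vb i.-1) by move=> i1; apply: X_inner; lia.
have Xp : (i < dr)%N -> X i.+1 = g (V i.+1) * g (Vb i.+1) by move=> i1; apply: X_inner; lia.
have Um : (1 < i)%N -> U i.-1 = g (V i.-1) by move=> i1; rewrite /UU; decide_ifs.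
rewrite (X_inner ni); case: (eqVneq i 1%N) => i1.
  have -> : X i.-1 = U i.-1 by rewrite i1.
  case: (eqVneq i dr) => iE; decide_ifs; rewrite Ci -[g (Vb i) ^ 2]/(g (Vb i) ^+ 2).
    by rewrite mulr1 !invfM; ring.
  by rewrite Cp ?Xp ?exprN1 ?mulr1; [rewrite exprMn !invfM; ring|lia..].
case: (eqVneq i dr) => iE; decide_ifs;
  rewrite Ci Cm ?Xm ?Um ?exprN1 ?mulr1 -?[g (Vb i) ^ 2]/(g (Vb i) ^+ 2); try lia.
  by rewrite exprMn !invfM; ring.
by rewrite Cp ?Xp ?exprN1; [rewrite exprMn !invfM; ring|lia..].
Qed.

Lemma gamma_last : ~~ is_D1 t ->
  \prod_(l <- L) g l ^ cartan t n (lidx l) n = g (V n) ^+ 2 / X n.-1 ^+ (3 - pn t).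
Proof.
move=> nD; have drE : dr = n.-1 by rewrite /down_rank (negPf nD).
rewrite labels1E' big_cat /= (@prod_V _ _ _ [:: n.-1; n]) => [||j jr]; last first.
- rewrite !inE !negb_or => ji; rewrite cartan_last //; last by lia.
  by decide_ifs.
- by rewrite /= !inE; lia.
rewrite (@prod_Vb _ _ _ [:: n.-1]) => [||j jr]; last first.
- rewrite !inE => ji; rewrite cartan_last //; last by lia.
  by decide_ifs.
- by [].
rewrite !big_cons !big_nil drE; decide_ifs; rewrite !cartan_last //; try lia.
decide_ifs; rewrite !mulr1 X_inner ?drE; last lia.
by rewrite exprMn -!exprnN -[g (V n) ^ 2]/(g (V n) ^+ 2) invfM; ring.
Qed.

Lemma P_last : ~~ is_D1 t -> P n (V n) = g (V n.-1) ^+ (3 - pn t) / g (V n).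
Proof.
move=> nD; have ni' : (b0 <= n <= n)%N by lia.
rewrite (P_lab_split _ _ _ _ (split_V ni')); last by rewrite memVV mem_iota; lia.
rewrite (@prod_V _ _ _ [:: n.-1]) => [||j jr]; last first.
- rewrite !inE => ji; rewrite cartan_last //; last by lia.
  by decide_ifs.
- by [].
rewrite !big_cons !big_nil; decide_ifs; rewrite !cartan_last //; try lia.
by decide_ifs; rewrite mulr1 -exprnN invfM invrK.
Qed.

Lemma gamma_D1 i : is_D1 t -> i = n \/ i = n.-1 ->
  \prod_(l <- L) g l ^ cartan t n (lidx l) i = g (V i) ^+ 2 / X n.-2.
Proof.
move=> tD iE; have n4 : (4 <= n)%N by move: ad; rewrite (isD1P tD).
have pE : p0 t = 0%N by rewrite (isD1P tD).
have drE : dr = n.-2 by rewrite /down_rank tD.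
have Ci j : (1 <= j <= n)%N -> cartan t n j i = if j == i then 2 else if j == n.-2 then -1 else 0.
  by move: ad; rewrite (isD1P tD) => adD jr; rewrite cartan_D1.
rewrite labels1E' big_cat /= (@prod_V _ _ _ [:: n.-2; i]) => [||j jr]; last first.
- rewrite !inE !negb_or => ji; rewrite Ci //; last by lia.
  by decide_ifs.
- by rewrite /= !inE; lia.
rewrite (@prod_Vb _ _ _ [:: n.-2]) => [||j jr]; last first.
- rewrite !inE => ji; rewrite Ci //; last by lia.
  by decide_ifs.
- by [].
rewrite !big_cons !big_nil drE; decide_ifs; rewrite !Ci //; try lia.
decide_ifs; rewrite !mulr1 X_inner ?drE; last lia.
by rewrite !exprN1 -[g (V i) ^ 2]/(g (V i) ^+ 2) invfM; ring.
Qed.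

Lemma P_D1 i : is_D1 t -> i = n \/ i = n.-1 -> P i (V i) = g (V n.-2) / g (V i).
Proof.
move=> tD iE; have n4 : (4 <= n)%N by move: ad; rewrite (isD1P tD).
have pE : p0 t = 0%N by rewrite (isD1P tD).
have Ci j : (1 <= j <= n)%N -> cartan t n j i = if j == i then 2 else if j == n.-2 then -1 else 0.
  by move: ad; rewrite (isD1P tD) => adD jr; rewrite cartan_D1.
have ni' : (b0 <= i <= n)%N by lia.
rewrite (P_lab_split _ _ _ _ (split_V ni')); last by rewrite memVV mem_iota; lia.
rewrite (@prod_V _ _ _ [:: n.-2]) => [||j jr]; last first.
- rewrite !inE => ji; rewrite Ci //; last by lia.
  by decide_ifs.
- by [].
rewrite !big_cons !big_nil; decide_ifs; rewrite !Ci //; try lia.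
by decide_ifs; rewrite mulr1 exprN1 invfM invrK.
Qed.

End Formulas.

(** * Node 0 of the second word, and type A *)

Section OtherFormulas.

Context (C : numClosedFieldType) (n : nat) (g : label -> C).
Hypothesis g0 : forall l, g l != 0.

Lemma filter_zero : admissible A2dag n ->
  [seq l <- labels2 A2dag n | lidx l == 0%N] = [:: V 0].
Proof.
move=> ad; rewrite /labels2 filter_cat filter_V ?filter_Vb ?rev_uniq ?iota_uniq //.
by rewrite mem_rev !mem_iota; decide_ifs.
Qed.

Lemma P_zero : admissible A2dag n ->
  P_lab (labels2 A2dag n) A2dag n g 0 (V 0) = g (V 1) ^+ 2 / g (V 0).
Proof.
move=> ad; have n2 : (2 <= n)%N by [].
rewrite (@P_lab_split _ _ _ _ _ _ [seq V i | i <- rev (iota 1 n)] _ [seq Vb i | i <- iota 1 n.-1]).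
- rewrite big_map (@prod_supp _ _ _ [:: 1%N]) ?rev_uniq ?iota_uniq // => [|j]; last first.
    rewrite mem_rev mem_iota inE => jr j1; rewrite [lidx _]/= cartan_zero //; last by lia.
    by decide_ifs.
  rewrite big_cons big_nil mem_rev mem_iota; decide_ifs; rewrite /= cartan_zero //; last lia.
  by rewrite mulr1 -[_ ^ _]/((g (V 1) ^+ 2)^-1) invfM invrK.
- rewrite /labels2 [iota 0 n.+1]/= rev_cons map_rcons cat_rcons //.
- by rewrite memVV mem_rev mem_iota.
Qed.

Lemma gamma_zero : admissible A2dag n ->
  \prod_(l <- labels2 A2dag n) g l ^ cartan A2dag n (lidx l) 0 =
  g (V 0) ^+ 2 / XX A2dag n g 1 ^+ 2.
Proof.
move=> ad; have n2 : (2 <= n)%N by [].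
rewrite /labels2 big_cat !big_map (@prod_supp _ _ (rev (iota 0 n.+1)) [:: 0; 1]%N) ?rev_uniq ?iota_uniq // => [|j]; last first.
  rewrite mem_rev mem_iota !inE => jr j1; rewrite [lidx _]/= cartan_zero //.
  by decide_ifs.
rewrite (@prod_supp _ _ (iota 1 n.-1) [:: 1%N]) ?iota_uniq // => [|j]; last first.
  rewrite mem_iota inE => jr j1; rewrite [lidx _]/= cartan_zero //; last by lia.
  by decide_ifs.
rewrite !big_cons !big_nil !mem_rev !mem_iota; decide_ifs; rewrite /= !cartan_zero //; try lia.
decide_ifs; rewrite !mulr1 -[_ ^ -2]/((g (V 1) ^+ 2)^-1) -[g (Vb 1) ^ _]/((g (Vb 1) ^+ 2)^-1).
have -> : XX A2dag n g 1 = g (V 1) * g (Vb 1) by rewrite /XX /xb; decide_ifs.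
by rewrite exprMn [in RHS]invfM -[g (V 0) ^ 2]/(g (V 0) ^+ 2) [RHS]mulrA.
Qed.

Lemma filter_A1 i : (1 <= i <= n)%N -> [seq l <- labels1 A1 n | lidx l == i] = [:: V i].
Proof.
by move=> ni; rewrite /labels1 filter_V ?rev_uniq ?iota_uniq // mem_rev mem_iota; decide_ifs.
Qed.

Hypothesis g1 : forall l, l \notin labels1 A1 n -> g l = 1.

Lemma P_A1 i : admissible A1 n -> (1 <= i <= n)%N ->
  P_lab (labels1 A1 n) A1 n g i (V i) = g (V i.+1) / g (V i).
Proof.
move=> ad ni.
rewrite (@P_lab_split _ _ _ _ _ _ [seq V i | i <- rev (iota i.+1 (n - i))] _ [seq V i | i <- rev (iota 1 i.-1)]).
- rewrite big_map (@prod_supp _ _ _ [:: i.+1]) ?rev_uniq ?iota_uniq // => [|j]; last first.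
    rewrite mem_rev mem_iota inE => jr j1; rewrite [lidx _]/= cartan_A1 //; last by lia.
    by decide_ifs.
  rewrite big_cons big_nil mem_rev mem_iota; case: (eqVneq i n) => iE; decide_ifs.
    (* The letter n opens the word; its missing neighbour n+1 enters with the default value 1. *)
    by rewrite (@g1 (V i.+1)) ?mul1r // memVV mem_rev mem_iota; lia.
  rewrite /= cartan_A1 //; last lia.
  by decide_ifs; rewrite mulr1 exprN1 invfM invrK.
- rewrite /labels1 (_ : n = i.-1 + (n - i).+1)%N; last by lia.
  rewrite iotaD rev_cat map_cat (_ : 1 + i.-1 = i)%N; last by lia.
  by rewrite [iota i _]/= rev_cons map_rcons cat_rcons (_ : _ - i = n - i)%N //; lia.
- by rewrite memVV mem_rev mem_iota; lia.
Qed.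

Lemma gamma_A1 i : admissible A1 n -> (1 <= i <= n)%N ->
  \prod_(l <- labels1 A1 n) g l ^ cartan A1 n (lidx l) i =
  g (V i) ^+ 2 / (g (V i.-1) * g (V i.+1)).
Proof.
move=> ad ni; rewrite /labels1 big_map.
rewrite (@prod_supp _ _ _ [:: i.-1; i; i.+1]) ?rev_uniq ?iota_uniq // => [||j]; last first.
- rewrite mem_rev mem_iota !inE !negb_or => jr j1; rewrite [lidx _]/= cartan_A1 //.
  by decide_ifs.
- by rewrite /= !inE; lia.
have Ci : cartan A1 n i i = 2 by rewrite cartan_A1 ?eqxx //; lia.
have Cm : (1 < i)%N -> cartan A1 n i.-1 i = -1.
  by move=> i1; rewrite cartan_A1 //; [decide_ifs|lia].
have Cp : (i < n)%N -> cartan A1 n i.+1 i = -1.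
  by move=> i1; rewrite cartan_A1 //; decide_ifs.
have Xm : (i = 1)%N -> g (V i.-1) = 1 by move=> i1; apply: g1; rewrite memVV mem_rev mem_iota; lia.
have Xp : (i = n)%N -> g (V i.+1) = 1 by move=> i1; apply: g1; rewrite memVV mem_rev mem_iota; lia.
rewrite !big_cons !big_nil !mem_rev !mem_iota /= Ci -[g (V i) ^ 2]/(g (V i) ^+ 2).
case: (eqVneq i 1%N) => i1; case: (eqVneq i n) => iE; decide_ifs;
  rewrite ?Cm ?Cp ?exprN1 ?mulr1; try lia.
- by move: ad => /=; lia.
- by rewrite Xm // mul1r.
- by rewrite Xp // mulr1; ring.
- by rewrite invfM; ring.
Qed.

End OtherFormulas.

(** * The birational map sigma-bar *)

Section SigmaVec.

Context (C : numClosedFieldType) (t : affine_type) (n : nat).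
Local Notation B := (basis_labels t n).

(** [s] is the inverse of [sigma_label] on the basis, so each sum over preimages has a single
    term. *)
Lemma sigma_W_vec (s : label -> label) (F : label -> C) :
  {in B, forall l, s l \in B} ->
  {in B &, forall l l', (sigma_label t n l' == l) = (l' == s l)} ->
  sigma_W (vec t n F) = vec t n (F \o s).
Proof.
move=> sB sE; apply/ffunP => b; rewrite !ffunE /=.
have bB := valP b : ssval b \in B; have sbB := sB _ bB.
rewrite (big_pred1 (SeqSub sbB)) => [|b']; first by rewrite ffunE.
by rewrite sE ?(valP b') // -val_eqE.
Qed.

End SigmaVec.

Lemma v2_start1 (C : numClosedFieldType) t n : classical_type t -> t <> A2dag ->
  forall g : label -> C, v2_pt (@pt (labels2 t n) (word2 t n) C g) =
     orbit_point t n (V 1) (@pt (labels1 t n) (word1 t n) C g).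
Proof. by case: t. Qed.

Section EpsLab.

Context (C : numClosedFieldType) (t : affine_type) (n : nat) (g : label -> C).

Definition eps_lab (labs : seq label) (i : nat) : C :=
  \sum_(l <- [seq l <- labs | lidx l == i]) P_lab labs t n g i l.

(** The coordinate of v_i in v(x), except for that of v_1 at a fork. *)
Definition vcoef (i : nat) : C := (XX t n g i.-1 + XX t n g i) / UU t g i.-1.

Hypothesis ad : admissible t n.
Hypothesis ct : classical_type t.
Hypothesis g0 : forall l, g l != 0.
Local Notation L := (labels1 t n).
Local Notation X := (XX t n g).
Local Notation U := (UU t g).
Local Notation dr := (down_rank t n).

Lemma eps_inner i : (1 <= i <= dr)%N -> eps_lab L i = U i.-1 * vcoef i.+1 / X i.
Proof.
move=> ni; have dn := down_rank_lt ad ct; rewrite /eps_lab filter_inner // !big_cons big_nil addr0.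
have UE : U i = g (V i) by rewrite /UU; decide_ifs.
rewrite P_inner1 // P_inner2 // /vcoef /= UE (X_inner g ad ct ni).
by field; rewrite !g0.
Qed.

Lemma eps_last : ~~ is_D1 t -> eps_lab L n = g (V n.-1) ^+ (3 - pn t) / g (V n).
Proof.
move=> nD; rewrite /eps_lab filter_single // ?big_cons ?big_nil ?addr0; last first.
  by rewrite down_rank_lt //=.
exact: P_last.
Qed.

Lemma eps_D1 i : is_D1 t -> i = n \/ i = n.-1 -> eps_lab L i = g (V n.-2) / g (V i).
Proof.
move=> tD iE; have n4 : (4 <= n)%N by move: ad; rewrite (isD1P tD).
rewrite /eps_lab filter_single // ?big_cons ?big_nil ?addr0; first exact: P_D1.
by rewrite /down_rank tD; lia.
Qed.

Lemma UU_neq0 i : U i != 0.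
Proof. by rewrite /UU; case: ifP => _; rewrite ?expf_neq0. Qed.

Lemma XX_neq0 i : ~~ (is_D1 t && (i == n)) -> X i != 0.
Proof.
rewrite /XX /xb; case: ifP => _; first by rewrite expf_neq0.
case: ifP => [_|_ _]; first by rewrite andbT => /negPf ->; rewrite expf_neq0.
by rewrite mulf_neq0 //; case: ifP.
Qed.

End EpsLab.

Lemma labels2E t n : t <> A2dag -> labels2 t n = labels1 t n.
Proof. by case: t. Qed.

Lemma eps_word1_lab (C : numClosedFieldType) t n i (g : label -> C) :
  eps_word t n i (@pt (labels1 t n) (word1 t n) C g) = eps_lab t n g (labels1 t n) i.
Proof. exact: (eps_wordE (uniq_labels1 t n) (word1E t n)). Qed.

Lemma eps_word2_lab (C : numClosedFieldType) t n i (g : label -> C) :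
  eps_word t n i (@pt (labels2 t n) (word2 t n) C g) = eps_lab t n g (labels2 t n) i.
Proof. exact: (eps_wordE (uniq_labels2 t n) (word2E t n)). Qed.

Lemma sigma_fork_W (C : numClosedFieldType) t n (F : label -> C) :
  classical_type t -> admissible t n -> p0 t = 0%N ->
  sigma_W (vec t n F) = vec t n (F \o sigma_label t n).
Proof.
move=> ct ad pE; have n2 := n_ge2 ad.
apply: sigma_W_vec => [l|l l' lB l'B].
  rewrite !basis_labelsE; case: t ct ad pE => //= _ ad _; case: l => [[|[|j]]|[|[|j]]|] //= jn; lia.
case: t ct ad pE {lB l'B} => //= _ ad _; case: l => [[|[|j]]|[|[|j]]|]; case: l' => [[|[|j']]|[|[|j']]|].
all: by rewrite ?eq_label.
Qed.

(** * sigma-bar for a fork at node 0 *)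

Section Fork.

Context (C : numClosedFieldType) (t : affine_type) (n : nat).
Hypothesis ad : admissible t n.
Hypothesis ct : classical_type t.
Hypothesis pE : p0 t = 0%N.
Implicit Types g : label -> C.
Local Notation L := (labels1 t n).
Local Notation X := (XX t n).
Local Notation U := (UU t).
Local Notation dr := (down_rank t n).
Local Notation B := (basis_labels t n).

Let n3 : (3 <= n)%N. Proof. by case: t ct ad pE => //=; lia. Qed.

(** sigma exchanges v_1 and v_{bar 1}, whose coordinates are X_1 and 1, so the scalar is a = 1 /
    X_1. Every X_i has to be multiplied by a^2; outside D_n^(1) X_n is the power [pn] of its
    coordinate, which therefore takes a^(3 - [pn]), as (3 - [pn]) [pn] = 2. For D_n^(1) the exponent
    is 1. *)
Definition fork_map g (l : label) : C :=
  g l / X g 1 ^+ (if l == V n then 3 - pn t else 1)%N.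

Let nA : t <> A2dag. Proof. by move=> tE; move: pE; rewrite tE. Qed.

Lemma fork_X g h (a : C) : a != 0 -> {in L, forall l, h l = g l * a ^+ (if l == V n then 3 - pn t else 1)%N} ->
  [/\ forall i, (1 <= i <= n)%N -> X h i = a ^+ 2 * X g i &
      forall i, (1 <= i < n)%N -> U h i = a * U g i].
Proof.
move=> a0 E; have dn := down_rank_lt ad ct.
have EV i : (1 <= i < n)%N -> h (V i) = a * g (V i).
  by move=> ni; rewrite E ?mem_labels1 // ?eq_label; [decide_ifs; rewrite mulrC|lia].
have EVb i : (1 <= i <= dr)%N -> h (Vb i) = a * g (Vb i).
  by move=> ni; rewrite E ?mem_labels1 // mulrC.
have En : h (V n) = g (V n) * a ^+ (3 - pn t).
  by rewrite E ?mem_labels1 ?eqxx //; lia.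
split=> i ni; last by rewrite /UU; decide_ifs; rewrite EV.
case: (leqP i dr) => idr; first by rewrite !(X_inner _ ad ct) ?EV ?EVb; try lia; ring.
rewrite /XX /xb; decide_ifs; move: idr; rewrite /down_rank.
case: (boolP (is_D1 t)) => tD idr.
  case: (eqVneq i n) => iE; first by rewrite mulr0.
  have -> : i = n.-1 by lia.
  by rewrite eqxx /= En (isD1P tD) EV; [ring|lia].
have -> : i = n by lia.
rewrite eqxx En exprMn -exprM; have -> : ((3 - pn t) * pn t = 2)%N by case: t.
by rewrite mulrC.
Qed.

(** The coordinates of v_1 and v_{bar 1} give the scalar and the value of X_1 at the image; those of
    v_{bar i} give the U_i; those of v_i then give the remaining X_i one after another. Conversely,
    [fork_map] scales X by a^2 and U by a, so all coordinates and all eps_i with i >= 2 match. *)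
Lemma sigma_bar_fork gx gy : (forall l, gx l != 0) -> (forall l, gy l != 0) ->
  sigma_bar (@pt L (word1 t n) C gx) (@pt (labels2 t n) (word2 t n) C gy) <->
  {in L, gy =1 fork_map gx}.
Proof.
move=> gx0 gy0; have dn := down_rank_lt ad ct.
have X0 : X gx 1 != 0 by rewrite XX_neq0 //; lia.
have v1E : v1_pt (@pt L (word1 t n) C gx) = vec t n (v1_coef t n gx) by rewrite /v1_pt v1_ptE.
have v2E : v2_pt (@pt (labels2 t n) (word2 t n) C gy) = vec t n (v1_coef t n gy).
  by rewrite v2_start1 // v1_ptE.
have mB i : (1 <= i <= n)%N -> V i \in B.
  by rewrite basis_labelsE; case: i => //= i; case: t ct => //=; lia.
have mBb i : (1 <= i <= n)%N -> Vb i \in B.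
  by rewrite basis_labelsE; case: i => //= i; case: t ct => //=; lia.
have sV i : (2 <= i)%N -> sigma_label t n (V i) = V i.
  by case: i => [|[|i]] //; case: t ct pE => //.
have sVb i : (2 <= i)%N -> sigma_label t n (Vb i) = Vb i.
  by case: i => [|[|i]] //; case: t ct pE => //.
have sV1 : sigma_label t n (V 1) = Vb 1 by case: t ct pE.
have sVb1 : sigma_label t n (Vb 1) = V 1 by case: t ct pE.
have U1 g : U g 0 = 1 by rewrite /UU pE.
split.
  move=> [_ _ [a]]; rewrite v1E v2E sigma_fork_W // scale_vec => /vec_eq E _.
  have aE : X gy 1 = a by have := E (V 1) (mB 1 _); rewrite /= sV1 /= pE /= U1 mulr1 => -> //; lia.
  have aX : 1 = a * X gx 1 by have := E (Vb 1) (mBb 1 _); rewrite /= sVb1 /= pE /= U1 => -> //; lia.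
  have a0 : a != 0 by rewrite -aE XX_neq0 //; lia.
  have aV : a = (X gx 1)^-1 by apply: (mulIf X0); rewrite -aX mulVf.
  have EU i : (1 <= i < n)%N -> gy (V i) = a * gx (V i).
    move=> ni; have := E (Vb i.+1) (mBb _ _); rewrite /= sVb /= ?/UU; last lia.
    by decide_ifs => -> //; lia.
  (* X_1 is known; since X_i + X_{i+1} scales by a^2, knowledge of X_i passes on to X_{i+1}. *)
  have EX i : (1 <= i <= n)%N -> X gy i = a ^+ 2 * X gx i.
    elim: i => // i IH ni; case: (posnP i) => [->|i0].
      by rewrite aE expr2 -mulrA -aX mulr1.
    have := E (V i.+1) (mB _ ni); rewrite /= sV /=; last lia.
    case: i IH ni i0 => // i IH ni _ /=.
    rewrite IH; last lia.
    rewrite /UU /= EU; last lia.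
    move=> H; have : (a ^+ 2 * X gx i.+1 + X gy i.+2) = a ^+ 2 * (X gx i.+1 + X gx i.+2).
      by move/(congr1 (fun z => z * (a * gx (V i.+1)))): H; rewrite divfK ?mulf_neq0 // => ->; field.
    by rewrite mulrDr => /addrI.
  move=> l lL; rewrite /fork_map -exprVn -aV; case: l lL => [i|i|]; rewrite mem_labels1 // ?pE //= => ni.
    rewrite eqV; case: (eqVneq i n) => [->|iE]; last by rewrite EU ?expr1 1?mulrC //; lia.
    have [tD|tD] := boolP (is_D1 t).
      have := EX n.-1 _; rewrite /XX /xb tD; decide_ifs; rewrite /= EU; last lia.
      rewrite (_ : 3 - pn t = 1)%N ?expr1; last by rewrite (isD1P tD).
      move=> H; apply: (mulfI (x := a * gx (V n.-1))); first by rewrite mulf_neq0.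
      by rewrite H; [ring|lia].
    have pnE : pn t = 1%N \/ pn t = 2%N by case: t; auto.
    case: pnE => pnE.
      have := EX n _; rewrite /XX (negPf tD); decide_ifs; rewrite pnE !expr1 => ->; last by lia.
      by rewrite mulrC.
    (* For [pn] = 2 the square X_n fixes the last coordinate only up to sign; the coordinate of v_0
       fixes the sign. *)
    have := E (V 0); rewrite basis_labelsE /= => ->.
      by rewrite pnE expr1 mulrC; case: t ct pE => //.
    by case: t ct pE pnE tD.
  have := EX i _; rewrite !(X_inner _ ad ct) ?EU //; try lia.
  move=> H; rewrite ?eqVbV ?expr1; apply: (mulfI (x := a * gx (V i))); first by rewrite mulf_neq0.
  by rewrite H; [ring|lia].
move=> E; pose a := (X gx 1)^-1; have a0 : a != 0 by rewrite invr_eq0.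
have [EX EU] : [/\ forall i, (1 <= i <= n)%N -> X gy i = a ^+ 2 * X gx i &
      forall i, (1 <= i < n)%N -> U gy i = a * U gx i].
  by apply: fork_X => // l lL; rewrite E // /fork_map /a exprVn.
split.
- by apply/(torus_pt (word1E t n)) => l _.
- by apply/(torus_pt (word2E t n)) => l _.
- exists a; rewrite v1E v2E sigma_fork_W // scale_vec; apply/vec_eq => l lB.
  have aX : a * X gx 1 = 1 by rewrite mulVf.
  move: lB (lB); rewrite {1}basis_labelsE; case: l => [[|[|i]]|[|[|i]]|] //= ni lB.
  + have [-> pnE] : sigma_label t n (V 0) = V 0 /\ pn t = 2%N by case: t ct pE ni => //.
    by rewrite /= E ?mem_labels1 ?pE /fork_map ?eqxx ?pnE ?expr1 1?mulrC //; lia.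
  + rewrite pE sV1 /= U1 EX; last by lia.
    by rewrite expr2 -mulrA aX.
  + rewrite sV //=; have ni' : (i.+2 <= n)%N by case: t ct ni => //=; lia.
    by rewrite !EX ?EU; try lia; rewrite -mulrDr; field; rewrite a0 UU_neq0.
  + by rewrite sVb1 /= pE U1 aX.
  + rewrite sVb //= EU //; by case: t ct ni => //=; lia.
  + by case: t ct pE ni.
- move=> _ i ni si; rewrite eps_word1_lab eps_word2_lab labels2E //.
  have i2 : (2 <= i)%N by move: si; case: i ni => [|[|i]] //; case: t ct pE.
  have -> : sigma t n i = i by case: i i2 {ni si} => [|[|i]] //; case: t ct pE.
  case: (leqP i dr) => idr.
    rewrite !eps_inner //; try lia.
    rewrite /vcoef !EX ?EU //=; try lia.
    rewrite -mulrDr; field; rewrite a0 !UU_neq0 // XX_neq0 //; lia.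
  have EV j : (1 <= j < n)%N -> gy (V j) = a * gx (V j).
    by move=> nj; have := EU j nj; rewrite /UU; decide_ifs.
  have En : gy (V n) = gx (V n) * a ^+ (3 - pn t).
    by rewrite E ?mem_labels1 ?pE /fork_map ?eqxx ?exprVn //; lia.
  case: (boolP (is_D1 t)) => tD; last first.
    have -> : i = n by move: idr; rewrite /down_rank (negPf tD); lia.
    rewrite !eps_last // En EV; last by lia.
    by rewrite exprMn; field; rewrite gx0 expf_neq0.
  have pnE : (3 - pn t = 1)%N by rewrite (isD1P tD).
  have n4 : (4 <= n)%N by move: ad; rewrite (isD1P tD).
  have iE : i = n \/ i = n.-1 by move: idr; rewrite /down_rank tD; lia.
  rewrite !eps_D1 // EV; last by lia.
  have -> : gy (V i) = a * gx (V i).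
    by case: iE => ->; [rewrite En pnE expr1 mulrC|rewrite EV //; lia].
  by field; rewrite gx0 a0.
Qed.

End Fork.

(** * sigma-bar for a diagram that is a line *)

Definition is_dag (t : affine_type) : bool := if t is A2dag then true else false.

(* sigma-bar exchanges the nodes i and n - i of the Dynkin diagram, except for
   A_{2n}^(2)-dagger. *)
Definition rv (t : affine_type) (n j : nat) : nat := if is_dag t then j else (n - j)%N.

Section Line.

Context (C : numClosedFieldType) (t : affine_type) (n : nat).
Hypothesis ad : admissible t n.
Hypothesis pt0 : (0 < p0 t)%N.
Implicit Types g h : label -> C.
Local Notation L := (labels1 t n).
Local Notation L2 := (labels2 t n).
Local Notation X := (XX t n).
Local Notation U := (UU t).
Local Notation VV := (vcoef t n).
Local Notation B := (basis_labels t n).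
Local Notation rv := (rv t n).

Lemma line_classical : classical_type t. Proof. by case: t pt0. Qed.
Lemma line_not_D1 : ~~ is_D1 t. Proof. by case: t pt0. Qed.
Let ct := line_classical.
Let nD := line_not_D1.
Let n2 : (2 <= n)%N. Proof. exact: n_ge2 ad. Qed.

Lemma rvK j : (j <= n)%N -> rv (rv j) = j.
Proof. by move=> jn; rewrite /rv; case: is_dag => //; rewrite subKn. Qed.

Lemma rv_inner i : (1 <= i < n)%N -> (1 <= rv i < n)%N.
Proof. by move=> ni; rewrite /rv; case: is_dag => //; lia. Qed.

Lemma rv_le j : (j <= n)%N -> (rv j <= n)%N.
Proof. by move=> jn; rewrite /rv; case: is_dag => //; lia. Qed.

Lemma mem_labels2 l : l \in L2 = match l with
  | V i => (i <= n)%N | Vb i => (1 <= i < n)%N | Phi => false end.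
Proof.
case: t pt0 => // _; rewrite /labels2 /labels1 mem_cat.
all: by case: l => [i|i|]; rewrite ?inE !mem_label ?eq_label //=; lia.
Qed.

Lemma X_line i g : (1 <= i < n)%N -> X g i = g (V i) * g (Vb i).
Proof. by move=> ni; rewrite X_inner // /down_rank (negPf nD); lia. Qed.

Lemma X_rv0 g : X g (rv 0) = g (V (rv 0)) ^+ p0 t.
Proof.
rewrite /rv /XX (negPf nD); case: t pt0 => //= _; rewrite ?subn0 ?eqxx //.
all: by decide_ifs.
Qed.

Lemma X_rvn g : X g (rv n) = g (V (rv n)) ^+ pn t.
Proof.
rewrite /rv /XX (negPf nD); case: t pt0 => //= _; rewrite ?subnn ?eqxx //.
by decide_ifs.
Qed.

Lemma v1_V g k : (1 <= k)%N -> v1_coef t n g (V k) = VV g k.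
Proof. by case: k => [|[|k]] // _; rewrite /v1_coef /=; case: eqP pt0 => // ->. Qed.

(** The scalar a of sigma-bar. One coordinate of the image equals its X at [rv n], which is a times
    the coordinate [VV] n of v_n and also a^2 X_n; hence a = [VV] n / X_n. *)
Definition line_scale g : C := VV g n / X g n.

Definition line_map g (l : label) : C :=
  match l with
  | V j => if rv j == 0%N then line_scale g ^+ (3 - p0 t) * g (V 0)
           else if rv j == n then line_scale g ^+ (3 - pn t) * g (V n)
           else line_scale g * VV g (rv j)
  | Vb j => line_scale g * X g (rv j) / VV g (rv j)
  | Phi => 1
  end.

(** sigma-bar with its scalar kept as a variable and without denominators. In this form the
    relations for two related points can be divided by each other, which is how e_0 is found
    below. *)
Definition line_rel (a : C) g h : Prop :=
  [/\ forall i, (1 <= i < n)%N -> h (V (rv i)) = a * VV g i,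
      forall j, (j <= n)%N -> X h (rv j) = a ^+ 2 * X g j,
      h (V (rv 0)) = a ^+ (3 - p0 t) * g (V 0),
      h (V (rv n)) = a ^+ (3 - pn t) * g (V n) & a * X g n = VV g n].

Lemma line_rel_map a g h : (forall l, g l != 0) -> (forall l, h l != 0) -> a != 0 ->
  line_rel a g h ->
  (forall i, (1 <= i <= n)%N -> VV g i != 0) /\ {in L2, h =1 line_map g}.
Proof.
move=> g0 h0 a0 [E1 E2 E3 E4 E5].
have Xn0 : X g n != 0 by rewrite XX_neq0 // (negPf nD).
have V0 i : (1 <= i <= n)%N -> VV g i != 0.
  move=> ni; case: (eqVneq i n) => [->|iE]; first by rewrite -E5 mulf_neq0.
  by have := h0 (V (rv i)); rewrite E1 ?mulf_eq0 ?negb_or => [/andP[]|] //; lia.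
have aE : line_scale g = a by rewrite /line_scale -E5 mulfK.
split=> // l; rewrite mem_labels2; case: l => [j|j|] // jn; rewrite /line_map aE.
  case: (eqVneq (rv j) 0%N) => [j0|j0]; first by rewrite -E3 -j0 rvK.
  case: (eqVneq (rv j) n) => [j1|j1]; first by rewrite -E4 -(congr1 rv j1) rvK.
  have := rv_le jn => jn'.
  by rewrite -E1 ?rvK //; lia.
have jn' := rv_inner jn; have := E2 (rv j); rewrite rvK; last by lia.
rewrite X_line //; have := E1 _ jn'; rewrite rvK; last by lia.
move=> -> H; have := V0 (rv j); move: H; move: (VV g (rv j)) => v H v0.
have {}v0 : v != 0 by apply: v0; lia.
apply: (mulfI (x := a * v)); first by rewrite mulf_neq0.
rewrite H; last by lia.
by field.
Qed.

Lemma line_map_rel g h : (forall l, g l != 0) ->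
  (forall i, (1 <= i <= n)%N -> VV g i != 0) -> {in L2, h =1 line_map g} ->
  line_scale g != 0 /\ line_rel (line_scale g) g h.
Proof.
move=> g0 V0 E; set a := line_scale g.
have Xn0 : X g n != 0 by rewrite XX_neq0 // (negPf nD).
have a0 : a != 0 by rewrite /a /line_scale mulf_neq0 ?invr_eq0 // V0 //; lia.
have E1 i : (1 <= i < n)%N -> h (V (rv i)) = a * VV g i.
  move=> ni; have ni' := rv_inner ni; rewrite E ?mem_labels2; last by lia.
  by rewrite /line_map rvK; [decide_ifs|lia].
have E3 : h (V (rv 0)) = a ^+ (3 - p0 t) * g (V 0).
  by rewrite E ?mem_labels2 ?rv_le // /line_map rvK.
have E4 : h (V (rv n)) = a ^+ (3 - pn t) * g (V n).
  by rewrite E ?mem_labels2 ?rv_le // /line_map rvK //; decide_ifs.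
have p3 : ((3 - p0 t) * p0 t = 2)%N by case: t pt0.
have n3 : ((3 - pn t) * pn t = 2)%N by case: t.
split=> //; split=> // [j jn|]; last by rewrite /a /line_scale divfK.
case: (posnP j) => [->|j0]; first by rewrite X_rv0 E3 exprMn -exprM p3.
case: (eqVneq j n) => [->|jn'].
  rewrite X_rvn E4 exprMn -exprM n3 /XX (negPf nD); decide_ifs => //.
have ni : (1 <= j < n)%N by lia.
have ni' := rv_inner ni.
rewrite X_line // E1 // E ?mem_labels2 // /line_map rvK // -/a.
by field; rewrite V0 //; lia.
Qed.

Lemma sigma_line_W (F : label -> C) : t <> A2dag ->
  sigma_W (vec t n F) = vec t n (F \o sigma_label t n).
Proof.
move=> nA; apply: sigma_W_vec => [l|l l' lB l'B].
  rewrite !basis_labelsE; case: t pt0 nA => //= _ _; case: l => [[|j]|[|j]|] //= jn;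
    by rewrite subSn //=; lia.
move: lB l'B; rewrite !basis_labelsE.
case: t pt0 nA => //= _ _; case: l => [[|j]|[|j]|] // jn; case: l' => [[|j']|[|j']|] // jn';
  rewrite ?eq_label //; lia.
Qed.

(** The sums X_{i-1} + X_i of the image are a^2 times those of the source, in reversed order unless
    the type is dagger. One X_j has to be known to separate them: the condition on eps_1 provides it
    for the reversed diagrams, the coordinate of v_0 for the dagger type. The nonvanishing of all
    [VV] i is what the existence of an image in the torus amounts to. *)
Lemma sigma_bar_line g h : (forall l, g l != 0) -> (forall l, h l != 0) ->
  sigma_bar (@pt L (word1 t n) C g) (@pt L2 (word2 t n) C h) <->
  (forall i, (1 <= i <= n)%N -> VV g i != 0) /\ {in L2, h =1 line_map g}.
Proof.
move=> g0 h0.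
have v1E : v1_pt (@pt L (word1 t n) C g) = vec t n (v1_coef t n g) by rewrite /v1_pt v1_ptE.
have mB i : (1 <= i <= n)%N -> V i \in B.
  by rewrite basis_labelsE; case: i => //= i; case: t pt0 => //=; lia.
have mBb i : (1 <= i <= n)%N -> Vb i \in B.
  by rewrite basis_labelsE; case: i => //= i; case: t pt0 => //=; lia.
have tx : torus (@pt L (word1 t n) C g) by apply/(torus_pt (word1E t n)) => l _.
have ty : torus (@pt L2 (word2 t n) C h) by apply/(torus_pt (word2E t n)) => l _.
have VU (f : label -> C) i : (forall l, f l != 0) -> X f i + X f i.+1 = VV f i.+1 * U f i.
  by move=> f0; rewrite /vcoef divfK // UU_neq0.
have Xn (f : label -> C) : X f n = f (V n) ^+ pn t by rewrite /XX (negPf nD); decide_ifs.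
have X0 (f : label -> C) : X f 0 = f (V 0) ^+ p0 t by [].
case: (boolP (is_dag t)) => tA.
  have tE : t = A2dag by case: t tA.
  have rvE j : rv j = j by rewrite /rv tA.
  have v2E : v2_pt (@pt L2 (word2 t n) C h) = vec t n (v2_coef n h).
    by move: ad; rewrite /v2_pt tE => adA; rewrite v2_ptE.
  have sW (F : label -> C) : sigma_W (vec t n F) = vec t n F.
    by apply: sigma_W_vec => // l l' _ _; rewrite tE.
  have p0E : p0 t = 1%N by rewrite tE.
  have pnE : pn t = 2%N by rewrite tE.
  pose D i := if i == n then X h n else h (V i).
  have DE (f : label -> C) : v2_coef n f =1 fun l => match l with
     | V 0 => f (V n) | V i => if i == n then X f n else f (V i)
     | Vb i => (X f i.-1 + X f i) / (if i == n then X f n else f (V i))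
     | Phi => 0 end by rewrite tE => -[[|i]|i|].
  split=> [[_ _ [a]]|[V0 E]].
    rewrite v1E v2E sW scale_vec => /vec_eq E _.
    have ED i : (1 <= i <= n)%N -> D i = a * VV g i.
      move=> ni; have := E (V i) (mB i ni); rewrite DE v1_V //; last by lia.
      by case: i ni.
    have D0 i : D i != 0 by rewrite /D; case: ifP; rewrite ?XX_neq0 ?(negPf nD).
    have a0 : a != 0 by have := D0 1%N; rewrite ED ?mulf_eq0 ?negb_or => [/andP[]|] //; lia.
    have EU i : (1 <= i <= n)%N -> X h i.-1 + X h i = a ^+ 2 * (X g i.-1 + X g i).
      move=> ni; have := E (Vb i) (mBb i ni); rewrite DE -/(D i) /= => H.
      have : X h i.-1 + X h i = (a * U g i.-1) * D i by rewrite -H divfK.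
      case: i ni {H} => // i ni; rewrite ED //= (VU g i g0) => ->; ring.
    (* The coordinate of v_0 is linear in that of the letter n, so it gives X_n, from which the sums
       are resolved downwards. *)
    have En : h (V n) = a * g (V n) by rewrite -[h (V n)]/(v2_coef n h (V 0)) E // basis_labelsE tE.
    have EX k : (k <= n)%N -> X h (n - k) = a ^+ 2 * X g (n - k).
      elim: k => [|k IH] kn; first by rewrite subn0 !Xn En pnE; ring.
      have := EU (n - k)%N; rewrite IH; last lia.
      rewrite (_ : (n - k).-1 = n - k.+1)%N; last lia.
      by rewrite mulrDr => H; apply: (addIr (a ^+ 2 * X g (n - k))); apply: H; lia.
    have EX' j : (j <= n)%N -> X h j = a ^+ 2 * X g j.
      by move=> jn; rewrite -(subKn jn) EX // leq_subr.
    apply: (line_rel_map g0 h0 a0); split; rewrite ?rvE.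
    - by move=> i ni; rewrite rvE -ED /D; [decide_ifs|lia].
    - by move=> j jn; rewrite rvE EX'.
    - by have := EX' 0%N isT; rewrite !X0 p0E.
    - by rewrite pnE En.
    - have := ED n; rewrite /D eqxx EX' // => H; apply: (mulfI a0).
      by rewrite -H ?mulrA //; lia.
  have [a0 [E1 E2 E3 E4 E5]] := line_map_rel g0 V0 E; set a := line_scale g in a0 E1 E2 E3 E4 E5.
  have E2' j : (j <= n)%N -> X h j = a ^+ 2 * X g j by move=> jn; have := E2 j jn; rewrite rvE.
  have E4' : h (V n) = a ^+ (3 - pn t) * g (V n) by have := E4; rewrite rvE.
  split=> //; exists a; rewrite v1E v2E sW scale_vec; apply/vec_eq => l lB; rewrite DE.
  have ED i : (1 <= i <= n)%N -> D i = a * VV g i.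
    move=> ni; rewrite /D; case: eqP => [->|iE].
      by rewrite E2' // -E5; ring.
    by rewrite -E1 ?rvE //; lia.
  have lB' := lB; rewrite basis_labelsE tE in lB'; case: l lB lB' => [[|i]|[|i]|] // lB ni.
  + by rewrite E4' pnE.
  + by rewrite v1_V // -ED //=; lia.
  rewrite -/(D i.+1) ED; last by lia.
  rewrite !E2'; try lia.
  rewrite /= -mulrDr VU //; field.
  by rewrite a0 V0 //; lia.
have nA : t <> A2dag by move=> tE; move: tA; rewrite tE.
have rvE j : rv j = (n - j)%N by rewrite /rv (negPf tA).
have pE : pn t = p0 t by case: t pt0 tA.
have v2E : v2_pt (@pt L2 (word2 t n) C h) = vec t n (v1_coef t n h).
  by rewrite v2_start1 // v1_ptE.
have sV i : (1 <= i <= n)%N -> sigma_label t n (V i) = Vb (n.+1 - i).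
  by case: i => // i _; case: t pt0 nA.
have sVb i : (1 <= i <= n)%N -> sigma_label t n (Vb i) = V (n.+1 - i).
  by case: i => // i _; case: t pt0 nA.
have sE i : sigma t n i = (n - i)%N by case: t pt0 nA.
have epsE (f : label -> C) i : (forall l, f l != 0) -> (1 <= i < n)%N ->
    eps_lab t n f L i = U f i.-1 * VV f i.+1 / X f i.
  by move=> f0 ni; rewrite eps_inner // /down_rank (negPf nD); lia.
split=> [[_ _ [a]]|[V0 E]].
  rewrite v1E v2E sigma_line_W // scale_vec => /vec_eq E Heps.
  have EU i : (i < n)%N -> U h i = a * VV g (n - i).
    move=> ni; have := E (Vb i.+1) (mBb i.+1 ni); rewrite /comp sVb // subSS v1_V //; lia.
  have EV i : (1 <= i <= n)%N -> VV h i = a * U g (n - i).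
    move=> ni; have := E (V i) (mB _ ni); rewrite /comp sV // v1_V => [->|]; last lia.
    by rewrite /= subSn //; lia.
  have a0 : a != 0 by have := UU_neq0 t h0 0; rewrite EU ?mulf_eq0 ?negb_or => [/andP[]|] //; lia.
  have V0 i : (1 <= i <= n)%N -> VV g i != 0.
    move=> ni; have := UU_neq0 t h0 (n - i); rewrite EU; last lia.
    by rewrite subKn ?mulf_eq0 ?negb_or => [/andP[]|]; last lia.
  (* The condition on eps at node 1 compares the two expressions U_{i-1} [VV] (i+1) / X_i; their
     numerators are known up to a^2, so it isolates one X. *)
  have EX1 : X h (n - 1) = a ^+ 2 * X g 1.
    have := Heps nA 1%N; rewrite eps_word1_lab eps_word2_lab labels2E // sE !epsE //; try lia.
    rewrite EU; last by lia.
    rewrite EV; last by lia.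
    rewrite (_ : n - (n - 1).-1 = 2)%N; last lia.
    rewrite (_ : n - (n - 1).+1 = 0)%N /=; last lia.
    move=> H; have {H} := H _ _; rewrite -subn_eq0 -!ltnNge => H.
    have Xh0 : X h (n - 1) != 0 by rewrite XX_neq0 // (negPf nD).
    have Xg0 : X g 1 != 0 by rewrite XX_neq0 // (negPf nD).
    have /eqP : a * VV g 2 * (a * U g 0) / X h (n - 1) = U g 0 * VV g 2 / X g 1.
      by apply: H; lia.
    rewrite eqr_div // => /eqP H'.
    apply: (mulfI (x := U g 0 * VV g 2)); first by rewrite mulf_neq0 ?UU_neq0 // V0 //; lia.
    by rewrite -H'; ring.
  have chain i : (1 <= i <= n)%N -> X h i.-1 + X h i = a ^+ 2 * (X g (n - i) + X g (n - i).+1).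
    case: i => // i ni; rewrite !VU // EU // EV // (_ : (n - i.+1).+1 = n - i)%N; last lia.
    by rewrite /=; ring.
  have EX k : (k < n)%N -> X h (n - k.+1) = a ^+ 2 * X g k.+1.
    elim: k => [|k IH] kn //.
    have := chain (n - k.+1)%N; rewrite subKn; last lia.
    rewrite IH; last lia.
    rewrite (_ : (n - k.+1).-1 = n - k.+2)%N; last lia.
    by rewrite mulrDr addrC => H; apply: (addrI (a ^+ 2 * X g k.+1)); apply: H; lia.
  have EX0 : X h n = a ^+ 2 * X g 0.
    have := chain n; rewrite subnn -subn1 EX1 mulrDr addrC => H.
    by apply: (addIr (a ^+ 2 * X g 1)); apply: H; lia.
  have EX' j : (j <= n)%N -> X h (n - j) = a ^+ 2 * X g j.
    by case: j => [|j] jn; rewrite ?subn0 ?EX0 ?EX.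
  have E5 : a * X g n = VV g n.
    apply: (mulfI a0); have := EX' n (leqnn n); rewrite subnn => H.
    by have := EU 0%N _; rewrite subn0 -[U h 0]/(X h 0) H => <-; [ring|lia].
  apply: (line_rel_map g0 h0 a0); split=> //.
  - move=> i ni; have := EU (n - i)%N; rewrite subKn /UU ?rvE; last lia.
    by decide_ifs; apply; lia.
  - by move=> j jn; rewrite rvE EX'.
  (* For end exponent 2 the X at the end is a square; the coordinate of v_0 or phi selects the right
     root. *)
  - rewrite rvE subn0; have p12 : p0 t = 1%N \/ p0 t = 2%N by case: t pt0; auto.
    case: p12 => p12; first by have := EX0; rewrite Xn X0 pE p12.
    have [sig mem] : sigma_label t n (V 0) = Phi /\ V 0 \in B.
      by rewrite basis_labelsE; case: t pt0 nA p12.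
    by rewrite -[h (V n)]/(v1_coef t n h (V 0)) (E _ mem) /comp sig p12.
  - rewrite rvE subnn; have p12 : p0 t = 1%N \/ p0 t = 2%N by case: t pt0; auto.
    case: p12 => p12; first by have := EX' n (leqnn n); rewrite subnn Xn X0 pE p12.
    have [sig mem] : sigma_label t n Phi = V 0 /\ Phi \in B.
      by rewrite basis_labelsE; case: t pt0 nA p12.
    by rewrite -[h (V 0)]/(v1_coef t n h Phi) (E _ mem) /comp sig pE p12.
have [a0 [E1 E2 E3 E4 E5]] := line_map_rel g0 V0 E; set a := line_scale g in a0 E1 E2 E3 E4 E5.
have EX j : (j <= n)%N -> X h j = a ^+ 2 * X g (n - j).
  by move=> jn; rewrite -E2 ?rvE ?subKn //; lia.
have EU i : (i < n)%N -> U h i = a * VV g (n - i).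
  move=> ni; case: (posnP i) => [->|i0].
    by rewrite -[U h 0]/(X h 0) EX // subn0 -E5; ring.
  by rewrite -E1 ?rvE ?subKn /UU; try lia; decide_ifs.
have EV i : (1 <= i <= n)%N -> VV h i = a * U g (n - i).
  case: i => // i ni; rewrite /vcoef /= EU // !EX //; last by lia.
  rewrite addrC (_ : n - i = (n - i.+1).+1)%N; last lia.
  rewrite -mulrDr VU //; field.
  by rewrite a0 V0 //; lia.
split=> //.
  exists a; rewrite v1E v2E sigma_line_W // scale_vec; apply/vec_eq => l lB; rewrite /comp.
  move: (lB); rewrite basis_labelsE; case: l lB => [[|i]|[|i]|] // lB ni.
  + have [-> p2] : sigma_label t n (V 0) = Phi /\ p0 t = 2%N by case: t pt0 nA ni.
    by have := E3; rewrite rvE subn0 p2.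
  + have ni' : (1 <= i.+1 <= n)%N by case: t pt0 ni => //=; lia.
    rewrite v1_V // sV // EV //= (_ : (_ - _).-1 = n - i.+1)%N //; lia.
  + have ni' : (1 <= i.+1 <= n)%N by case: t pt0 ni => //=; lia.
    by rewrite sVb // v1_V /= ?EU //; lia.
  + have [-> p2] : sigma_label t n Phi = V 0 /\ p0 t = 2%N by case: t pt0 nA ni.
    by have := E4; rewrite rvE subnn pE p2.
move=> _ i ni; rewrite sE eps_word1_lab eps_word2_lab labels2E // => si.
rewrite !epsE // ?EU ?EV ?EX; try lia.
rewrite (_ : n - (n - i).-1 = i.+1)%N; last lia.
rewrite (_ : n - (n - i).+1 = i.-1)%N; last lia.
rewrite subKn; last lia.
by field; rewrite a0 XX_neq0 // (negPf nD).
Qed.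

End Line.

(** * sigma-bar in type A *)

Section TypeA.

Context (C : numClosedFieldType) (n : nat).
Hypothesis ad : admissible A1 n.
Implicit Types g h : label -> C.
Local Notation L := (labels1 A1 n).
Local Notation B := (basis_labels A1 n).

Lemma mem_labels_A1 l : l \in L = if l is V i then (1 <= i <= n)%N else false.
Proof. by rewrite /labels1; case: l => [i|i|]; rewrite mem_label ?mem_rev ?mem_iota //; lia. Qed.

(** The cyclic shift of the coordinates (g_1 : ... : g_n : 1), renormalized to have last coordinate
    1. The default g (V 0) = 1 stands for the coordinate of v_{n+1}. *)
Definition A1_map g (l : label) : C :=
  if l is V j then g (V j.-1) / g (V n) else 1.

Lemma eps_A1 g i : (forall l, g l != 0) -> (forall l, l \notin L -> g l = 1) ->
  (1 <= i <= n)%N -> eps_lab A1 n g L i = g (V i.+1) / g (V i).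
Proof.
by move=> g0 g1 ni; rewrite /eps_lab filter_A1 // big_cons big_nil addr0 P_A1.
Qed.

Lemma sigma_bar_A1 g h : (forall l, g l != 0) -> (forall l, h l != 0) ->
  (forall l, l \notin L -> g l = 1) -> (forall l, l \notin L -> h l = 1) ->
  sigma_bar (@pt L (word1 A1 n) C g) (@pt (labels2 A1 n) (word2 A1 n) C h) <->
  {in L, h =1 A1_map g}.
Proof.
move=> g0 h0 g1 h1; have n2 : (2 <= n)%N by [].
have v1E (f : label -> C) : (forall l, f l != 0) -> v1_pt (@pt L (word1 A1 n) C f) =
  vec A1 n (fun l => if l is V j then if j == n.+1 then 1 else f (V j) else 0).
  by move=> f0; rewrite /v1_pt v1_pt_A1.
have v2E : v2_pt (@pt (labels2 A1 n) (word2 A1 n) C h) = v1_pt (@pt L (word1 A1 n) C h) by [].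
pose s l := if l is V j then if j == 1%N then V n.+1 else V j.-1 else l.
have sW (F : label -> C) : sigma_W (vec A1 n F) = vec A1 n (F \o s).
  apply: sigma_W_vec => [l|l l' lB l'B].
    rewrite !basis_labelsE /s; case: l => [[|[|j]]|[|j]|] //=; lia.
  move: lB l'B; rewrite !basis_labelsE /s.
  case: l => [[|[|j]]|[|j]|] // jn; case: l' => [[|j']|[|j']|] // jn' /=; case: ifP => ?;
    rewrite ?eq_label; lia.
have gn0 := g0 (V n).
split.
  move=> [_ _ [a]]; rewrite v2E !v1E // sW scale_vec => /vec_eq E _.
  have mB i : (1 <= i <= n.+1)%N -> V i \in B by rewrite basis_labelsE; case: i => //= i; lia.
  have E1 := E (V n.+1) (mB _ _); rewrite /= eqxx in E1.
  rewrite (_ : (n.+1 == 1)%N = false) in E1; last lia.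
  rewrite (_ : (n == n.+1)%N = false) in E1; last lia.
  have aE : a = (g (V n))^-1 by apply: (mulIf gn0); rewrite -E1 ?mulVf //; lia.
  move=> l; rewrite mem_labels_A1; case: l => // i ni.
  have := E (V i) (mB _ _); rewrite /= ; case: (eqVneq i 1%N) => [->|i1].
    rewrite eqxx mulr1 (_ : (1 == n.+1)%N = false) ?(@g1 (V 0)) ?mem_labels_A1 //; last lia.
    by move=> ->; [rewrite aE div1r|lia].
  rewrite (_ : (i == n.+1)%N = false) ; last lia.
  rewrite (_ : (i.-1 == n.+1)%N = false); last lia.
  by move=> ->; [rewrite aE mulrC|lia].
move=> E; pose a := (g (V n))^-1.
have EV i : (1 <= i <= n.+1)%N -> h (V i) = a * g (V i.-1).
  move=> ni; case: (eqVneq i n.+1) => [->|iE].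
    by rewrite h1 ?mem_labels_A1 ?mulVf //; lia.
  by rewrite E ?mem_labels_A1 1?mulrC //; lia.
split.
- by apply/(torus_pt (word1E A1 n)) => l _.
- by apply/(torus_pt (word2E A1 n)) => l _.
- exists a; rewrite v2E !v1E // sW scale_vec; apply/vec_eq => l.
  rewrite basis_labelsE; case: l => [[|i]|[|i]|] // ni; rewrite /comp /s /=.
  case: (eqVneq i 0%N) => [->|i0] /=.
    by rewrite eqxx mulr1 EV //= (@g1 (V 0)) ?mem_labels_A1 ?mulr1 //; case: ifP => //; lia.
  rewrite (_ : (i.+1 == 1)%N = false); last lia.
  rewrite (_ : (i == n.+1)%N = false); last lia.
  case: ifP => iE; last by rewrite EV //; lia.
  by rewrite (_ : i = n) ?mulVf //; lia.
- move=> _ i ni; rewrite /sigma eps_word1_lab eps_word2_lab => si.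
  have iln : (i < n)%N.
    by case: (ltngtP i n) => // [|ie]; [lia|move: si; rewrite ie modnn].
  rewrite modn_small // !eps_A1 ?EV //=; try lia.
  by rewrite /a; field; rewrite !g0.
Qed.

End TypeA.

(** * The maps e_i *)

Section ERat.

Context (C : numClosedFieldType) (t : affine_type) (n : nat).
Hypothesis ad : admissible t n.
Implicit Types g h : label -> C.
Local Notation L := (labels1 t n).
Local Notation L2 := (labels2 t n).
Local Notation X := (XX t n).
Local Notation U := (UU t).
Local Notation dr := (down_rank t n).
Local Notation rv := (rv t n).

Definition rho (i : nat) (c : C) g : C := (c * X g i + X g i.+1) / (X g i + X g i.+1).

Definition R_inner (i : nat) (c : C) g (l : label) : C :=
  if l == V i then rho i c g else if l == Vb i then c / rho i c g else 1.

Definition R_single (i : nat) (c : C) g (l : label) : C := if l == V i then c else 1.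

(** [labs] and [w] are independent of the first word, so that the statement also serves for the
    second one, which agrees with it only through [labels2E]. *)
Lemma e_word_inner labs w (wE : w = map lidx labs) i c g x' :
  labs = L -> classical_type t -> (forall l, g l != 0) -> c != 0 ->
  (1 <= i <= dr)%N -> X g i + X g i.+1 != 0 -> c * X g i + X g i.+1 != 0 ->
  e_word t n i (cons_pt c (@pt labs w C g)) x' <->
  x' = pt labs (fun l => g l * R_inner i c g l).
Proof.
move=> lE ct g0 c0 ni S1 S2; have dn := down_rank_lt ad ct.
have X0 : X g i != 0 by rewrite XX_neq0 //; lia.
have P1 := P_inner1 g ad ct ni; have P2 := P_inner2 ad ct g0 ni.
(* The common factor of the two terms of eps_i is pulled out; it is nonzero and cancels in both
   quotients. *)
have E b : b * P_lab L t n g i (V i) + P_lab L t n g i (Vb i) =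
    U g i.-1 / (g (V i) * X g i) * (b * X g i + X g i.+1).
  by rewrite P1 P2; field; rewrite X0 g0.
have E1 := E 1; rewrite !mul1r in E1.
have F0 : U g i.-1 / (g (V i) * X g i) != 0.
  by rewrite mulf_neq0 ?UU_neq0 // invr_eq0 mulf_neq0.
have ul : uniq labs by rewrite lE uniq_labels1.
have PE l : P_lab labs t n g i l = P_lab L t n g i l by rewrite lE.
have := @e_word_two labs w ul wE C t n g i (V i) (Vb i) c x'.
rewrite /= !PE E E1 => -> //.
- rewrite /R_inner /rho (_ : _ / (_ * (X g i + X g i.+1)) = (c * X g i + X g i.+1) / (X g i + X g i.+1)) //.
  by rewrite -mulf_div divff // mul1r.
- by rewrite lE filter_inner.
- by rewrite lE index_V_Vb.
- by rewrite mulf_neq0.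
- by rewrite mulf_neq0.
Qed.

Lemma e_word_single labs w (wE : w = map lidx labs) i c g x' :
  labs = L -> classical_type t -> (forall l, g l != 0) -> c != 0 ->
  (dr < i <= n)%N ->
  e_word t n i (cons_pt c (@pt labs w C g)) x' <->
  x' = pt labs (fun l => g l * R_single i c g l).
Proof.
move=> lE ct g0 c0 ni; have ul : uniq labs by rewrite lE uniq_labels1.
by apply: (e_word_one ul wE) => //; rewrite lE filter_single.
Qed.

(** e_1^c multiplies X_1 by rho (c / rho) = c. Conjugation by [fork_map], which divides by X_1,
    therefore divides the factors rho, c / rho and 1 of [R_inner] by c, or by c^(3 - [pn]) at the
    letter n. *)
Definition R_fork (c : C) g (l : label) : C :=
  if l == V 1 then rho 1 c g / c else if l == Vb 1 then (rho 1 c g)^-1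
  else (c ^+ (if l == V n then 3 - pn t else 1)%N)^-1.

(** X_1 is scaled by (1 / X_1)^2 and so becomes its own inverse; the second division undoes the
    first. *)
Lemma fork_mapK g h : classical_type t -> p0 t = 0%N ->
  (forall l, g l != 0) -> {in L, h =1 fork_map t n g} -> {in L, g =1 fork_map t n h}.
Proof.
move=> ct pE g0 E; have n3 : (3 <= n)%N by case: t ct ad pE => //=; lia.
have X0 : X g 1 != 0 by rewrite XX_neq0 //; lia.
have a0 : (X g 1)^-1 != 0 by rewrite invr_eq0.
have [|EX _] := @fork_X C t n ad ct pE g h (X g 1)^-1 a0 _.
  by move=> l lL; rewrite E // /fork_map exprVn.
have X1 : X h 1 = (X g 1)^-1 by rewrite EX; [field|lia].
by move=> l lL; rewrite /fork_map X1 E // /fork_map exprVn invrK divfK // expf_neq0.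
Qed.

(** [fork_map] scales X_1 and X_2 by the same factor, so rho is the same at both points; what
    remains is to divide by the new X_1, which is c / X_1. *)
Lemma fork_core c g h : classical_type t -> p0 t = 0%N ->
  (forall l, g l != 0) -> (forall l, h l != 0) -> c != 0 ->
  X g 1 + X g 2 != 0 -> c * X g 1 + X g 2 != 0 ->
  {in L, h =1 fork_map t n g} ->
  [/\ X h 1 + X h 2 != 0, c * X h 1 + X h 2 != 0, rho 1 c h = rho 1 c g &
   {in L, (fun l => g l * R_fork c g l) =1
      fork_map t n (fun l => h l * R_inner 1 c h l)}].
Proof.
move=> ct pE g0 h0 c0 S1 S2 E.
have n3 : (3 <= n)%N by case: t ct ad pE => //=; lia.
have dr1 : (1 <= 1 <= dr)%N.
  by case: t ct ad pE => //= _ ad' _; rewrite /down_rank /=; lia.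
have X0 : X g 1 != 0 by rewrite XX_neq0 //; lia.
have a0 : (X g 1)^-1 != 0 by rewrite invr_eq0.
have [|EX _] := @fork_X C t n ad ct pE g h (X g 1)^-1 a0 _.
  by move=> l lL; rewrite E // /fork_map exprVn.
have X1 : X h 1 = (X g 1)^-1 by rewrite EX; [field|lia].
have X2 : X h 2 = (X g 1)^-1 ^+ 2 * X g 2 by rewrite EX //; lia.
have T b : b * X h 1 + X h 2 = (X g 1)^-1 ^+ 2 * (b * X g 1 + X g 2).
  by rewrite X1 X2; field.
have T1 := T 1; rewrite !mul1r in T1.
have rE : rho 1 c h = rho 1 c g by rewrite /rho T T1; field; rewrite S1 X0.
split; rewrite ?T ?T1 ?mulf_neq0 ?expf_neq0 // => l lL.
have r0 : rho 1 c g != 0 by rewrite mulf_neq0 ?invr_eq0.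
rewrite /fork_map; set h' := fun l => h l * _.
have -> : X h' 1 = c * (X g 1)^-1.
  by rewrite (X_inner h' ad ct dr1) /h' /R_inner eqxx /= -X1 (X_inner h ad ct dr1) rE; field.
rewrite /h' E // /fork_map /R_fork /R_inner rE.
case: (eqVneq l (V 1)) => [->|l1].
  by rewrite eqV ifF ?expr1; [field; rewrite X0 c0|lia].
case: (eqVneq l (Vb 1)) => [->|l2].
  by rewrite eqVbV !expr1; field; rewrite X0 c0.
rewrite mulr1 exprMn exprVn; move: (if _ then _ else _)%N => k.
have ck : c ^+ k != 0 by rewrite expf_neq0.
have Xk : X g 1 ^+ k != 0 by rewrite expf_neq0.
by move: (c ^+ k) (X g 1 ^+ k) ck Xk => u v u0 v0; field; rewrite u0 v0.
Qed.

(** The graph of e_0 constrains [x'] only through its image under sigma-bar; the involution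
    [fork_mapK] solves this for [x'], and conversely provides the two intermediate points. *)
Lemma e_rat_fork c g x' : classical_type t -> p0 t = 0%N ->
  (forall l, g l != 0) -> c != 0 ->
  X g 1 + X g 2 != 0 -> c * X g 1 + X g 2 != 0 ->
  e_rat 0 (cons_pt c (@pt L (word1 t n) C g)) x' <->
  x' = pt L (fun l => g l * R_fork c g l).
Proof.
move=> ct pE g0 c0 S1 S2; have n3 : (3 <= n)%N by case: t ct ad pE => //=; lia.
have nA : t <> A2dag by move=> tE; move: pE; rewrite tE.
have l2E := labels2E n nA.
have sE : sigma t n 0 = 1%N by case: t ct pE.
have dr1 : (1 <= 1 <= dr)%N.
  by case: t ct ad pE => //= _ ad' _; rewrite /down_rank /=; lia.
have r0 : rho 1 c g != 0 by rewrite mulf_neq0 ?invr_eq0.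
have Ri0 h l : rho 1 c h != 0 -> R_inner 1 c h l != 0.
  move=> rh; rewrite /R_inner; case: ifP => // _; case: ifP => _; last exact: oner_neq0.
  by rewrite mulf_neq0 ?invr_eq0.
rewrite /e_rat eqxx tail_cons_pt head_cons_pt sE; split=> [[y [y' [s1 e s2]]]|->].
  have [_ ty _ _] := s1; have [tx' _ _ _] := s2.
  pose h := coord L2 1 y; have h0 : forall l, h l != 0 := torus_coord (uniq_labels2 t n) (word2E t n) ty.
  have yE : y = pt L2 h by rewrite coordK //; [exact: uniq_labels2|exact: word2E].
  pose g' := coord L 1 x'; have g'0 : forall l, g' l != 0 := torus_coord (uniq_labels1 t n) (word1E t n) tx'.
  have xE : x' = pt L g' by rewrite coordK //; [exact: uniq_labels1|exact: word1E].
  move: s1 e s2; rewrite yE xE => /(sigma_bar_fork ad ct pE g0 h0) hE.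
  have [T1 T2 rE core] := fork_core ct pE g0 h0 c0 S1 S2 hE.
  move/(e_word_inner (word2E t n) _ l2E ct h0 c0 dr1 T1 T2) => ->.
  move/(sigma_bar_fork ad ct pE g'0) => H.
  have {}H := fork_mapK ct pE g'0 (H _).
  apply/(pt_eq (word1E t n)) => l lL; rewrite core //; apply: H => // l'.
  by rewrite mulf_neq0 // Ri0 // rE.
pose h := fork_map t n g.
have X0 : X g 1 != 0 by rewrite XX_neq0 //; lia.
have h0 l : h l != 0 by rewrite mulf_neq0 // invr_eq0 expf_neq0.
have [T1 T2 rE core] := fork_core ct pE g0 h0 c0 S1 S2 (fun l _ => erefl).
exists (pt L2 h), (pt L2 (fun l => h l * R_inner 1 c h l)); split.
- by apply/(sigma_bar_fork ad ct pE g0 h0).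
- by apply/(e_word_inner (word2E t n) _ l2E ct h0 c0 dr1 T1 T2).
have h'0 l : h l * R_inner 1 c h l != 0 by rewrite mulf_neq0 // Ri0 // rE.
have g'0 l : g l * R_fork c g l != 0.
  rewrite mulf_neq0 // /R_fork; do 2?case: ifP => _; rewrite ?invr_eq0 ?expf_neq0 //.
  by rewrite mulf_neq0 ?invr_eq0.
by apply/(sigma_bar_fork ad ct pE g'0 h'0); apply: (fork_mapK ct pE h'0).
Qed.

End ERat.

(** * The map e_0 for a line *)

Section LineERat.

Context (C : numClosedFieldType) (t : affine_type) (n : nat).
Hypothesis ad : admissible t n.
Implicit Types g h : label -> C.
Local Notation L := (labels1 t n).
Local Notation L2 := (labels2 t n).
Local Notation X := (XX t n).
Local Notation U := (UU t).
Local Notation VV := (vcoef t n).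
Local Notation rv := (rv t n).

(** The ratio of the scalars of sigma-bar before and after e_0^c, obtained by solving c^[p0] X_0 +
    X_1 = r c^[p0] (X_0 + X_1). *)
Definition r_line (c : C) g : C :=
  (c ^+ p0 t * X g 0 + X g 1) / (c ^+ p0 t * (X g 0 + X g 1)).

(** As (3 - [p0]) [p0] = (3 - [pn]) [pn] = 2, these factors multiply X_0 by c^[p0] r^2 and every
    other X_i by r^2. *)
Definition R_line (c : C) g (l : label) : C :=
  if l == V 0 then c * r_line c g ^+ (3 - p0 t)
  else if l == V n then r_line c g ^+ (3 - pn t) else r_line c g.

Section LineCore.

Hypothesis pt0 : (0 < p0 t)%N.
Let ct := line_classical pt0.
Let nD := line_not_D1 pt0.
Let n2 : (2 <= n)%N. Proof. exact: n_ge2 ad. Qed.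

Lemma VV_mul g i : (forall l, g l != 0) -> X g i + X g i.+1 = VV g i.+1 * U g i.
Proof. by move=> g0; rewrite /vcoef divfK // UU_neq0. Qed.

Lemma XX_line_neq0 g i : (forall l, g l != 0) -> X g i != 0.
Proof. by move=> g0; rewrite XX_neq0 // (negPf nD). Qed.

Lemma UU_gt0 g i : (0 < i)%N -> U g i = g (V i).
Proof. by move=> i0; rewrite /UU; decide_ifs. Qed.

Lemma memL l : l \in L = match l with
  | V i => (i <= n)%N | Vb i => (1 <= i < n)%N | Phi => false end.
Proof.
rewrite mem_labels1 //; case: l => [i|i|] //; rewrite ?/down_rank ?(negPf nD); last by nat_lia.
by case: (p0 t) pt0.
Qed.

(** On the image side only the coordinate at [rv 0] changes. Dividing the relations [line_rel] of
    the two points shows that [VV] i is multiplied by r and X_i by r^2 for i >= 1, where r is the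
    quotient of the two scalars, whereas X_0 picks up an additional c^[p0]. *)
Lemma line_core c g g' h h' : (forall l, g l != 0) -> (forall l, g' l != 0) ->
  (forall i, (1 <= i <= n)%N -> VV g i != 0) ->
  (forall i, (1 <= i <= n)%N -> VV g' i != 0) -> c != 0 ->
  {in L2, h =1 line_map t n g} -> {in L2, h' =1 line_map t n g'} ->
  {in L2, forall l, h' l = h l * (if l == V (rv 0) then c else 1)} ->
  {in L, forall l, g' l = g l * R_line c g l}.
Proof.
move=> g0 g'0 V0 V'0 c0 hE h'E H.
have [a0 [E1 E2 E3 E4 E5]] := line_map_rel ad pt0 g0 V0 hE.
have [a'0 [F1 F2 F3 F4 F5]] := line_map_rel ad pt0 g'0 V'0 h'E.
set a := line_scale t n g in a0 E1 E2 E3 E4 E5.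
set a' := line_scale t n g' in a'0 F1 F2 F3 F4 F5; clearbody a a'.
pose r := a / a'; have r0 : r != 0 by rewrite mulf_neq0 ?invr_eq0.
have aE : a = r * a' by rewrite /r divfK.
clearbody r.
have mV i : (i <= n)%N -> V (rv i) \in L2 by move=> ni; rewrite mem_labels2 // rv_le.
have mVb i : (1 <= i < n)%N -> Vb (rv i) \in L2.
  by move=> ni; rewrite mem_labels2 //; apply: rv_inner.
have rv_inj i : (i <= n)%N -> rv i = rv 0 -> i = 0%N.
  by move=> ni /(congr1 rv); rewrite !rvK.
have HV i : (1 <= i <= n)%N -> h' (V (rv i)) = h (V (rv i)).
  move=> ni; rewrite H; last by apply: mV; nat_lia.
  by rewrite eqV (_ : (rv i == rv 0) = false) ?mulr1 //; apply/eqP => /rv_inj; nat_lia.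
have HX i : (1 <= i <= n)%N -> X h' (rv i) = X h (rv i).
  move=> ni; case: (eqVneq i n) => [->|iE]; first by rewrite !X_rvn ?HV //; nat_lia.
  have ni' : (1 <= i < n)%N by nat_lia.
  by rewrite !X_line ?HV ?rv_inner ?H ?mVb ?eqVbV ?mulr1.
have EV i : (1 <= i < n)%N -> VV g' i = r * VV g i.
  move=> ni; apply: (mulfI a'0); rewrite -F1 // HV ?E1 //; last by nat_lia.
  by rewrite aE; ring.
have EX i : (1 <= i <= n)%N -> X g' i = r ^+ 2 * X g i.
  move=> ni; apply: (mulfI (x := a' ^+ 2)); first by rewrite expf_neq0.
  rewrite -F2 ?HX ?E2 //; try nat_lia.
  by rewrite aE; ring.
have EVn : VV g' n = r * VV g n.
  by rewrite -F5 EX ?[in RHS]aE -?E5 ?aE; [field|nat_lia].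
have EV' i : (1 <= i <= n)%N -> VV g' i = r * VV g i.
  by move=> ni; case: (eqVneq i n) => [->|iE] //; apply: EV; nat_lia.
have Gn : g' (V n) = r ^+ (3 - pn t) * g (V n).
  have := HV n; rewrite F4 E4 aE exprMn => H'; apply: (mulfI (x := a' ^+ (3 - pn t))).
    by rewrite expf_neq0.
  by rewrite H'; [ring|nat_lia].
have G0 : g' (V 0) = c * r ^+ (3 - p0 t) * g (V 0).
  have := H _ (mV 0%N isT); rewrite eqxx F3 E3 aE exprMn => H'.
  apply: (mulfI (x := a' ^+ (3 - p0 t))); first by rewrite expf_neq0.
  by rewrite H'; ring.
have p3 : ((3 - p0 t) * p0 t = 2)%N by case: t pt0.
have X0 : X g' 0 = c ^+ p0 t * r ^+ 2 * X g 0.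
  by rewrite /XX /= G0 !exprMn -exprM p3.
(* The coordinate of v_1 is (X_0 + X_1) / X_0 and scales by r as well, although X_0 carries the
   extra factor; this determines r. *)
have rE : r = r_line c g.
  have S1 : X g 0 + X g 1 != 0 by rewrite VV_mul // mulf_neq0 ?UU_neq0 // V0 //; nat_lia.
  have cp : c ^+ p0 t != 0 by rewrite expf_neq0.
  have X00 := XX_line_neq0 0 g0.
  have := EV' 1%N; rewrite /vcoef /UU /= -![g _ ^+ p0 t]/(X g 0) -![g' _ ^+ p0 t]/(X g' 0).
  rewrite X0 EX; last by nat_lia.
  move=> H'; have {}H' := H' (ltnW n2).
  have : r * (c ^+ p0 t * X g 0 + X g 1) = r * (r * (c ^+ p0 t * (X g 0 + X g 1))).
    move/(congr1 (fun z => z * (c ^+ p0 t * r * X g 0))): H'.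
    move: (c ^+ p0 t) cp => cc cp; move: (X g 0) (X g 1) X00 => x0 x1 x00 H'.
    have -> : r * (cc * x0 + x1) = (cc * r ^+ 2 * x0 + r ^+ 2 * x1) / (cc * r ^+ 2 * x0) * (cc * r * x0).
      by field; rewrite x00 r0 cp.
    by rewrite H'; field.
  by move/(mulfI r0) => H''; rewrite /r_line H'' mulfK // mulf_neq0.
(* The coordinate U_i is recovered from X_i + X_{i+1} = [VV] (i+1) U_i, whose left side scales by
   r^2. *)
have GV i : (1 <= i < n)%N -> g' (V i) = r * g (V i).
  move=> ni; rewrite -!UU_gt0; try nat_lia.
  apply: (mulfI (x := VV g' i.+1)); first by rewrite V'0 //; nat_lia.
  rewrite -VV_mul // !EX ?EV'; try nat_lia.
  by rewrite -mulrDr VV_mul //; ring.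
move=> l; rewrite memL /R_line -rE; case: l => [i|i|] // ni; rewrite ?eq_label.
  case: (eqVneq i 0%N) => [->|i0]; first by rewrite G0; ring.
  case: (eqVneq i n) => [->|iE]; first by rewrite Gn mulrC.
  by rewrite GV ?(mulrC r) //; nat_lia.
apply: (mulfI (x := g' (V i))); first exact: g'0.
rewrite -(X_line ad pt0) // EX ?GV ?(X_line ad pt0) //; try nat_lia.
by ring.
Qed.

End LineCore.

End LineERat.

Section LineERatRev.

Context (C : numClosedFieldType) (t : affine_type) (n : nat).
Hypothesis ad : admissible t n.
Hypothesis pt0 : (0 < p0 t)%N.
Implicit Type g : label -> C.
Local Notation L2 := (labels2 t n).
Local Notation X := (XX t n).
Local Notation U := (UU t).
Local Notation VV := (vcoef t n).
Local Notation rv := (rv t n).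
Let nD := line_not_D1 pt0.
Let n2 : (2 <= n)%N. Proof. exact: n_ge2 ad. Qed.

(** The candidate has [VV], X and the scalar multiplied by r, r^2 and 1 / r, apart from X_0. In
    [line_map] these factors cancel at every label, and only the c at the image of node 0
    survives. *)
Lemma line_core_rev c g : (forall l, g l != 0) ->
  (forall i, (1 <= i <= n)%N -> VV g i != 0) -> c != 0 ->
  c ^+ p0 t * X g 0 + X g 1 != 0 ->
  let g' l := g l * R_line t n c g l in
  [/\ forall l, g' l != 0, forall i, (1 <= i <= n)%N -> VV g' i != 0 &
   {in L2, (fun l => line_map t n g l * (if l == V (rv 0) then c else 1)) =1
      line_map t n g'}].
Proof.
move=> g0 V0 c0 S2 g'.
have S1 : X g 0 + X g 1 != 0 by rewrite VV_mul // mulf_neq0 ?UU_neq0 // V0 //; nat_lia.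
have cp : c ^+ p0 t != 0 by rewrite expf_neq0.
have [r rE] : exists r, r = r_line t n c g by exists (r_line t n c g).
have r0 : r != 0 by rewrite rE mulf_neq0 ?invr_eq0 ?mulf_neq0.
have g'0 l : g' l != 0.
  rewrite mulf_neq0 // /R_line -rE; do 2?case: ifP => _; rewrite ?expf_neq0 //.
  by rewrite mulf_neq0 ?expf_neq0.
have G0 : g' (V 0) = c * r ^+ (3 - p0 t) * g (V 0) by rewrite /g' /R_line -rE eqxx mulrC.
have Gn : g' (V n) = r ^+ (3 - pn t) * g (V n).
  by rewrite /g' /R_line -rE !eq_label; decide_ifs; rewrite mulrC.
have GV i : (1 <= i < n)%N -> g' (V i) = r * g (V i).
  by move=> ni; rewrite /g' /R_line -rE !eq_label; decide_ifs; rewrite mulrC.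
have GVb i : g' (Vb i) = r * g (Vb i) by rewrite /g' /R_line -rE /= mulrC.
have p3 : ((3 - p0 t) * p0 t = 2)%N by case: t pt0.
have n3 : ((3 - pn t) * pn t = 2)%N by case: t.
have X0 : X g' 0 = c ^+ p0 t * r ^+ 2 * X g 0.
  by rewrite /XX /= G0 !exprMn -exprM p3.
have EX i : (1 <= i <= n)%N -> X g' i = r ^+ 2 * X g i.
  move=> ni; case: (eqVneq i n) => [->|iE].
    by rewrite /XX (negPf nD); decide_ifs; rewrite Gn exprMn -exprM n3.
  by rewrite !X_line ?GV ?GVb; [ring|nat_lia..].
have EV i : (1 <= i <= n)%N -> VV g' i = r * VV g i.
  case: i => // -[|i] ni; rewrite /vcoef /=.
    rewrite -[U g' 0]/(X g' 0) -[U g 0]/(X g 0) X0 EX //.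
    have X00 := XX_line_neq0 n pt0 0 g0; rewrite rE /r_line; move: (c ^+ p0 t) cp S2 => cc cp S2.
    move: (X g 0) (X g 1) X00 S1 S2 => x0 x1 x00 S1 S2.
    by field; rewrite x00 S1 S2 cp.
  rewrite !EX /UU /= ?GV; try nat_lia.
  by field; rewrite r0 g0.
have aE : line_scale t n g' = line_scale t n g / r.
  rewrite /line_scale EV ?EX; try nat_lia.
  by field; rewrite r0 XX_line_neq0.
split=> // [i ni|l]; first by rewrite EV // mulf_neq0 // V0.
rewrite mem_labels2 // /line_map aE; move: (line_scale t n g) => a; case: l => [i|i|] // ni; last first.
  rewrite mulr1; have ni' : (1 <= rv i < n)%N by apply: rv_inner.
  rewrite EX ?EV; try nat_lia.
  by field; rewrite r0 V0 //; nat_lia.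
rewrite eqV; case: (eqVneq (rv i) 0%N) => [i0|i0].
  have iE : i == rv 0 by rewrite -(congr1 rv i0) rvK.
  rewrite iE G0 exprMn exprVn; have : r ^+ (3 - p0 t) != 0 by rewrite expf_neq0.
  by move: (r ^+ (3 - p0 t)) => rr rr0; field.
have -> : (i == rv 0) = false by apply: contraNF i0 => /eqP ->; rewrite rvK.
case: (eqVneq (rv i) n) => [iE|iE].
  rewrite Gn exprMn exprVn; have : r ^+ (3 - pn t) != 0 by rewrite expf_neq0.
  by move: (r ^+ (3 - pn t)) => rr rr0; field.
have ni' : (rv i <= n)%N by apply: rv_le.
rewrite EV; last by nat_lia.
by field.
Qed.

End LineERatRev.

Section LineE0.

Context (C : numClosedFieldType) (t : affine_type) (n : nat).
Hypothesis ad : admissible t n.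
Hypothesis pt0 : (0 < p0 t)%N.
Local Notation L := (labels1 t n).
Local Notation L2 := (labels2 t n).

Lemma filter_sigma0 : [seq l <- L2 | lidx l == sigma t n 0] = [:: V (rv t n 0)].
Proof.
have n2 := n_ge2 ad; case: (boolP (is_dag t)) => tA.
  have tE : t = A2dag by case: t tA.
  by move: ad; rewrite tE; exact: filter_zero.
have nA : t <> A2dag by move=> tE; move: tA; rewrite tE.
rewrite labels2E // /rv (negPf tA) subn0.
have -> : sigma t n 0 = n by case: t pt0 nA => //= _ _; rewrite subn0.
by apply: filter_single; rewrite ?line_classical // /down_rank; case: ifP; lia.
Qed.

Lemma e_rat_line c (g : label -> C) x' : (forall l, g l != 0) -> c != 0 ->
  (forall i, (1 <= i <= n)%N -> vcoef t n g i != 0) ->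
  c ^+ p0 t * XX t n g 0 + XX t n g 1 != 0 ->
  e_rat 0 (cons_pt c (@pt L (word1 t n) C g)) x' <->
  x' = pt L (fun l => g l * R_line t n c g l).
Proof.
move=> g0 c0 V0 S2.
have [g'0 V'0 core] := line_core_rev ad pt0 g0 V0 c0 S2.
have E1 h y (h0 : forall l, h l != 0) := @e_word_one _ _ (uniq_labels2 t n) (word2E t n) C t n h _ _ c y (fun l _ => h0 l) c0 filter_sigma0.
rewrite /e_rat eqxx tail_cons_pt head_cons_pt; split=> [[y [y' [s1 e s2]]]|->].
  have [_ ty _ _] := s1; have [tx' _ _ _] := s2.
  pose h := coord L2 1 y; have h0 : forall l, h l != 0 := torus_coord (uniq_labels2 t n) (word2E t n) ty.
  have yE : y = pt L2 h by rewrite coordK //; [exact: uniq_labels2|exact: word2E].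
  pose g' := coord L 1 x'; have g''0 : forall l, g' l != 0 := torus_coord (uniq_labels1 t n) (word1E t n) tx'.
  have xE : x' = pt L g' by rewrite coordK //; [exact: uniq_labels1|exact: word1E].
  move: s1 e s2; rewrite yE xE => /(sigma_bar_line ad pt0 g0 h0) [_ hE].
  move/(E1 h _ h0) => ->.
  move/(sigma_bar_line ad pt0 g''0) => H.
  have h'0 l : h l * (if l == V (rv t n 0) then c else 1) != 0.
    by rewrite mulf_neq0 //; case: ifP => _; rewrite ?oner_neq0.
  have [V''0 h'E] := H h'0.
  apply/(pt_eq (word1E t n)) => l lL.
  exact: (line_core ad pt0 g0 g''0 V0 V''0 c0 hE h'E (fun _ _ => erefl)).
(* [line_map] is known to be nonzero only at labels of the second word, hence the default 1. *)
pose h l := if l \in L2 then line_map t n g l else 1.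
have h0 l : h l != 0.
  rewrite /h; case: ifP => // lL2; last exact: oner_neq0.
  have n2 := n_ge2 ad.
  have X0 i : XX t n g i != 0 by rewrite XX_neq0 // (negPf (line_not_D1 pt0)).
  have a0 : line_scale t n g != 0 by rewrite mulf_neq0 ?invr_eq0 // V0 //; lia.
  move: lL2; rewrite mem_labels2 // /line_map; case: l => [i|i|] // ni.
    case: (eqVneq (rv t n i) 0%N) => [_|i0]; first by rewrite mulf_neq0 // expf_neq0.
    case: (eqVneq (rv t n i) n) => [_|i1]; first by rewrite mulf_neq0 // expf_neq0.
    have ni' : (rv t n i <= n)%N by apply: rv_le.
    rewrite mulf_neq0 // V0 //; lia.
  have ni' : (1 <= rv t n i < n)%N by apply: rv_inner.
  by apply: mulf_neq0; [exact: mulf_neq0|rewrite invr_eq0 V0 //; lia].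
have hE : {in L2, h =1 line_map t n g} by move=> l lL2; rewrite /h lL2.
have h'0 l : h l * (if l == V (rv t n 0) then c else 1) != 0.
  by rewrite mulf_neq0 //; case: ifP => _; rewrite ?oner_neq0.
exists (pt L2 h), (pt L2 (fun l => h l * (if l == V (rv t n 0) then c else 1))); split.
- by apply/(sigma_bar_line ad pt0 g0 h0).
- by apply/(E1 h _ h0).
apply/(sigma_bar_line ad pt0 g'0 h'0); split=> // l lL2.
by rewrite -core // hE.
Qed.

End LineE0.

(** After the shift the coordinates are 1 / g (V n) and g (V i) / g (V n). Multiplying the first one
    by c and keeping the others divides g (V n), and with it every g (V i), by c. *)
Lemma e_rat_A1 (C : numClosedFieldType) n c (g : label -> C) x' : admissible A1 n ->
  (forall l, g l != 0) -> (forall l, l \notin labels1 A1 n -> g l = 1) -> c != 0 ->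
  e_rat 0 (cons_pt c (@pt (labels1 A1 n) (word1 A1 n) C g)) x' <->
  x' = pt (labels1 A1 n) (fun l => g l * c^-1).
Proof.
move=> ad g0 g1 c0; have n2 : (2 <= n)%N by [].
set L := labels1 A1 n.
have F : [seq l <- labels2 A1 n | lidx l == sigma A1 n 0] = [:: V 1].
  by rewrite /sigma modn_small ?ltnS ?(ltnW n2) // (@filter_A1 n 1) // (ltnW n2).
have E1 h y (h0 : forall l, h l != 0) := @e_word_one _ _ (uniq_labels2 A1 n) (word2E A1 n) C A1 n h _ _ c y (fun l _ => h0 l) c0 F.
have V1L : V 1 \in L by rewrite mem_labels_A1; lia.
rewrite /e_rat eqxx tail_cons_pt head_cons_pt; split=> [[y [y' [s1 e s2]]]|->].
  have [_ ty _ _] := s1; have [tx' _ _ _] := s2.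
  pose h := coord (labels2 A1 n) 1 y; have h0 : forall l, h l != 0 := torus_coord (uniq_labels2 A1 n) (word2E A1 n) ty.
  have yE : y = pt (labels2 A1 n) h by rewrite coordK //; [exact: uniq_labels2|exact: word2E].
  pose g' := coord L 1 x'; have g'0 : forall l, g' l != 0 := torus_coord (uniq_labels1 A1 n) (word1E A1 n) tx'.
  have xE : x' = pt L g' by rewrite coordK //; [exact: uniq_labels1|exact: word1E].
  have h1 l : l \notin L -> h l = 1 by apply: coord_out; exact: word2E.
  have g'1 l : l \notin L -> g' l = 1 by apply: coord_out; exact: word1E.
  move: s1 e s2; rewrite yE xE => /(sigma_bar_A1 ad g0 h0 g1 h1) hE.
  move/(E1 h _ h0) => ->.
  set h' := fun l => _ * _.
  have h'0 l : h' l != 0 by rewrite mulf_neq0 //; case: ifP => _; rewrite ?oner_neq0.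
  have h'1 l : l \notin L -> h' l = 1.
    by move=> lL; rewrite /h' h1 // mul1r ifF //; apply: contraNF lL => /eqP ->.
  move/(sigma_bar_A1 ad g'0 h'0 g'1 h'1) => h'E.
  have z0 : V 0 \notin L by rewrite mem_labels_A1.
  have H1 := h'E _ V1L; rewrite /h' eqxx hE // /A1_map /= (g1 _ z0) (g'1 _ z0) in H1.
  have gn : g' (V n) = g (V n) * c^-1.
    by apply: invr_inj; rewrite -[LHS]div1r -H1; field; rewrite c0 g0.
  apply/(pt_eq (word1E A1 n)) => l; rewrite mem_labels_A1; case: l => // i ni.
  case: (eqVneq i n) => [-> //|iE].
  have iL : V i.+1 \in L by rewrite mem_labels_A1; lia.
  have := h'E _ iL; rewrite /h' hE // /A1_map /= eqV gn ifF; last by lia.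
  move=> H; apply: (mulIf (x := (g (V n) * c^-1)^-1)); first by rewrite invr_eq0 mulf_neq0 ?invr_eq0.
  by rewrite -H; field; rewrite c0 g0.
pose h l := if l \in L then A1_map n g l else 1.
have h0 l : h l != 0.
  rewrite /h /A1_map; case: ifP => _; last exact: oner_neq0.
  by case: l => *; rewrite ?mulf_neq0 ?invr_eq0 ?oner_neq0.
have h1 l : l \notin L -> h l = 1 by rewrite /h => /negPf ->.
have hE : {in L, h =1 A1_map n g} by move=> l lL; rewrite /h lL.
pose h' l := h l * (if l == V 1 then c else 1).
have h'0 l : h' l != 0 by rewrite mulf_neq0 //; case: ifP => _; rewrite ?oner_neq0.
have h'1 l : l \notin L -> h' l = 1.
  by move=> lL; rewrite /h' h1 // mul1r ifF //; apply: contraNF lL => /eqP ->.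
pose g' l := if l \in L then g l * c^-1 else 1.
have g'0 l : g' l != 0.
  by rewrite /g'; case: ifP => _; rewrite ?oner_neq0 // mulf_neq0 ?invr_eq0.
have g'1 l : l \notin L -> g' l = 1 by rewrite /g' => /negPf ->.
exists (pt (labels2 A1 n) h), (pt (labels2 A1 n) h'); split.
- by apply/(sigma_bar_A1 ad g0 h0 g1 h1).
- by apply/(E1 h _ h0).
have -> : @pt L (word1 A1 n) C (fun l => g l * c^-1) = pt L g'.
  by apply/(pt_eq (word1E A1 n)) => l lL; rewrite /g' lL.
apply/(sigma_bar_A1 ad g'0 h'0 g'1 h'1) => l lL; rewrite /h' hE //.
move: (lL); rewrite mem_labels_A1; case: l lL => // i lL ni; rewrite /A1_map eqV.
have -> : g' (V n) = g (V n) * c^-1 by rewrite /g' mem_labels_A1 ifT //; lia.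
case: (eqVneq i 1%N) => [->|i1] /=.
  by rewrite g1 ?g'1 ?mem_labels_A1 //; field; rewrite c0 g0.
have -> : g' (V i.-1) = g (V i.-1) * c^-1 by rewrite /g' mem_labels_A1 ifT //; lia.
by field; rewrite c0 g0.
Qed.

(** * The functions eps_0 and gamma_0 *)

Section NodeZero.

Context (C : numClosedFieldType) (t : affine_type) (n : nat).
Hypothesis ad : admissible t n.
Implicit Types g h : label -> C.
Local Notation L := (labels1 t n).
Local Notation L2 := (labels2 t n).
Local Notation X := (XX t n).

Lemma gamma_word1_lab i g :
  gamma_word t n i (@pt L (word1 t n) C g) = \prod_(l <- L) g l ^ cartan t n (lidx l) i.
Proof. exact: (gamma_wordE (word1E t n)). Qed.

Lemma gamma_word2_lab i g :
  gamma_word t n i (@pt L2 (word2 t n) C g) = \prod_(l <- L2) g l ^ cartan t n (lidx l) i.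
Proof. exact: (gamma_wordE (word2E t n)). Qed.

(** eps_0 and gamma_0 are graphs that pass through an image under sigma-bar. To evaluate them it
    suffices that an image exists and that [f] is constant on the set [S] of images. *)
Lemma sigma_bar_section g (S : (label -> C) -> Prop) (f : ('I_(size (word2 t n)) -> C) -> C) z0 :
  (forall h, (forall l, h l != 0) -> (forall l, l \notin L2 -> h l = 1) ->
    (sigma_bar (@pt L (word1 t n) C g) (@pt L2 (word2 t n) C h) <-> S h)) ->
  (forall h, (forall l, h l != 0) -> (forall l, l \notin L2 -> h l = 1) -> S h ->
     f (pt L2 h) = z0) ->
  (exists h, [/\ forall l, h l != 0, forall l, l \notin L2 -> h l = 1 & S h]) ->
  forall z, (exists2 y, sigma_bar (@pt L (word1 t n) C g) y & z = f y) <-> z = z0.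
Proof.
move=> H1 H2 [h [h0 h1 hS]] z; split=> [[y s ->]|->]; last first.
  by exists (pt L2 h); [apply/H1|rewrite H2].
have [_ ty _ _] := s.
have yE : pt L2 (coord L2 1 y) = y by rewrite coordK //; [exact: uniq_labels2|exact: word2E].
have c0 := torus_coord (uniq_labels2 t n) (word2E t n) ty.
have c1 l : l \notin L2 -> coord L2 1 y l = 1 by apply: coord_out; exact: word2E.
by rewrite -yE H2 //; apply/H1 => //; rewrite yE.
Qed.

Lemma fork_zero g : classical_type t -> p0 t = 0%N -> (forall l, g l != 0) ->
  (forall z, eps_rat (n := n) 0 (@pt L (word1 t n) C g) z <-> z = (X g 1 + X g 2) / g (V 1)) /\
  (forall z, gamma_rat (n := n) 0 (@pt L (word1 t n) C g) z <-> z = (X g 2)^-1).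
Proof.
move=> ct pE g0; have n3 : (3 <= n)%N by case: t ct ad pE => //=; lia.
have nA : t <> A2dag by move=> tE; move: pE; rewrite tE.
have sE : sigma t n 0 = 1%N by case: t ct pE.
have dr1 : (1 <= 1 <= down_rank t n)%N.
  by case: t ct ad pE => //= _ ad' _; rewrite /down_rank /=; lia.
have X0 : X g 1 != 0 by rewrite XX_neq0 //; lia.
have X2 : X g 2 != 0 by rewrite XX_neq0 //; case: t ct ad pE => //=; lia.
have a0 : (X g 1)^-1 != 0 by rewrite invr_eq0.
have ex : exists h, [/\ forall l, h l != 0, forall l, l \notin L2 -> h l = 1 &
    {in L, h =1 fork_map t n g}].
  exists (fun l => if l \in L then fork_map t n g l else 1); split=> [l|l|l lL].
  - case: ifP => _; last exact: oner_neq0.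
    by rewrite mulf_neq0 // invr_eq0 expf_neq0.
  - by rewrite labels2E // => /negPf ->.
  - by rewrite lL.
have facts h : {in L, h =1 fork_map t n g} ->
    [/\ X h 1 = (X g 1)^-1, X h 2 = (X g 1)^-1 ^+ 2 * X g 2 & h (V 1) = (X g 1)^-1 * g (V 1)].
  move=> E; have [|EX EU] := @fork_X C t n ad ct pE g h (X g 1)^-1 a0 _.
    by move=> l lL; rewrite E // /fork_map exprVn.
  split; [by rewrite EX; [field|lia]|by rewrite EX //; lia|].
  by have := EU 1%N; rewrite /UU /= => -> //; lia.
rewrite /eps_rat /gamma_rat eqxx sE; split; apply: (sigma_bar_section (S := fun h => {in L, h =1 fork_map t n g})) => //.
- by move=> h h0 _; apply: sigma_bar_fork.
- move=> h h0 _ /facts [E1 E2 E3].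
  rewrite eps_word2_lab labels2E // eps_inner // /vcoef /UU /= pE expr0 E1 E2 E3.
  by field; rewrite X0 g0.
- by move=> h h0 _; apply: sigma_bar_fork.
move=> h h0 _ /facts [E1 E2 E3].
rewrite gamma_word2_lab labels2E // gamma_inner // /= E1 E2.
rewrite (_ : X h 0 = 1); last by rewrite /XX /= pE.
by field; rewrite X0 X2.
Qed.

Lemma line_zero g : (0 < p0 t)%N -> (forall l, g l != 0) ->
  (forall i, (1 <= i <= n)%N -> vcoef t n g i != 0) ->
  (forall z, eps_rat (n := n) 0 (@pt L (word1 t n) C g) z <->
     z = vcoef t n g 1 ^+ (3 - p0 t) / g (V 0)) /\
  (forall z, gamma_rat (n := n) 0 (@pt L (word1 t n) C g) z <->
     z = g (V 0) ^+ 2 / X g 1 ^+ (3 - p0 t)).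
Proof.
move=> pt0 g0 V0; have n2 := n_ge2 ad; have nD := line_not_D1 pt0; have ct := line_classical pt0.
have X0 i : X g i != 0 by rewrite XX_neq0 // (negPf nD).
have a0 : line_scale t n g != 0 by rewrite mulf_neq0 ?invr_eq0 // V0 //; lia.
pose S h := {in L2, h =1 line_map t n g}.
have ex : exists h, [/\ forall l, h l != 0, forall l, l \notin L2 -> h l = 1 & S h].
  exists (fun l => if l \in L2 then line_map t n g l else 1); split=> [l|l|l lL].
  - case: ifP => [lL2|_]; last exact: oner_neq0.
    move: lL2; rewrite mem_labels2 // /line_map; case: l => [i|i|] // ni.
      case: (eqVneq (rv t n i) 0%N) => [_|i0]; first by rewrite mulf_neq0 // expf_neq0.
      case: (eqVneq (rv t n i) n) => [_|i1]; first by rewrite mulf_neq0 // expf_neq0.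
      have ni' : (rv t n i <= n)%N by apply: rv_le.
      by rewrite mulf_neq0 // V0 //; lia.
    have ni' : (1 <= rv t n i < n)%N by apply: rv_inner.
    by apply: mulf_neq0; [exact: mulf_neq0|rewrite invr_eq0 V0 //; lia].
  - by move=> /negPf ->.
  - by rewrite lL.
have sS h : (forall l, h l != 0) -> sigma_bar (@pt L (word1 t n) C g) (pt L2 h) <-> S h.
  by move=> h0; rewrite (sigma_bar_line ad pt0 g0 h0); split=> [[]|].
have F h : S h -> let a := line_scale t n g in
  [/\ h (V (rv t n 1)) = a * vcoef t n g 1, X h (rv t n 1) = a ^+ 2 * X g 1 &
     h (V (rv t n 0)) = a ^+ (3 - p0 t) * g (V 0)].
  by move=> hE; have [_ [E1 E2 E3 _ _]] := line_map_rel ad pt0 g0 V0 hE; split; auto; apply: E2; lia.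
have ee h : (forall l, h l != 0) ->
    eps_word t n (sigma t n 0) (@pt L2 (word2 t n) C h) = h (V (rv t n 1)) ^+ (3 - p0 t) / h (V (rv t n 0)) /\
    gamma_word t n (sigma t n 0) (@pt L2 (word2 t n) C h) = h (V (rv t n 0)) ^+ 2 / X h (rv t n 1) ^+ (3 - p0 t).
  move=> h0; rewrite eps_word2_lab gamma_word2_lab; case: (boolP (is_dag t)) => tA.
    have tE : t = A2dag by case: t tA.
    rewrite /eps_lab (filter_sigma0 ad pt0) big_cons big_nil addr0 /rv tA.
    by move: ad; rewrite tE => adA; rewrite P_zero // gamma_zero.
  have nA : t <> A2dag by move=> tE; move: tA; rewrite tE.
  have -> : sigma t n 0 = n by case: t pt0 nA => //= _ _; rewrite subn0.
  have pE : pn t = p0 t by case: t pt0 tA.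
  by rewrite labels2E // eps_last // gamma_last // /rv (negPf tA) subn0 subn1 pE.
move: (line_scale t n g) a0 F => a a0 F.
have ak : a ^+ (3 - p0 t) != 0 by rewrite expf_neq0.
rewrite /eps_rat /gamma_rat eqxx; split; apply: (sigma_bar_section (S := S)) => //.
- by move=> h h0 _; apply: sS.
- move=> h h0 _ /F [E1 E2 E3]; have [-> _] := ee h h0.
  rewrite E1 E3; move: (vcoef t n g 1) => v; rewrite exprMn.
  by move: (a ^+ _) (v ^+ _) ak => b w b0; field; rewrite b0 g0.
- by move=> h h0 _; apply: sS.
move=> h h0 _ /F [E1 E2 E3]; have [_ ->] := ee h h0.
rewrite E2 E3; move: (X g 1) (X0 1%N) => x x0; rewrite !exprMn.
have xk : x ^+ (3 - p0 t) != 0 by rewrite expf_neq0.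
by move: (a ^+ _) (x ^+ _) ak xk => b w b0 w0; field; rewrite b0 w0.
Qed.

End NodeZero.

Lemma A1_zero (C : numClosedFieldType) n (g : label -> C) : admissible A1 n ->
  (forall l, g l != 0) -> (forall l, l \notin labels1 A1 n -> g l = 1) ->
  (forall z, eps_rat (n := n) 0 (@pt (labels1 A1 n) (word1 A1 n) C g) z <-> z = g (V 1)) /\
  (forall z, gamma_rat (n := n) 0 (@pt (labels1 A1 n) (word1 A1 n) C g) z <->
     z = (g (V 1) * g (V n))^-1).
Proof.
move=> ad g0 g1; have n2 : (2 <= n)%N by [].
have sE : sigma A1 n 0 = 1%N by rewrite /sigma modn_small // ltnS ltnW.
pose S h := {in labels1 A1 n, h =1 A1_map n g}.
have ex : exists h, [/\ forall l, h l != 0, forall l, l \notin labels2 A1 n -> h l = 1 & S h].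
  exists (fun l => if l \in labels1 A1 n then A1_map n g l else 1); split=> [l|l|l lL].
  - rewrite /A1_map; case: ifP => _; last exact: oner_neq0.
    by case: l => *; rewrite ?mulf_neq0 ?invr_eq0 ?oner_neq0.
  - by move=> /negPf; rewrite /labels2 => ->.
  - by rewrite lL.
have F h : (forall l, l \notin labels2 A1 n -> h l = 1) -> S h ->
  [/\ h (V 0) = 1, h (V 1) = (g (V n))^-1 & h (V 2) = g (V 1) / g (V n)].
  move=> h1 hS; split; first by rewrite h1 // mem_labels_A1.
    rewrite hS; last by rewrite mem_labels_A1; lia.
    by rewrite /A1_map /= (g1 (V 0)) ?mem_labels_A1 // mul1r.
  by rewrite hS ?mem_labels_A1.
rewrite /eps_rat /gamma_rat eqxx sE; split; apply: (sigma_bar_section (S := S)) => //.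
- by move=> h h0 h1; apply: sigma_bar_A1.
- move=> h h0 h1 /(F _ h1) [E0 E1 E2]; rewrite eps_word2_lab eps_A1 //; last by lia.
  by rewrite E1 E2; field; rewrite g0.
- by move=> h h0 h1; apply: sigma_bar_A1.
move=> h h0 h1 /(F _ h1) [E0 E1 E2]; rewrite gamma_word2_lab [labels2 A1 n]/(labels1 A1 n) gamma_A1 //; last by lia.
by rewrite /= E0 E1 E2; field; rewrite !g0.
Qed.

(** * Ultra-discretization *)

Lemma posrat_expn (C : numClosedFieldType) k g tau (m : nat) : @posrat C k g tau ->
  posrat (fun x => g x ^+ m) (fun xi => m%:Z * tau xi).
Proof. by move=> H; apply: (posrat_expz m%:Z H). Qed.

Lemma generically_bounded (C : numClosedFieldType) k (P : nat -> ('I_k -> C) -> Prop) m :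
  (forall i, (i < m)%N -> generically (P i)) ->
  generically (fun x => forall i, (i < m)%N -> P i x).
Proof.
elim: m => [|m IH] H; first exact: generically_all.
have := generically_and (IH (fun i im => H i (ltnW im))) (H m (ltnSn m)).
apply: generically_impl => x _ [H1 H2] i; rewrite ltnS leq_eqVlt => /orP[/eqP -> //|].
exact: H1.
Qed.

(** For D_n^(1) the value at n is a placeholder, since X_n = 0 has no tropicalization; [posrat_X]
    excludes this case. *)
Definition tX (t : affine_type) (n : nat) (u : label -> int) (i : nat) : int :=
  if i == 0%N then (p0 t)%:Z * u (V 0)
  else if i == n then (pn t)%:Z * u (V n)
  else u (V i) + (if is_D1 t && (i == n.-1) then u (V n) else u (Vb i)).

Definition tU (t : affine_type) (u : label -> int) (i : nat) : int :=
  if i == 0%N then (p0 t)%:Z * u (V 0) else u (V i).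

Definition tV (t : affine_type) (n : nat) (u : label -> int) (i : nat) : int :=
  Num.max (tX t n u i.-1) (tX t n u i) - tU t u i.-1.

Section Family.

Context (C : numClosedFieldType) (t : affine_type) (n k : nat).
Variables (G : ('I_k -> C) -> label -> C) (T : ('I_k -> int) -> label -> int).
Hypothesis GT : forall l, posrat (fun z => G z l) (fun z => T z l).

Lemma posrat_X i : ~~ (is_D1 t && (i == n)) ->
  posrat (fun z => XX t n (G z) i) (fun z => tX t n (T z) i).
Proof.
rewrite /XX /tX /xb => H; case: (i == 0%N); first exact: (posrat_expn _ (GT _)).
case: (i == n) H => [|_].
  by rewrite andbT => /negPf ->; exact: (posrat_expn _ (GT _)).
by apply: posratM => //; case: (_ && _).
Qed.

Lemma posrat_U i : posrat (fun z => UU t (G z) i) (fun z => tU t (T z) i).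
Proof. by rewrite /UU /tU; case: (i == 0%N) => //; exact: (posrat_expn _ (GT _)). Qed.

Lemma posrat_V i : ~~ (is_D1 t && (i.-1 == n)) -> ~~ (is_D1 t && (i == n)) ->
  posrat (fun z => vcoef t n (G z) i) (fun z => tV t n (T z) i).
Proof.
move=> H1 H2; apply: posratM; first by apply: posratD; apply: posrat_X.
by apply: posratV; apply: posrat_U.
Qed.

End Family.

Section UD.

Context (C : numClosedFieldType) (t : affine_type) (n : nat).
Hypothesis ad : admissible t n.
Local Notation L := (labels1 t n).
Local Notation k := (size (word1 t n)).
Local Notation gx := (coord L 1).
Local Notation ux := (coord L 0).

Let uL := uniq_labels1 t n.
Let wL := word1E t n.

(** For e_i^c given generically by multiplication with factors [R], the crystal operator adds their
    tropicalization [D] with the parameter c in degree 1. The predicate [P] collects the genericity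
    conditions under which the graph of e_i has been computed. *)
Lemma ud_mapP i (R : C -> (label -> C) -> label -> C)
    (D : int -> (label -> int) -> label -> int)
    (P : C -> (label -> C) -> Prop) (xi : 'I_k -> int) :
  (forall l, posrat (fun z : 'I_k.+1 -> C => R (head_pt z) (gx (tail_pt z)) l)
                    (fun zeta => D (head_pt zeta) (ux (tail_pt zeta)) l)) ->
  generically (fun z : 'I_k.+1 -> C => P (head_pt z) (gx (tail_pt z))) ->
  (forall c g x', c != 0 -> (forall l, g l != 0) -> (forall l, l \notin L -> g l = 1) ->
     P c g -> e_rat i (cons_pt c (@pt L (word1 t n) C g)) x' <->
     x' = pt L (fun l => g l * R c g l)) ->
  ud_map (@e_rat C t n i) (cons_pt 1 xi) = pt L (fun l => ux xi l + D 1 (ux xi) l).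
Proof.
move=> HR HP H.
pose F (z : 'I_k.+1 -> C) := pt L (fun l => gx (tail_pt z) l * R (head_pt z) (gx (tail_pt z)) l) : 'I_k -> C.
pose Tr (z : 'I_k.+1 -> int) := pt L (fun l => ux (tail_pt z) l + D (head_pt z) (ux (tail_pt z)) l) : 'I_k -> int.
rewrite (@ud_mapE C k.+1 k (e_rat i) F Tr).
- by rewrite /Tr tail_cons_pt head_cons_pt.
- by move=> j; apply: posratM => //; exact: posrat_coord_tail.
apply: generically_impl HP => z tz Pz x'.
have tt : torus (tail_pt z) by move=> j; exact: tz.
rewrite -(H (head_pt z) _ x' (tz ord0) (torus_coord uL wL tt)) // ?coordK ?cons_head_tail //.
by move=> l lL; apply: coord_out.
Qed.

Lemma ud_funP (f : ratfun C k) (E : (label -> C) -> C) (tau : (label -> int) -> int)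
    (P : (label -> C) -> Prop) (xi : 'I_k -> int) :
  posrat (fun x : 'I_k -> C => E (gx x)) (fun xi => tau (ux xi)) ->
  generically (fun x : 'I_k -> C => P (gx x)) ->
  (forall g z, (forall l, g l != 0) -> (forall l, l \notin L -> g l = 1) -> P g ->
     f (@pt L (word1 t n) C g) z <-> z = E g) ->
  ud_fun f xi = tau (ux xi).
Proof.
move=> HE HP H; apply: (@ud_funE C k f (fun x => E (gx x)) (fun xi => tau (ux xi))) => //.
apply: generically_impl HP => x tx Px z.
rewrite -(H (gx x) z (torus_coord uL wL tx)) ?coordK //.
by move=> l lL; apply: coord_out.
Qed.

Lemma posrat_gx l : posrat (fun x : 'I_k -> C => gx x l) (fun xi => ux xi l).
Proof. exact: posrat_coord. Qed.

Lemma posrat_gtail l :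
  posrat (fun z : 'I_k.+1 -> C => gx (tail_pt z) l) (fun zeta => ux (tail_pt zeta) l).
Proof. exact: posrat_coord_tail. Qed.

Let gtrue m : generically (fun _ : 'I_m -> C => True).
Proof. exact: generically_all. Qed.

Section Classical.

Hypothesis ct : classical_type t.
Local Notation dr := (down_rank t n).

Definition D_inner (i : nat) (u : label -> int) (l : label) : int :=
  let r := Num.max (1 + tX t n u i) (tX t n u i.+1) - Num.max (tX t n u i) (tX t n u i.+1) in
  if l == V i then r else if l == Vb i then 1 - r else 0.

Lemma ud_inner i xi : (1 <= i <= dr)%N ->
  [/\ ud_map (@e_rat C t n i) (cons_pt 1 xi) = pt L (fun l => ux xi l + D_inner i (ux xi) l),
      ud_fun (@eps_rat C t n i) xi =
        tU t (ux xi) i.-1 + tV t n (ux xi) i.+1 - tX t n (ux xi) i &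
      ud_fun (@gamma_rat C t n i) xi =
        2 * tX t n (ux xi) i - (tX t n (ux xi) i.-1 + tX t n (ux xi) i.+1)].
Proof.
move=> ni; have dn := down_rank_lt ad ct.
have i0 : (i == 0%N) = false by lia.
have b1 : ~~ (is_D1 t && (i == n)) by lia.
have b2 : ~~ (is_D1 t && (i.+1 == n)).
  by move: ni; rewrite /down_rank; case: is_D1; lia.
have b0 : ~~ (is_D1 t && (i.-1 == n)) by lia.
split.
- pose D c u l := let r := Num.max (c + tX t n u i) (tX t n u i.+1) - Num.max (tX t n u i) (tX t n u i.+1) in
    if l == V i then r else if l == Vb i then c - r else 0.
  have prho : posrat (fun z : 'I_k.+1 -> C => rho t n i (head_pt z) (gx (tail_pt z)))
    (fun z => Num.max (head_pt z + tX t n (ux (tail_pt z)) i) (tX t n (ux (tail_pt z)) i.+1)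
      - Num.max (tX t n (ux (tail_pt z)) i) (tX t n (ux (tail_pt z)) i.+1)).
    apply: posratM; last apply: posratV; apply: posratD; try apply: posratM;
      try exact: posrat_head; by apply: posrat_X => //; exact: posrat_gtail.
  apply: (@ud_mapP i (fun c g => R_inner t n i c g) D
    (fun c g => XX t n g i + XX t n g i.+1 != 0 /\ c * XX t n g i + XX t n g i.+1 != 0)).
  + move=> l; rewrite /R_inner /D; case: (l == V i) => //; case: (l == Vb i); last exact: posrat1.
    by apply: posratM; [exact: posrat_head|exact: posratV].
  + apply: generically_and.
      apply: posrat_neq0 (fun z => Num.max (tX t n (ux (tail_pt z)) i) (tX t n (ux (tail_pt z)) i.+1)) _.
      by apply: posratD; apply: posrat_X => //; exact: posrat_gtail.
    apply: posrat_neq0 (fun z => Num.max (head_pt z + tX t n (ux (tail_pt z)) i) (tX t n (ux (tail_pt z)) i.+1)) _.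
    by apply: posratD; [apply: posratM; first exact: posrat_head|]; apply: posrat_X => //; exact: posrat_gtail.
  + move=> c g x' c0 g0 _ [S1 S2]; rewrite /e_rat i0.
    exact: e_word_inner.
- apply: (@ud_funP _ (fun g => UU t g i.-1 * vcoef t n g i.+1 / XX t n g i)
    (fun u => tU t u i.-1 + tV t n u i.+1 - tX t n u i) (fun=> True)) => //.
    apply: posratM; last by apply: posratV; apply: posrat_X => //; exact: posrat_gx.
    apply: posratM; first by apply: posrat_U; exact: posrat_gx.
    by apply: posrat_V => //; exact: posrat_gx.
  by move=> g z g0 _ _; rewrite /eps_rat i0 eps_word1_lab eps_inner.
apply: (@ud_funP _ (fun g => XX t n g i ^+ 2 / (XX t n g i.-1 * XX t n g i.+1))
    (fun u => 2 * tX t n u i - (tX t n u i.-1 + tX t n u i.+1)) (fun=> True)) => //.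
  apply: posratM; first by apply: posrat_expn; apply: posrat_X => //; exact: posrat_gx.
  by apply: posratV; apply: posratM; apply: posrat_X => //; exact: posrat_gx.
by move=> g z g0 _ _; rewrite /gamma_rat i0 gamma_word1_lab gamma_inner.
Qed.

Definition D_single (i : nat) (l : label) : int := if l == V i then 1 else 0.

Lemma ud_single i xi : (dr < i <= n)%N ->
  ud_map (@e_rat C t n i) (cons_pt 1 xi) = pt L (fun l => ux xi l + D_single i l).
Proof.
move=> ni; have i0 : (i == 0%N) = false by lia.
apply: (@ud_mapP i (fun c g => R_single i c g)
  (fun c _ l => if l == V i then c else 0) (fun _ _ => True)) => //.
- by move=> l; rewrite /R_single; case: (l == V i); [exact: posrat_head|exact: posrat1].
- by move=> c g x' c0 g0 _ _; rewrite /e_rat i0; exact: e_word_single.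
Qed.

Lemma ud_last xi : ~~ is_D1 t ->
  ud_fun (@eps_rat C t n n) xi = (3 - pn t)%N%:Z * ux xi (V n.-1) - ux xi (V n) /\
  ud_fun (@gamma_rat C t n n) xi = 2 * ux xi (V n) - (3 - pn t)%N%:Z * tX t n (ux xi) n.-1.
Proof.
move=> nD; have n2 := n_ge2 ad; have n0 : (n == 0%N) = false by lia.
split.
- apply: (@ud_funP _ (fun g => g (V n.-1) ^+ (3 - pn t) / g (V n))
    (fun u => (3 - pn t)%N%:Z * u (V n.-1) - u (V n)) (fun=> True)) => //.
    by apply: posratM; [apply: posrat_expn|apply: posratV]; exact: posrat_gx.
  by move=> g z g0 _ _; rewrite /eps_rat n0 eps_word1_lab eps_last.
apply: (@ud_funP _ (fun g => g (V n) ^+ 2 / XX t n g n.-1 ^+ (3 - pn t))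
    (fun u => 2 * u (V n) - (3 - pn t)%N%:Z * tX t n u n.-1) (fun=> True)) => //.
  apply: posratM; first by apply: posrat_expn; exact: posrat_gx.
  by apply: posratV; apply: posrat_expn; apply: posrat_X; rewrite ?(negPf nD) //; exact: posrat_gx.
by move=> g z g0 _ _; rewrite /gamma_rat n0 gamma_word1_lab gamma_last.
Qed.

Lemma ud_D1 i xi : is_D1 t -> i = n \/ i = n.-1 ->
  ud_fun (@eps_rat C t n i) xi = ux xi (V n.-2) - ux xi (V i) /\
  ud_fun (@gamma_rat C t n i) xi = 2 * ux xi (V i) - tX t n (ux xi) n.-2.
Proof.
move=> tD iE; have n4 : (4 <= n)%N by move: ad; rewrite (isD1P tD).
have i0 : (i == 0%N) = false by lia.
split.
- apply: (@ud_funP _ (fun g => g (V n.-2) / g (V i))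
    (fun u => u (V n.-2) - u (V i)) (fun=> True)) => //.
    by apply: posratM; [|apply: posratV]; exact: posrat_gx.
  by move=> g z g0 _ _; rewrite /eps_rat i0 eps_word1_lab eps_D1.
apply: (@ud_funP _ (fun g => g (V i) ^+ 2 / XX t n g n.-2)
    (fun u => 2 * u (V i) - tX t n u n.-2) (fun=> True)) => //.
  apply: posratM; first by apply: posrat_expn; exact: posrat_gx.
  by apply: posratV; apply: posrat_X; [exact: posrat_gx|lia].
by move=> g z g0 _ _; rewrite /gamma_rat i0 gamma_word1_lab gamma_D1.
Qed.

Definition D_fork (u : label -> int) (l : label) : int :=
  let r := Num.max (1 + tX t n u 1) (tX t n u 2) - Num.max (tX t n u 1) (tX t n u 2) in
  if l == V 1 then r - 1 else if l == Vb 1 then - r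
  else - ((if l == V n then 3 - pn t else 1)%N%:Z).

Lemma ud_fork xi : p0 t = 0%N ->
  [/\ ud_map (@e_rat C t n 0) (cons_pt 1 xi) = pt L (fun l => ux xi l + D_fork (ux xi) l),
      ud_fun (@eps_rat C t n 0) xi =
        Num.max (tX t n (ux xi) 1) (tX t n (ux xi) 2) - ux xi (V 1) &
      ud_fun (@gamma_rat C t n 0) xi = - tX t n (ux xi) 2].
Proof.
move=> pE; have n3 : (3 <= n)%N by case: t ct ad pE => //=; lia.
have b1 : ~~ (is_D1 t && (1 == n)%N) by lia.
have b2 : ~~ (is_D1 t && (2 == n)%N) by lia.
split.
- pose D c u l := let r := Num.max (c + tX t n u 1) (tX t n u 2) - Num.max (tX t n u 1) (tX t n u 2) in
    if l == V 1 then r - c else if l == Vb 1 then - r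
    else - ((if l == V n then 3 - pn t else 1)%N%:Z * c).
  have prho : posrat (fun z : 'I_k.+1 -> C => rho t n 1 (head_pt z) (gx (tail_pt z)))
    (fun z => Num.max (head_pt z + tX t n (ux (tail_pt z)) 1) (tX t n (ux (tail_pt z)) 2)
      - Num.max (tX t n (ux (tail_pt z)) 1) (tX t n (ux (tail_pt z)) 2)).
    apply: posratM; last apply: posratV; apply: posratD; try apply: posratM;
      try exact: posrat_head; by apply: posrat_X => //; exact: posrat_gtail.
  have -> : (fun l => ux xi l + D_fork (ux xi) l) = (fun l => ux xi l + D 1 (ux xi) l).
    by apply: funext => l; rewrite /D /D_fork mulr1.
  apply: (@ud_mapP 0 (fun c g => R_fork t n c g) D
    (fun c g => XX t n g 1 + XX t n g 2 != 0 /\ c * XX t n g 1 + XX t n g 2 != 0)).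
  + move=> l; rewrite /R_fork /D; case: (l == V 1).
      by apply: posratM => //; apply: posratV; exact: posrat_head.
    by case: (l == Vb 1); apply: posratV => //; apply: posrat_expn; exact: posrat_head.
  + apply: generically_and.
      apply: posrat_neq0 (fun z => Num.max (tX t n (ux (tail_pt z)) 1) (tX t n (ux (tail_pt z)) 2)) _.
      by apply: posratD; apply: posrat_X => //; exact: posrat_gtail.
    apply: posrat_neq0 (fun z => Num.max (head_pt z + tX t n (ux (tail_pt z)) 1) (tX t n (ux (tail_pt z)) 2)) _.
    by apply: posratD; [apply: posratM; first exact: posrat_head|]; apply: posrat_X => //; exact: posrat_gtail.
  + move=> c g x' c0 g0 _ [S1 S2].
    exact: e_rat_fork.
- apply: (@ud_funP _ (fun g => (XX t n g 1 + XX t n g 2) / g (V 1))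
    (fun u => Num.max (tX t n u 1) (tX t n u 2) - u (V 1)) (fun=> True)) => //.
    apply: posratM; last by apply: posratV; exact: posrat_gx.
    by apply: posratD; apply: posrat_X => //; exact: posrat_gx.
  by move=> g z g0 _ _; case: (fork_zero ad ct pE g0).
apply: (@ud_funP _ (fun g => (XX t n g 2)^-1) (fun u => - tX t n u 2) (fun=> True)) => //.
  by apply: posratV; apply: posrat_X => //; exact: posrat_gx.
by move=> g z g0 _ _; case: (fork_zero ad ct pE g0).
Qed.

End Classical.

Definition D_line (u : label -> int) (l : label) : int :=
  let r := Num.max ((p0 t)%:Z + tX t n u 0) (tX t n u 1)
           - ((p0 t)%:Z + Num.max (tX t n u 0) (tX t n u 1)) in
  if l == V 0 then 1 + (3 - p0 t)%N%:Z * r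
  else if l == V n then (3 - pn t)%N%:Z * r else r.

Lemma ud_line xi : (0 < p0 t)%N ->
  [/\ ud_map (@e_rat C t n 0) (cons_pt 1 xi) = pt L (fun l => ux xi l + D_line (ux xi) l),
      ud_fun (@eps_rat C t n 0) xi =
        (3 - p0 t)%N%:Z * tV t n (ux xi) 1 - ux xi (V 0) &
      ud_fun (@gamma_rat C t n 0) xi =
        2 * ux xi (V 0) - (3 - p0 t)%N%:Z * tX t n (ux xi) 1].
Proof.
move=> pt0; have nD := line_not_D1 pt0; have n2 := n_ge2 ad.
have b i : ~~ (is_D1 t && (i == n)) by rewrite (negPf nD).
have genV m (G : ('I_m -> C) -> label -> C) T :
    (forall l, posrat (fun z => G z l) (fun z => T z l)) ->
    generically (fun z => forall i, (1 <= i <= n)%N -> vcoef t n (G z) i != 0).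
  move=> GT.
  apply: generically_impl (@generically_bounded C m (fun i z => vcoef t n (G z) i != 0) n.+1 _).
    by move=> z _ H i ni; apply: H; lia.
  by move=> i _; apply: posrat_neq0 (fun z => tV t n (T z) i) _; apply: posrat_V.
split.
- pose D c u l := let r := Num.max ((p0 t)%:Z * c + tX t n u 0) (tX t n u 1)
           - ((p0 t)%:Z * c + Num.max (tX t n u 0) (tX t n u 1)) in
    if l == V 0 then c + (3 - p0 t)%N%:Z * r
    else if l == V n then (3 - pn t)%N%:Z * r else r.
  have pr : posrat (fun z : 'I_k.+1 -> C => r_line t n (head_pt z) (gx (tail_pt z)))
    (fun z => Num.max ((p0 t)%:Z * head_pt z + tX t n (ux (tail_pt z)) 0) (tX t n (ux (tail_pt z)) 1)
      - ((p0 t)%:Z * head_pt z + Num.max (tX t n (ux (tail_pt z)) 0) (tX t n (ux (tail_pt z)) 1))).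
    have ph : posrat (fun z : 'I_k.+1 -> C => head_pt z ^+ p0 t) (fun z => (p0 t)%:Z * head_pt z).
      by apply: posrat_expn; exact: posrat_head.
    apply: posratM; last apply: posratV; [apply: posratD; first apply: posratM|apply: posratM; last apply: posratD];
      try exact: ph; by apply: posrat_X => //; exact: posrat_gtail.
  have -> : (fun l => ux xi l + D_line (ux xi) l) = (fun l => ux xi l + D 1 (ux xi) l).
    by apply: funext => l; rewrite /D /D_line mulr1.
  apply: (@ud_mapP 0 (fun c g => R_line t n c g) D
    (fun c g => (forall i, (1 <= i <= n)%N -> vcoef t n g i != 0) /\
       c ^+ p0 t * XX t n g 0 + XX t n g 1 != 0)).
  + move=> l; rewrite /R_line /D; case: (l == V 0).
      by apply: posratM; [exact: posrat_head|apply: posrat_expn].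
    by case: (l == V n) => //; apply: posrat_expn.
  + apply: generically_and; first exact: genV posrat_gtail.
    apply: posrat_neq0 (fun z => Num.max ((p0 t)%:Z * head_pt z + tX t n (ux (tail_pt z)) 0) (tX t n (ux (tail_pt z)) 1)) _.
    apply: posratD; [apply: posratM; first by apply: posrat_expn; exact: posrat_head|];
      by apply: posrat_X => //; exact: posrat_gtail.
  + by move=> c g x' c0 g0 _ [S1 S2]; apply: e_rat_line.
- apply: (@ud_funP _ (fun g => vcoef t n g 1 ^+ (3 - p0 t) / g (V 0))
    (fun u => (3 - p0 t)%N%:Z * tV t n u 1 - u (V 0))
    (fun g => forall i, (1 <= i <= n)%N -> vcoef t n g i != 0)).
  + apply: posratM; last by apply: posratV; exact: posrat_gx.
    by apply: posrat_expn; apply: posrat_V => //; exact: posrat_gx.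
  + exact: genV posrat_gx.
  + by move=> g z g0 _ V0; case: (line_zero ad pt0 g0 V0).
apply: (@ud_funP _ (fun g => g (V 0) ^+ 2 / XX t n g 1 ^+ (3 - p0 t))
    (fun u => 2 * u (V 0) - (3 - p0 t)%N%:Z * tX t n u 1)
    (fun g => forall i, (1 <= i <= n)%N -> vcoef t n g i != 0)).
+ apply: posratM; first by apply: posrat_expn; exact: posrat_gx.
  by apply: posratV; apply: posrat_expn; apply: posrat_X => //; exact: posrat_gx.
+ exact: genV posrat_gx.
+ by move=> g z g0 _ V0; case: (line_zero ad pt0 g0 V0).
Qed.

End UD.

(** * Ultra-discretization in type A *)

Section UDA1.

Context (C : numClosedFieldType) (n : nat).
Hypothesis ad : admissible A1 n.
Local Notation L := (labels1 A1 n).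
Local Notation k := (size (word1 A1 n)).
Local Notation ux := (coord L 0).

Lemma ud_A1 i (xi : 'I_k -> int) : (1 <= i <= n)%N ->
  [/\ ud_map (@e_rat C A1 n i) (cons_pt 1 xi) = pt L (fun l => ux xi l + D_single i l),
      ud_fun (@eps_rat C A1 n i) xi = ux xi (V i.+1) - ux xi (V i) &
      ud_fun (@gamma_rat C A1 n i) xi =
        2 * ux xi (V i) - (ux xi (V i.-1) + ux xi (V i.+1))].
Proof.
move=> ni; have i0 : (i == 0%N) = false by lia.
have gtrue m : generically (fun _ : 'I_m -> C => True) by exact: generically_all.
split.
- apply: (@ud_mapP C A1 n i (fun c g => R_single i c g)
    (fun c _ l => if l == V i then c else 0) (fun _ _ => True)) => //.
    by move=> l; rewrite /R_single; case: (l == V i); [exact: posrat_head|exact: posrat1].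
  move=> c g x' c0 g0 _ _; rewrite /e_rat i0.
  by apply: (e_word_one (uniq_labels1 A1 n) (word1E A1 n)) => //; exact: filter_A1.
- apply: (@ud_funP C A1 n _ (fun g => g (V i.+1) / g (V i))
    (fun u => u (V i.+1) - u (V i)) (fun=> True)) => //.
    by apply: posratM; [|apply: posratV]; exact: posrat_gx.
  by move=> g z g0 g1 _; rewrite /eps_rat i0 eps_word1_lab eps_A1.
apply: (@ud_funP C A1 n _ (fun g => g (V i) ^+ 2 / (g (V i.-1) * g (V i.+1)))
    (fun u => 2 * u (V i) - (u (V i.-1) + u (V i.+1))) (fun=> True)) => //.
  apply: posratM; first by apply: posrat_expn; exact: posrat_gx.
  by apply: posratV; apply: posratM; exact: posrat_gx.
by move=> g z g0 g1 _; rewrite /gamma_rat i0 gamma_word1_lab gamma_A1.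
Qed.

Lemma ud_A1_zero (xi : 'I_k -> int) :
  [/\ ud_map (@e_rat C A1 n 0) (cons_pt 1 xi) = pt L (fun l => ux xi l + -1),
      ud_fun (@eps_rat C A1 n 0) xi = ux xi (V 1) &
      ud_fun (@gamma_rat C A1 n 0) xi = - (ux xi (V 1) + ux xi (V n))].
Proof.
have gtrue m : generically (fun _ : 'I_m -> C => True) by exact: generically_all.
split.
- apply: (@ud_mapP C A1 n 0 (fun c _ _ => c^-1) (fun c _ _ => - c) (fun _ _ => True)) => //.
    by move=> l; apply: posratV; exact: posrat_head.
  by move=> c g x' c0 g0 g1 _; apply: e_rat_A1.
- apply: (@ud_funP C A1 n _ (fun g => g (V 1)) (fun u => u (V 1)) (fun=> True)) => //.
    exact: posrat_gx.
  by move=> g z g0 g1 _; case: (A1_zero ad g0 g1).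
apply: (@ud_funP C A1 n _ (fun g => (g (V 1) * g (V n))^-1)
  (fun u => - (u (V 1) + u (V n))) (fun=> True)) => //.
  by apply: posratV; apply: posratM; exact: posrat_gx.
by move=> g z g0 g1 _; case: (A1_zero ad g0 g1).
Qed.

End UDA1.

(** * The isomorphism *)

(** [cr_f] selects a preimage under e_i. With e_i bijective on the source and [psi] a bijection
    commuting with e_i, the preimages are unique on both sides and correspond, so nothing has to be
    computed for f_i. *)
Lemma crystal_iso_of (n : nat) (A B : crystal n) (psi : cr_type A -> cr_type B) :
  @cr_set n A = setT -> set_bij (@cr_set n A) (@cr_set n B) psi ->
  (forall i, injective (@cr_e n A i) /\ forall b, exists a, @cr_e n A i a = b) ->
  (forall i a, [/\ psi (cr_e i a) = cr_e i (psi a), cr_wt i (psi a) = cr_wt i a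
     & cr_eps i (psi a) = cr_eps i a]) ->
  crystal_iso A B.
Proof.
move=> AT [PsiS PsiI PsiJ] eB H; exists psi; first by split.
move=> i a _; have [H1 H2 H3] := H i a; split=> //; last by rewrite /cr_phi H2 H3.
have [inj surj] := eB i; have [a' a'E] := surj a.
have -> : cr_f i a = a'.
  rewrite /cr_f; apply: xget_unique => [|b [_ bE]]; first by rewrite AT.
  by apply: inj; rewrite bE a'E.
rewrite /cr_f; apply/esym/xget_unique.
  split; first by apply: PsiS; rewrite AT.
  by have [<- _ _] := H i a'; rewrite a'E.
move=> b [/PsiJ [c _ <-]]; have [<- _ _] := H i c => E.
congr psi; apply: inj; rewrite a'E; apply: PsiI => //; by rewrite inE AT.
Qed.

Section Shift.

Context (t : affine_type) (n : nat).
Local Notation L := (labels1 t n).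
Local Notation k := (size (word1 t n)).
Local Notation ux := (coord L 0).

(* The piecewise linear map e_i adds to u a vector depending on the linear form
   delta of u only, and delta changes by a constant. *)
Lemma shift_bij (delta : (label -> int) -> int) (W : int -> label -> int) (kappa : int)
    (e : ('I_k -> int) -> 'I_k -> int) :
  (forall xi, e xi = pt L (fun l => ux xi l + W (delta (ux xi)) l)) ->
  (forall u v, {in L, u =1 v} -> delta u = delta v) ->
  (forall u v, delta (fun l => u l + v l) = delta u + delta v) ->
  (forall m, delta (W m) = kappa) ->
  injective e /\ forall eta, exists xi, e xi = eta.
Proof.
move=> eE ext add W0.
have wL := word1E t n; have uL := uniq_labels1 t n.
have ce (f : label -> int) : {in L, ux (pt L f : 'I_k -> int) =1 f}.
  by move=> l lL; rewrite coord_pt.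
split=> [xi xi' E|eta].
  have D : delta (ux xi) = delta (ux xi').
    have de z : delta (ux (e z)) = delta (ux z) + kappa.
      by rewrite eE (ext _ _ (ce _)) add W0.
    by apply: (addIr kappa); rewrite -!de E.
  move: E; rewrite !eE D => /(pt_eq wL) E.
  rewrite -(coordK uL wL 0 xi) -(coordK uL wL 0 xi'); apply/(pt_eq wL) => l lL.
  exact: addIr (E l lL).
(* [e] raises [delta] by [kappa], so a preimage of [eta] must have the value [m]; this tells which
   vector to subtract. *)
pose m := delta (ux eta) - kappa.
pose xi : 'I_k -> int := pt L (fun l => ux eta l - W m l).
have dm : delta (ux xi) = m.
  rewrite (ext _ _ (ce _)) /m; apply: (addIr kappa); rewrite subrK.
  have := add (fun l => ux eta l - W m l) (W m); rewrite W0 => <-.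
  by apply: ext => l _; rewrite subrK.
exists xi; rewrite eE dm -[RHS](coordK uL wL 0); apply/(pt_eq wL) => l lL.
by rewrite ce // subrK.
Qed.

End Shift.

(** * The coordinates u_i, ub_i and the map to B_infinity *)

Section psi.

Context (t : affine_type) (n : nat).
Hypothesis ad : admissible t n.
Hypothesis ct : classical_type t.
Implicit Types u v : label -> int.
Local Notation L := (labels1 t n).

Let n2 : (2 <= n)%N. Proof. exact: n_ge2 ad. Qed.

(** At node 0 all of X_0 goes to u_0, so that ub_0 = 0. At node n the two halves coincide. For
    D_n^(1) the letter n supplies u_{n-1} and u_n alike, so bar b_n = u_{n-1} - u_n = 0, the
    coordinate absent from that type. *)
Definition uco u (j : nat) : rat :=
  if j == 0%N then ((p0 t)%:Z * u (V 0))%:~R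
  else if j == n then (pn t)%:R / 2 * (u (V n))%:~R
  else if is_D1 t && (j == n.-1) then (u (V n))%:~R else (u (V j))%:~R.

Definition ubco u (j : nat) : rat :=
  if j == 0%N then 0
  else if j == n then (pn t)%:R / 2 * (u (V n))%:~R
  else if is_D1 t && (j == n.-1) then (u (V j))%:~R else (u (Vb j))%:~R.

Definition psi u (l : label) : rat :=
  match l with
  | V i => if (1 <= i <= n)%N then ubco u i - ubco u i.-1 else 0
  | Vb i => if (1 <= i <= n)%N then uco u i.-1 - uco u i else 0
  | Phi => 0
  end.

Lemma tX_hu u i : (tX t n u i)%:~R = uco u i + ubco u i :> rat.
Proof.
rewrite /tX /uco /ubco; case: (i == 0%N); first by rewrite addr0.
case: (i == n); first by rewrite intrM; field.
by case: (is_D1 t && _); rewrite ?intrD // addrC.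
Qed.

Lemma hu_add u v j : uco (fun l => u l + v l) j = uco u j + uco v j.
Proof.
rewrite /uco; case: (j == 0%N); first by rewrite mulrDr intrD.
case: (j == n); first by rewrite intrD mulrDr.
by case: (_ && _); rewrite intrD.
Qed.

Lemma hub_add u v j : ubco (fun l => u l + v l) j = ubco u j + ubco v j.
Proof.
rewrite /ubco; case: (j == 0%N); first by rewrite addr0.
case: (j == n); first by rewrite intrD mulrDr.
by case: (_ && _); rewrite intrD.
Qed.

Lemma tX_add u v i : tX t n (fun l => u l + v l) i = tX t n u i + tX t n v i.
Proof. by apply: (@intr_inj rat); rewrite intrD !tX_hu hu_add hub_add; ring. Qed.

Lemma Psi_add u v l : psi (fun l => u l + v l) l = psi u l + psi v l.
Proof.
rewrite /psi; case: l => [i|i|]; rewrite ?addr0 //; case: ifP => _; rewrite ?addr0 //;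
  rewrite ?hu_add ?hub_add; ring.
Qed.

Lemma hu_ext u v j : {in L, u =1 v} -> (j <= n)%N -> uco u j = uco v j.
Proof.
move=> E jn; rewrite /uco; case: (eqVneq j 0%N) => j0.
  by case: (posnP (p0 t)) => pE; [rewrite pE !mul0r|rewrite E // mem_labels1 //; lia].
case: (eqVneq j n) => j1; first by rewrite E // mem_labels1 //; lia.
by case: ifP => _; rewrite E // mem_labels1 //; lia.
Qed.

Lemma hub_ext u v j : {in L, u =1 v} -> (j <= n)%N -> ubco u j = ubco v j.
Proof.
move=> E jn; rewrite /ubco; case: (eqVneq j 0%N) => j0 //.
case: (eqVneq j n) => j1; first by rewrite E // mem_labels1 //; lia.
case: ifP => D; rewrite E // mem_labels1 //; first by lia.
by move: D; rewrite /down_rank; case: (is_D1 t) => /= D; lia.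
Qed.

Lemma tX_ext u v i : {in L, u =1 v} -> (i <= n)%N -> tX t n u i = tX t n v i.
Proof.
by move=> E ni; apply: (@intr_inj rat); rewrite !tX_hu (hu_ext E ni) (hub_ext E ni).
Qed.

Lemma Psi_ext u v : {in L, u =1 v} -> psi u = psi v.
Proof.
move=> E; apply: funext => -[i|i|] //=; case: ifP => // ni;
  by rewrite !(hu_ext E, hub_ext E) //; lia.
Qed.

(** The sum telescopes: u_n = ub_n at one end and ub_0 = 0 at the other leave u_0. *)
Lemma len_Psi u : len n (psi u) = uco u 0.
Proof.
rewrite /len (eq_big_nat _ _ (F2 := fun i => (ubco u i - uco u i) - (ubco u i.-1 - uco u i.-1))).
  rewrite big_add1 /= (telescope_sumr (fun i => ubco u i - uco u i)) // /uco /ubco.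
  by decide_ifs; ring.
by move=> i ni; rewrite /psi [(0 < i)%N && _]ni; ring.
Qed.

Lemma tX_lt u i j : (tX t n u i < tX t n u j) = (uco u i + ubco u i < uco u j + ubco u j).
Proof. by rewrite -(ltr_int rat) !tX_hu. Qed.

End psi.

(** Partial sums inverting the differences: [cub] recovers ub_i from ub_0 = 0, and [cu] recovers u_i
    downwards from u_n = ub_n. *)
Definition cub (b : coords) (i : nat) : rat := \sum_(1 <= j < i.+1) b (V j).

Definition cu (n : nat) (b : coords) (i : nat) : rat :=
  cub b n + \sum_(i.+1 <= j < n.+1) b (Vb j).

Lemma cubS b i : cub b i.+1 = cub b i + b (V i.+1).
Proof. by rewrite /cub big_nat_recr. Qed.

Lemma cuS n b i : (i < n)%N -> cu n b i = cu n b i.+1 + b (Vb i.+1).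
Proof. by move=> ni; rewrite /cu big_ltn ?ltnS //; ring. Qed.

Lemma len_cu n b : len n b = cu n b 0.
Proof. by rewrite /len big_split. Qed.

(** * Bijectivity onto B_infinity of the dual type *)

Section PsiBij.

Context (t : affine_type) (n : nat).
Hypothesis ad : admissible t n.
Hypothesis ct : classical_type t.
Implicit Types u v : label -> int.
Local Notation L := (labels1 t n).
Local Notation k := (size (word1 t n)).
Local Notation ux := (coord L 0).
Local Notation hu := (uco t n).
Local Notation hub := (ubco t n).
Local Notation Psi := (psi t n).

Let n2 : (2 <= n)%N. Proof. exact: n_ge2 ad. Qed.

(** The underlying sets of all the dual types in terms of [pn] and [p0] of the original one:
    half-integral b_n and bar b_n for [pn] = 1, and length zero, arbitrary or even for [p0] = 0, 1,
    2. *)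
Lemma Binf_setE b : Binf_set (langlands t) n b <->
  [/\ forall l, l \notin coord_labels (langlands t) n -> b l = 0,
      if pn t == 1%N then half_int_at n b else all_int b &
      match p0 t with 0 => len n b = 0 | 1 => True | _ => len n b / 2 \is a Num.int end].
Proof.
rewrite /Binf_set; case: t ct => //= _; split=> [[H1 H2]|[H1 H2 H3]]; split=> //;
  by case: H2.
Qed.

Lemma hub_cub u i : (i <= n)%N -> hub u i = cub (Psi u) i.
Proof.
elim: i => [|i IH] ni; first by rewrite /cub big_geq.
by rewrite cubS -IH ?(ltnW ni) // /Psi ni /=; ring.
Qed.

Lemma hu_cu u i : (i <= n)%N -> hu u i = cu n (Psi u) i.
Proof.
move=> ni; rewrite -(subKn ni); have : (n - i <= n)%N by rewrite leq_subr.
elim: (n - i)%N => [|j IH] jn.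
  rewrite subn0 /cu big_geq // addr0 -hub_cub // /uco /ubco.
  by rewrite (_ : (n == 0)%N = false) ?eqxx //; lia.
rewrite cuS; last by lia.
rewrite (_ : (n - j.+1).+1 = n - j)%N; last by lia.
rewrite -IH ?(ltnW jn) // /Psi ifT; last by lia.
by rewrite (_ : (n - j).-1 = n - j.+1)%N; [ring|lia].
Qed.

Lemma notin_coord l : l \notin coord_labels (langlands t) n -> forall u, Psi u l = 0.
Proof.
move=> H u; case: l H => [i|i|] // H; rewrite /psi; case: ifP => // ni.
  by exfalso; move: H; case: t ct => // _; rewrite /coord_labels mem_cat !mem_label /= orbF; lia.
case: (boolP (is_D1 t)) => tD; last first.
  by exfalso; move: H; case: t ct tD => // _ _; rewrite /coord_labels mem_cat !mem_label /=; lia.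
have iE : i = n by move: H; rewrite (isD1P tD) /coord_labels mem_cat !mem_label /=; lia.
by rewrite iE /uco (isD1P tD) /=; decide_ifs; field.
Qed.

Lemma hu_int u i : (i < n)%N -> hu u i \is a Num.int.
Proof.
move=> ni; rewrite /uco; case: ifP => _; first exact: intr_int.
by rewrite ifF; [case: ifP => _; exact: intr_int|lia].
Qed.

Lemma hub_int u i : (i < n)%N -> hub u i \is a Num.int.
Proof.
move=> ni; rewrite /ubco; case: ifP => _ //.
by rewrite ifF; [case: ifP => _; exact: intr_int|lia].
Qed.

Lemma hub_n u : hub u n = (pn t)%:R / 2 * (u (V n))%:~R.
Proof. by rewrite /ubco eqxx ifF //; lia. Qed.

Lemma hu_n u : hu u n = hub u n.
Proof. by rewrite hub_n /uco eqxx ifF //; lia. Qed.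

Lemma pn12 : pn t = 1%N \/ pn t = 2%N.
Proof. by case: t; auto. Qed.

Lemma hub_int2 u i : pn t = 2%N -> (i <= n)%N -> hub u i \is a Num.int /\ hu u i \is a Num.int.
Proof.
move=> pE ni; case: (eqVneq i n) => [->|iE]; last by rewrite hub_int ?hu_int //; lia.
by rewrite hu_n hub_n pE divff // mul1r intr_int.
Qed.

Lemma Psi_set u : Binf_set (langlands t) n (Psi u).
Proof.
apply/Binf_setE; split.
- by move=> l /notin_coord ->.
- case: pn12 => pE; rewrite pE /=.
    have E2 : 2 * hub u n \is a Num.int.
      by rewrite (_ : _ * _ = (u (V n))%:~R) ?intr_int // hub_n pE; field.
    split.
    + move=> i ni; rewrite /psi !ifT; try lia.
      by rewrite !rpredB ?hub_int ?hu_int //; lia.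
    + rewrite /psi ifT ?mulrBr ?rpredB //; last by lia.
      by rewrite rpredM ?hub_int //; lia.
    + rewrite /psi ifT ?mulrBr ?hu_n ?rpredB //; last by lia.
      by rewrite rpredM ?hu_int //; lia.
    (* The possibly half-integral values u_n = ub_n cancel in b_n + bar b_n. *)
    + rewrite /psi !ifT ?hu_n; try lia.
      rewrite (_ : _ + _ = hu u n.-1 - hub u n.-1); last by ring.
      by rewrite rpredB ?hub_int ?hu_int //; lia.
  move=> [i|i|] //=; case: ifP => // ni; rewrite rpredB //;
    by case: (hub_int2 u pE (i := i)) => //; try lia; case: (hub_int2 u pE (i := i.-1)) => //; lia.
rewrite len_Psi // /uco /=.
have pE : p0 t = 0%N \/ p0 t = 1%N \/ p0 t = 2%N by case: t; auto.
case: pE => [|[]] ->; rewrite ?mul0r //.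
by rewrite intrM mulrAC divff // mul1r intr_int.
Qed.

Lemma Psi_inj u v : Psi u = Psi v -> {in L, u =1 v}.
Proof.
move=> E; have Eh i : (i <= n)%N -> hub u i = hub v i by move=> ni; rewrite !hub_cub // E.
have Eu i : (i <= n)%N -> hu u i = hu v i by move=> ni; rewrite !hu_cu // E.
have En : u (V n) = v (V n).
  apply: (@intr_inj rat); have := Eh n (leqnn n); rewrite !hub_n.
  by apply: mulfI; case: pn12 => ->.
move=> l; rewrite mem_labels1 //; case: l => [i|i|] // ni; apply: (@intr_inj rat).
  case: (eqVneq i 0%N) => [iE|i0].
    have p00 : (p0 t)%:R != 0 :> rat by rewrite pnatr_eq0; lia.
    have := Eu 0%N isT; rewrite iE /uco /= !intrM => /(mulfI _); apply.
    by rewrite -[(p0 t)%:~R]/((p0 t)%:R).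
  case: (eqVneq i n) => [->|iE]; first by rewrite En.
  have i0' : (i == 0%N) = false by lia.
  have i1' : (i == n) = false by lia.
  case: (boolP (is_D1 t && (i == n.-1))) => D.
    by have := Eh i; rewrite /ubco i0' i1' D; apply; lia.
  by have := Eu i; rewrite /uco i0' i1' (negPf D); apply; lia.
have dn := down_rank_lt ad ct.
have i0' : (i == 0%N) = false by lia.
have i1' : (i == n) = false by lia.
have D : is_D1 t && (i == n.-1) = false.
  by move: ni; rewrite /down_rank; case: (is_D1 t) => //= ni; lia.
by have := Eh i; rewrite /ubco i0' i1' D; apply; lia.
Qed.

(* The inverse of Psi; all the arguments of the floor are integers on the
   crystal. *)
Definition psi_inv (b : coords) (l : label) : int :=
  Num.floor (match l with
  | V j => if j == 0%N then cu n b 0 / (p0 t)%:R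
           else if j == n then 2 / (pn t)%:R * cub b n
           else if is_D1 t && (j == n.-1) then cub b j else cu n b j
  | Vb j => cub b j
  | Phi => 0 end).

Lemma cub_int b i : (i < n)%N -> (forall j, (1 <= j < n)%N -> b (V j) \is a Num.int) ->
  cub b i \is a Num.int.
Proof.
move=> ni H; rewrite /cub big_nat rpred_sum // => j ji; apply: H; lia.
Qed.

Lemma psi_invK b : Binf_set (langlands t) n b -> Psi (psi_inv b) = b.
Proof.
move=> /Binf_setE [B0 B1 B2].
have bI : forall j, (1 <= j < n)%N -> b (V j) \is a Num.int /\ b (Vb j) \is a Num.int.
  by move=> j nj; case: pn12 B1 => -> /=; [case=> H _ _ _; exact: H|move=> H; split].
have cI i : (i < n)%N -> cub b i \is a Num.int.
  by move=> ni; apply: cub_int => // j /bI [].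
have cn : 2 / (pn t)%:R * cub b n \is a Num.int.
  have -> : cub b n = cub b n.-1 + b (V n) by rewrite -[in LHS](prednK (ltnW n2)) cubS prednK // ltnW.
  case: pn12 B1 => -> /=.
    by case=> _ H _ _; rewrite divr1 mulrDr rpredD // rpredM // cI //; lia.
  by move=> H; rewrite divff // mul1r rpredD // cI //; lia.
have uI i : (1 <= i < n)%N -> cu n b i \is a Num.int.
  move=> ni; rewrite /cu.
  have -> : cub b n = cub b n.-1 + b (V n) by rewrite -[in LHS](prednK (ltnW n2)) cubS prednK // ltnW.
  have -> : \sum_(i.+1 <= j < n.+1) b (Vb j) = \sum_(i.+1 <= j < n) b (Vb j) + b (Vb n).
    by rewrite big_nat_recr //; lia.
  (* b_n and bar b_n are grouped because for [pn] = 1 only their sum is known to be an integer. *)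
  have -> : cub b n.-1 + b (V n) + (\sum_(i.+1 <= j < n) b (Vb j) + b (Vb n)) =
     cub b n.-1 + \sum_(i.+1 <= j < n) b (Vb j) + (b (V n) + b (Vb n)) by ring.
  apply: rpredD; last by case: pn12 B1 => -> /=; [case|move=> H; apply: rpredD].
  apply: rpredD; first by apply: cI; lia.
  by rewrite big_nat; apply: rpred_sum => j nj; case: (bI j) => //; lia.
have u0 : (0 < p0 t)%N -> cu n b 0 / (p0 t)%:R \is a Num.int.
  have pE : p0 t = 0%N \/ p0 t = 1%N \/ p0 t = 2%N by case: t; auto.
  case: pE B2 => [|[]] -> //; last by rewrite len_cu.
  move=> _ _; rewrite divr1 cuS ?(ltnW n2) //.
  by apply: rpredD; [apply: uI; lia|case: (bI 1%N)].
have Hn : hub (psi_inv b) n = cub b n.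
  by rewrite hub_n /psi_inv eqxx ifF ?floorK //; [case: pn12 => ->; field|lia].
have Hb i : (i <= n)%N -> hub (psi_inv b) i = cub b i.
  move=> ni; case: (eqVneq i n) => [->|iE] //.
  rewrite /ubco (negPf iE) /psi_inv; case: (eqVneq i 0%N) => [->|i0]; first by rewrite /cub big_geq.
  rewrite (negPf iE); case: (boolP (is_D1 t && _)) => D; rewrite floorK // cI //; lia.
have Hu i : (i <= n)%N -> hu (psi_inv b) i = cu n b i.
  move=> ni; case: (eqVneq i n) => [->|iE]; first by rewrite hu_n Hn /cu big_geq // addr0.
  rewrite /uco (negPf iE); case: (eqVneq i 0%N) => [->|i0].
    case: (posnP (p0 t)) => pE; first by rewrite pE mul0r -len_cu; move: B2; rewrite pE => ->.
    by rewrite intrM /psi_inv /= floorK ?u0 //; field; rewrite pnatr_eq0; lia.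
  case: (boolP (is_D1 t && _)) => D.
    have [tD iE'] := andP D; rewrite (eqP iE') cuS; last by lia.
    rewrite prednK ?(ltnW n2) // /cu big_geq // B0; last first.
      by rewrite (isD1P tD) /coord_labels mem_cat !mem_label /=; lia.
    by rewrite !addr0 -Hn hub_n (isD1P tD) divff // mul1r.
  rewrite /psi_inv (negPf i0) (negPf iE) (negPf D) floorK // uI //; lia.
apply: funext => -[i|i|] /=; last first.
- by rewrite B0 //; case: t ct => // _; rewrite /coord_labels mem_cat !mem_label.
- case: ifP => ni; last first.
    rewrite B0 //; case: t ct => // _; rewrite /coord_labels mem_cat !mem_label /=; lia.
  by rewrite !Hu; try lia; case: i ni => // i ni; rewrite cuS //=; ring.
- case: ifP => ni; last first.
    rewrite B0 //; case: t ct => // _; rewrite /coord_labels mem_cat !mem_label /=; lia.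
  by rewrite !Hb; try lia; case: i ni => // i ni; rewrite cubS //=; ring.
Qed.

Lemma Psi_bij : set_bij setT (Binf_set (langlands t) n) (fun xi : 'I_k -> int => Psi (ux xi)).
Proof.
split.
- by move=> xi _; exact: Psi_set.
- move=> xi xi' _ _ /Psi_inj E.
  rewrite -(coordK (uniq_labels1 t n) (word1E t n) 0 xi) -(coordK (uniq_labels1 t n) (word1E t n) 0 xi').
  exact/(pt_eq (word1E t n)).
move=> b bB; exists (pt L (psi_inv b)) => //.
rewrite -[RHS](psi_invK bB); apply: Psi_ext => // l lL.
by rewrite coord_pt //; exact: word1E.
Qed.

End PsiBij.

(** The tropical rho takes only the values 0 and 1, by integrality; these are the two branches of
    e_i on B_infinity. *)
Lemma max_cases (a b : int) :
  Num.max (1 + a) b - Num.max a b = (if a < b then 0 else 1).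
Proof. by case: ifP => H; rewrite /Num.max; do 2?case: ifP => ?; lia. Qed.

(** * Compatibility with the operators e_i *)

Section Commute.

Context (t : affine_type) (n : nat).
Hypothesis ad : admissible t n.
Hypothesis ct : classical_type t.
Implicit Type u : label -> int.
Local Notation L := (labels1 t n).
Local Notation k := (size (word1 t n)).
Local Notation ux := (coord L 0).
Local Notation hu := (uco t n).
Local Notation hub := (ubco t n).
Local Notation Psi := (psi t n).
Local Notation dr := (down_rank t n).
Local Notation X := (tX t n).
Local Notation tl := (langlands t).

Let n2 : (2 <= n)%N. Proof. exact: n_ge2 ad. Qed.

Lemma Psi_shift (xi : 'I_k -> int) (D : label -> int) :
  Psi (ux (pt L (fun l => ux xi l + D l) : 'I_k -> int)) = fun l => Psi (ux xi) l + Psi D l.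
Proof.
rewrite (@Psi_ext t n ad ct _ (fun l => ux xi l + D l)); last first.
  by move=> l lL; rewrite coord_pt //; exact: word1E.
by apply: funext => l; rewrite Psi_add.
Qed.

Lemma hu_inner u i : (1 <= i <= dr)%N -> hu u i = (u (V i))%:~R /\ hub u i = (u (Vb i))%:~R.
Proof.
move=> ni; have dn := down_rank_lt ad ct.
have D : is_D1 t && (i == n.-1) = false.
  by move: ni; rewrite /down_rank; case: (is_D1 t) => //= ni; lia.
by rewrite /uco /ubco D; decide_ifs.
Qed.

Lemma dr_cond u i : (1 <= i < n)%N ->
  (Psi u (Vb i.+1) < Psi u (V i.+1)) = (X u i < X u i.+1).
Proof.
move=> ni; rewrite tX_lt /psi !ifT /=; try lia.
by rewrite -subr_gt0 -[RHS]subr_gt0; congr (_ < _); ring.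
Qed.

Lemma e_inner (xi : 'I_k -> int) i : (1 <= i <= dr)%N ->
  Psi (ux (pt L (fun l => ux xi l + D_inner t n i (ux xi) l) : 'I_k -> int)) =
  Binf_ei tl n i (Psi (ux xi)).
Proof.
move=> ni; have dn := down_rank_lt ad ct; rewrite Psi_shift; set u := ux xi.
have -> : Binf_ei tl n i (Psi u) = if X u i < X u i.+1
    then add_at (add_at (Psi u) (V i) 1) (V i.+1) (-1)
    else add_at (add_at (Psi u) (Vb i.+1) 1) (Vb i) (-1).
  rewrite -dr_cond; last by lia.
  by move: ni dn; rewrite /down_rank; case: t ct ad => //= _ ad' ni dn; rewrite /Binf_ei;
     decide_ifs.
set D := D_inner t n i u.
pose r : int := if X u i < X u i.+1 then 0 else 1.
have DE l : D l = if l == V i then r else if l == Vb i then 1 - r else 0.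
  by rewrite /D /D_inner max_cases.
have hD j : hu D j = if j == i then r%:~R else 0.
  case: (eqVneq j i) => [->|ji]; first by case: (hu_inner D ni) => -> _; rewrite DE eqxx.
  rewrite /uco !DE !eq_label (negPf ji).
  by decide_ifs; do 3?case: ifP => _; rewrite ?mulr0.
have hbD j : hub D j = if j == i then (1 - r)%:~R else 0.
  case: (eqVneq j i) => [->|ji]; first by case: (hu_inner D ni) => _ ->; rewrite DE /= eqxx.
  rewrite /ubco !DE !eq_label (negPf ji).
  by decide_ifs; do 3?case: ifP => _; rewrite ?mulr0.
apply: funext => -[j|j|].
- rewrite [Psi D _]/= !hbD /r; case: (X u i < X u i.+1); rewrite /add_at !eq_label /=.
    case: (eqVneq j i) => [->|j1]; first by decide_ifs; lra.
    case: (eqVneq j i.+1) => [->|j2]; first by decide_ifs; lra.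
    by case: ifP => nj; decide_ifs; lra.
  by do 3?case: ifP => _; lra.
- rewrite [Psi D _]/= !hD /r; case: (X u i < X u i.+1); rewrite /add_at !eq_label /=.
    by do 3?case: ifP => _; lra.
  case: (eqVneq j i) => [->|j1]; first by decide_ifs; lra.
  case: (eqVneq j i.+1) => [->|j2]; first by decide_ifs; lra.
  by case: ifP => nj; decide_ifs; lra.
- by case: ifP => _; rewrite /add_at /= !addr0.
Qed.

Lemma e_last (xi : 'I_k -> int) : ~~ is_D1 t ->
  Psi (ux (pt L (fun l => ux xi l + D_single n l) : 'I_k -> int)) =
  Binf_ei tl n n (Psi (ux xi)).
Proof.
move=> nD; rewrite Psi_shift; set u := ux xi.
(* A unit step at the letter n moves u_n and ub_n by [pn] / 2 each; this is the step 1/2 or 1 of e_n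
   on the dual side. *)
pose q : rat := (pn t)%:R / 2.
have -> : Binf_ei tl n n (Psi u) = add_at (add_at (Psi u) (V n) q) (Vb n) (- q).
  by rewrite /q; case: t ct ad nD => //= _ ad' _; rewrite /Binf_ei; decide_ifs; rewrite /Binf_en ?divff.
have hD j : hu (D_single n) j = if j == n then q else 0.
  rewrite /uco /D_single (negPf nD) !eq_label eqxx; decide_ifs.
  case: (eqVneq j 0%N) => [->|j0]; first by decide_ifs; rewrite mulr0.
  by case: (eqVneq j n) => [_|j1]; rewrite ?mulr1 ?if_same.
have hbD j : hub (D_single n) j = if j == n then q else 0.
  rewrite /ubco /D_single (negPf nD) !eq_label eqxx; decide_ifs.
  case: (eqVneq j 0%N) => [->|j0]; first by decide_ifs.
  by case: (eqVneq j n) => [_|j1]; rewrite ?mulr1 ?if_same.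
apply: funext => -[j|j|]; rewrite [Psi (D_single n) _]/= ?hD ?hbD /add_at !eq_label /=; last by rewrite !addr0.
  case: (eqVneq j n) => [->|j1]; first by decide_ifs; lra.
  by case: ifP => nj; decide_ifs; lra.
case: (eqVneq j n) => [->|j1]; first by decide_ifs; lra.
by case: ifP => nj; decide_ifs; lra.
Qed.

End Commute.

Section CommuteEnds.

Context (t : affine_type) (n : nat).
Hypothesis ad : admissible t n.
Hypothesis ct : classical_type t.
Implicit Type u : label -> int.
Local Notation L := (labels1 t n).
Local Notation k := (size (word1 t n)).
Local Notation ux := (coord L 0).
Local Notation hu := (uco t n).
Local Notation hub := (ubco t n).
Local Notation Psi := (psi t n).
Local Notation X := (tX t n).
Local Notation tl := (langlands t).

Let n2 : (2 <= n)%N. Proof. exact: n_ge2 ad. Qed.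

(** The letter n enters u_{n-1}, u_n and ub_n, so raising it changes b_n and bar b_{n-1} only. The
    letter n-1 enters ub_{n-1} alone, which changes b_{n-1} and b_n. *)
Lemma e_D1 (xi : 'I_k -> int) i : is_D1 t -> i = n \/ i = n.-1 ->
  Psi (ux (pt L (fun l => ux xi l + D_single i l) : 'I_k -> int)) =
  Binf_ei tl n i (Psi (ux xi)).
Proof.
move=> tD iE; have n4 : (4 <= n)%N by move: ad; rewrite (isD1P tD).
rewrite Psi_shift //; set u := ux xi.
have pE : p0 t = 0%N by rewrite (isD1P tD).
have pnE : (pn t)%:R / 2 = 1 :> rat by rewrite (isD1P tD).
have hD j : hu (D_single i) j = if (i == n) && (n.-1 <= j <= n)%N then 1 else 0.
  rewrite /uco /D_single pE pnE tD !eq_label; case: iE => ->; rewrite ?eqxx.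
    case: (ltngtP j n) => jn; decide_ifs; rewrite ?mulr1 ?mul0r //.
      by case: (eqVneq j n.-1) => [->|j1]; decide_ifs; rewrite ?mul0r ?if_same.
  by decide_ifs; rewrite mulr0; case: (j == n.-1); rewrite ?if_same.
have hbD j : hub (D_single i) j = if j == i then 1 else 0.
  rewrite /ubco /D_single pnE tD !eq_label; case: iE => ->; rewrite ?eqxx.
    case: (eqVneq j 0%N) => [->|j0]; first by decide_ifs.
    by case: (eqVneq j n) => [_|j1]; rewrite ?mulr1 ?if_same.
  decide_ifs; rewrite mulr0; case: (eqVneq j 0%N) => [->|j0]; first by decide_ifs.
  case: (eqVneq j n) => [->|j1]; first by decide_ifs.
  by case: (eqVneq j n.-1).
have -> : Binf_ei tl n i (Psi u) = if i == n
    then add_at (add_at (Psi u) (V n) 1) (Vb n.-1) (-1)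
    else add_at (add_at (Psi u) (V n.-1) 1) (V n) (-1).
  by rewrite (isD1P tD) /Binf_ei /=; case: iE => ->; decide_ifs.
case: iE hD hbD => -> hD hbD; rewrite ?eqxx.
  apply: funext => -[j|j|]; rewrite [Psi (D_single n) _]/= ?hD ?hbD ?eqxx /add_at ?eq_label /=; last by rewrite !addr0.
    case: (eqVneq j n) => [->|j1]; first by decide_ifs; lra.
    by case: ifP => nj; decide_ifs; lra.
  case: (eqVneq j n.-1) => [->|j1]; first by decide_ifs; lra.
  case: (eqVneq j n) => [->|j2]; first by decide_ifs; lra.
  by case: ifP => nj; decide_ifs; lra.
have nn : (n.-1 == n) = false by lia.
rewrite nn in hD *.
apply: funext => -[j|j|]; rewrite [Psi (D_single n.-1) _]/= ?hD ?hbD /add_at ?eq_label /=; last by rewrite !addr0.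
  case: (eqVneq j n.-1) => [->|j1]; first by decide_ifs; lra.
  case: (eqVneq j n) => [->|j2]; first by decide_ifs; lra.
  by case: ifP => nj; decide_ifs; lra.
by case: ifP => nj; lra.
Qed.

(** All u_j and ub_j with j >= 2 drop by 1, which cancels in differences. With u_0 = ub_0 = 0 fixed,
    u_1 moves by r - 1 and ub_1 by -r, so only indices 1 and 2 are affected. *)
Lemma e_fork (xi : 'I_k -> int) : p0 t = 0%N ->
  Psi (ux (pt L (fun l => ux xi l + D_fork t n (ux xi) l) : 'I_k -> int)) =
  Binf_ei tl n 0 (Psi (ux xi)).
Proof.
move=> pE; have n3 : (3 <= n)%N by case: t ct ad pE => //=; lia.
have n4 : is_D1 t -> (4 <= n)%N by move=> tD; move: ad; rewrite (isD1P tD).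
rewrite Psi_shift //; set u := ux xi.
have -> : Binf_ei tl n 0 (Psi u) = if X u 1 < X u 2
    then add_at (add_at (Psi u) (V 2) (-1)) (Vb 1) 1
    else add_at (add_at (Psi u) (V 1) (-1)) (Vb 2) 1.
  by rewrite -(@dr_cond t n ad) //; case: t ct pE.
set D := D_fork t n u.
pose r : int := if X u 1 < X u 2 then 0 else 1.
have DE l : D l = if l == V 1 then r - 1 else if l == Vb 1 then - r
  else - ((if l == V n then 3 - pn t else 1)%N%:Z) by rewrite /D /D_fork max_cases.
have Dn : (pn t)%:R / 2 * (D (V n))%:~R = -1 :> rat.
  by rewrite DE !eq_label eqxx; decide_ifs; case: (pn12 t) => ->.
have Dn' : is_D1 t -> D (V n) = -1.
  by move=> tD; rewrite DE !eq_label eqxx (isD1P tD); decide_ifs.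
have DV j : (1 < j < n)%N -> D (V j) = -1 by move=> jn; rewrite DE !eq_label; decide_ifs.
have DVb j : (1 < j)%N -> D (Vb j) = -1 by move=> jn; rewrite DE !eq_label; decide_ifs.
have hD j : (j <= n)%N -> hu D j = if j == 0%N then 0 else if j == 1%N then (r - 1)%:~R else -1.
  move=> jn; rewrite /uco pE mul0r; case: (eqVneq j 0%N) => [_|j0] //.
  case: (eqVneq j n) => [->|j1]; first by decide_ifs; rewrite Dn.
  case: (eqVneq j 1%N) => [->|j2]; first by rewrite ifF ?DE // ; case: (is_D1 t) n4 => //= n4; lia.
  case: (boolP (is_D1 t && _)) => [/andP[tD _]|_]; first by rewrite Dn'.
  by rewrite DV //; lia.
have hbD j : (j <= n)%N -> hub D j = if j == 0%N then 0 else if j == 1%N then (- r)%:~R else -1.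
  move=> jn; rewrite /ubco; case: (eqVneq j 0%N) => [_|j0] //.
  case: (eqVneq j n) => [->|j1]; first by decide_ifs; rewrite Dn.
  case: (eqVneq j 1%N) => [->|j2]; first by rewrite ifF ?DE // ; case: (is_D1 t) n4 => //= n4; lia.
  by case: ifP => _; rewrite ?DV ?DVb //; lia.
apply: funext => -[j|j|]; rewrite [Psi D _]/= /r; last first.
- by rewrite addr0; case: ifP => _; rewrite /add_at /= !addr0.
- case: (posnP j) => [->|j0]; first by rewrite /=; case: ifP => _; rewrite /add_at /= !addr0.
  case: (leqP j n) => jn; last first.
    by rewrite andbF; case: ifP => _; rewrite /add_at !eq_label; decide_ifs; rewrite !addr0.
  rewrite [X in _ + X]/= !hD ?(leq_trans (leq_pred _)) // /r.
  case: (X u 1 < X u 2); rewrite /add_at !eq_label /=;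
  (case: (eqVneq j 1%N) => [->|j1]; [by decide_ifs; lra|]);
  (case: (eqVneq j 2%N) => [->|j2]; [by decide_ifs; lra|]); by decide_ifs; lra.
case: (posnP j) => [->|j0]; first by rewrite /=; case: ifP => _; rewrite /add_at /= !addr0.
case: (leqP j n) => jn; last first.
  by rewrite andbF; case: ifP => _; rewrite /add_at !eq_label; decide_ifs; rewrite !addr0.
rewrite [X in _ + X]/= !hbD ?(leq_trans (leq_pred _)) // /r.
case: (X u 1 < X u 2); rewrite /add_at !eq_label /=;
(case: (eqVneq j 1%N) => [->|j1]; [by decide_ifs; lra|]);
(case: (eqVneq j 2%N) => [->|j2]; [by decide_ifs; lra|]); by decide_ifs; lra.
Qed.

End CommuteEnds.

Lemma posp_max (a b : int) : posp (b%:~R - a%:~R) = (Num.max a b)%:~R - a%:~R.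
Proof.
rewrite /posp; case: (leP a b) => ab.
  by rewrite max_l // subr_ge0 ler_int.
by rewrite max_r ?subrr // subr_le0 ler_int ltW.
Qed.

(** With d = X_1 - X_0 this is the tropical r. For p = 1 the middle case is void, leaving two
    branches; for p = 2 it is d = 1, the exceptional middle branch of e_0 on B_infinity of type
    C_n^(1). *)
Lemma line_jump (p : nat) (d : int) : (p = 1%N \/ p = 2%N) ->
  Num.max p%:Z d - p%:Z - Num.max 0 d =
  if p%:Z <= d then - p%:Z else if 0 < d then - d else 0.
Proof.
by move=> pE; rewrite !maxEle; do 4?case: ifP; case: pE => ->; lia.
Qed.

(** * Weights, the functions eps_i, and e_0 for a line *)

Section WtEps.

Context (t : affine_type) (n : nat).
Hypothesis ad : admissible t n.
Hypothesis ct : classical_type t.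
Implicit Type u : label -> int.
Local Notation L := (labels1 t n).
Local Notation k := (size (word1 t n)).
Local Notation ux := (coord L 0).
Local Notation hu := (uco t n).
Local Notation hub := (ubco t n).
Local Notation Psi := (psi t n).
Local Notation dr := (down_rank t n).
Local Notation X := (tX t n).
Local Notation tl := (langlands t).

Let n2 : (2 <= n)%N. Proof. exact: n_ge2 ad. Qed.

Lemma tU_hu u i : (i <= dr)%N -> (tU t u i)%:~R = hu u i.
Proof.
case: (posnP i) => [->|i0] // ni; have [|-> _] := @hu_inner t n ad ct u i; first by lia.
by rewrite /tU; decide_ifs.
Qed.

Lemma psiV u i : (1 <= i <= n)%N -> Psi u (V i) = hub u i - hub u i.-1.
Proof. by rewrite /psi => ->. Qed.

Lemma psiVb u i : (1 <= i <= n)%N -> Psi u (Vb i) = hu u i.-1 - hu u i.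
Proof. by rewrite /psi => ->. Qed.

Lemma posp_psi u i : (1 <= i < n)%N ->
  posp (Psi u (V i.+1) - Psi u (Vb i.+1)) = (Num.max (X u i) (X u i.+1))%:~R - (X u i)%:~R.
Proof.
move=> ni; rewrite -posp_max psiV ?psiVb ?tX_hu; try lia.
by congr posp; rewrite /=; ring.
Qed.

Lemma wt_eps_inner u i : (1 <= i <= dr)%N ->
  Binf_wt tl n i (Psi u) = (2 * X u i - (X u i.-1 + X u i.+1))%:~R /\
  Binf_eps tl n i (Psi u) = (tU t u i.-1 + tV t n u i.+1 - X u i)%:~R.
Proof.
move=> ni; have dn := down_rank_lt ad ct.
have -> : Binf_wt tl n i (Psi u) = Psi u (V i) - Psi u (Vb i) + Psi u (Vb i.+1) - Psi u (V i.+1).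
  by move: ni dn; rewrite /down_rank; case: t ct ad => //= _ ad' ni dn; rewrite /Binf_wt; decide_ifs.
have -> : Binf_eps tl n i (Psi u) = Psi u (Vb i) + posp (Psi u (V i.+1) - Psi u (Vb i.+1)).
  by move: ni dn; rewrite /down_rank; case: t ct ad => //= _ ad' ni dn; rewrite /Binf_eps; decide_ifs.
rewrite posp_psi ?psiV ?psiVb; try lia.
rewrite /tV !(intrD, intrM, mulrNz) /= !tU_hu ?tX_hu; try lia.
by split; ring.
Qed.

Lemma wt_eps_last u : ~~ is_D1 t ->
  Binf_wt tl n n (Psi u) = (2 * u (V n) - (3 - pn t)%N%:Z * X u n.-1)%:~R /\
  Binf_eps tl n n (Psi u) = ((3 - pn t)%N%:Z * u (V n.-1) - u (V n))%:~R.
Proof.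
move=> nD.
have -> : Binf_wt tl n n (Psi u) = (3 - pn t)%N%:R * (Psi u (V n) - Psi u (Vb n)).
  by case: t ct ad nD => //= _ ad' _; rewrite /Binf_wt; decide_ifs; rewrite /Binf_wtn /= ?mul1r.
have -> : Binf_eps tl n n (Psi u) = (3 - pn t)%N%:R * Psi u (Vb n).
  by case: t ct ad nD => //= _ ad' _; rewrite /Binf_eps; decide_ifs; rewrite /Binf_epsn /= ?mul1r.
have [|hE _] := @hu_inner t n ad ct u n.-1; first by rewrite /down_rank (negPf nD); lia.
rewrite psiV ?psiVb; try lia.
rewrite !(intrD, intrM, mulrNz) tX_hu hE hu_n // hub_n //.
have [[pE qE]|[pE qE]] : (pn t = 1 /\ 3 - pn t = 2 \/ pn t = 2 /\ 3 - pn t = 1)%N.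
  by case: t; auto.
all: by rewrite qE pE -?pmulrn; split; field.
Qed.

Lemma wt_eps_D1 u i : is_D1 t -> i = n \/ i = n.-1 ->
  Binf_wt tl n i (Psi u) = (2 * u (V i) - X u n.-2)%:~R /\
  Binf_eps tl n i (Psi u) = (u (V n.-2) - u (V i))%:~R.
Proof.
move=> tD iE; have n4 : (4 <= n)%N by move: ad; rewrite (isD1P tD).
have [|hE hbE] := @hu_inner t n ad ct u n.-2; first by rewrite /down_rank tD; lia.
have h1 : hu u n.-1 = (u (V n))%:~R by rewrite /uco tD; decide_ifs.
have h2 : hub u n.-1 = (u (V n.-1))%:~R by rewrite /ubco tD; decide_ifs.
have h3 : hub u n = (u (V n))%:~R by rewrite hub_n // (isD1P tD) divff // mul1r.
have -> : Binf_wt tl n i (Psi u) = Psi u (V n.-1) - Psi u (Vb n.-1) +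
    (if i == n then Psi u (V n) else - Psi u (V n)).
  by rewrite (isD1P tD) /Binf_wt /=; case: iE => ->; decide_ifs.
have -> : Binf_eps tl n i (Psi u) = (if i == n then 0 else Psi u (V n)) + Psi u (Vb n.-1).
  by rewrite (isD1P tD) /Binf_eps /=; case: iE => ->; decide_ifs; rewrite ?add0r.
rewrite !psiV ?psiVb; try lia.
rewrite !(intrD, intrM, mulrNz) tX_hu hE hbE h1 h2 h3.
by case: iE => ->; decide_ifs; split; ring.
Qed.

Lemma wt_eps_fork u : p0 t = 0%N ->
  Binf_wt tl n 0 (Psi u) = (- X u 2)%:~R /\
  Binf_eps tl n 0 (Psi u) = (Num.max (X u 1) (X u 2) - u (V 1))%:~R.
Proof.
move=> pE; have n3 : (3 <= n)%N by case: t ct ad pE => //=; lia.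
have -> : Binf_wt tl n 0 (Psi u) = Psi u (Vb 1) - Psi u (V 1) + Psi u (Vb 2) - Psi u (V 2).
  by case: t ct pE.
have -> : Binf_eps tl n 0 (Psi u) = Psi u (V 1) + posp (Psi u (V 2) - Psi u (Vb 2)).
  by case: t ct pE.
have [|hE hbE] := @hu_inner t n ad ct u 1%N.
  by case: t ct ad pE => //= _ ad' _; rewrite /down_rank /=; lia.
rewrite posp_psi // !psiV ?psiVb; try lia.
rewrite !(intrD, mulrNz) !tX_hu /= hE hbE (_ : hu u 0 = 0) 1?(_ : hub u 0 = 0) //; last first.
  by rewrite /uco pE mul0r.
by split; ring.
Qed.

Lemma wt_eps_line u : (0 < p0 t)%N ->
  Binf_wt tl n 0 (Psi u) = (2 * u (V 0) - (3 - p0 t)%N%:Z * X u 1)%:~R /\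
  Binf_eps tl n 0 (Psi u) = ((3 - p0 t)%N%:Z * tV t n u 1 - u (V 0))%:~R.
Proof.
move=> pt0; have nD := line_not_D1 pt0.
have -> : Binf_wt tl n 0 (Psi u) = (3 - p0 t)%N%:R * (Psi u (Vb 1) - Psi u (V 1)).
  by case: t pt0 => //= _; rewrite /Binf_wt /= ?mul1r.
have -> : Binf_eps tl n 0 (Psi u) = - ((3 - p0 t)%N%:R / 2) * len n (Psi u) +
    (3 - p0 t)%N%:R * posp (Psi u (V 1) - Psi u (Vb 1)).
  by case: t pt0 => //= _; rewrite /Binf_eps /= ?mul1r ?divff ?mulN1r.
rewrite len_Psi //.
have -> : posp (Psi u (V 1) - Psi u (Vb 1)) = (Num.max (X u 0) (X u 1))%:~R - (X u 0)%:~R.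
  rewrite -posp_max psiV ?psiVb; try lia.
  by congr posp; rewrite !tX_hu /=; ring.
rewrite psiV ?psiVb; try lia.
rewrite /tV !(intrD, intrM, mulrNz) /= !tX_hu (_ : hub u 0 = 0) //.
have -> : hu u 0 = (p0 t)%:R * (u (V 0))%:~R by rewrite /uco /= intrM.
have [[pE qE]|[pE qE]] : (p0 t = 1 /\ 3 - p0 t = 2 \/ p0 t = 2 /\ 3 - p0 t = 1)%N.
  by case: t pt0; auto.
all: by rewrite qE pE -?pmulrn; split; field.
Qed.

(** All u_j and ub_j with j >= 1 move by the same r, which cancels in differences, while u_0 moves
    by [p0] + 2 r and ub_0 stays 0. Hence b_1 changes by r, bar b_1 by [p0] + r, and nothing else
    changes. *)
Lemma e_line (xi : 'I_k -> int) : (0 < p0 t)%N ->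
  Psi (ux (pt L (fun l => ux xi l + D_line t n (ux xi) l) : 'I_k -> int)) =
  Binf_ei tl n 0 (Psi (ux xi)).
Proof.
move=> pt0; have nD := line_not_D1 pt0.
rewrite Psi_shift //; set u := ux xi.
set D := D_line t n u.
pose d := X u 1 - X u 0.
pose r : int := Num.max (p0 t)%:Z d - (p0 t)%:Z - Num.max 0 d.
have DE l : D l = if l == V 0 then 1 + (3 - p0 t)%N%:Z * r
    else if l == V n then (3 - pn t)%N%:Z * r else r.
  rewrite /D /D_line; suff -> : Num.max ((p0 t)%:Z + X u 0) (X u 1) -
     ((p0 t)%:Z + Num.max (X u 0) (X u 1)) = r by [].
  by rewrite /r /d /Num.max; do 4?case: ifP => ?; lia.
have pq : (pn t)%:R / 2 * (3 - pn t)%N%:R = 1 :> rat by case: (pn12 t) => ->.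
have hD j : (j <= n)%N -> hu D j = if j == 0%N then ((p0 t)%:Z + 2 * r)%:~R else r%:~R.
  move=> jn; rewrite /uco !DE (negPf nD) !eq_label; case: (eqVneq j 0%N) => [_|j0].
    by rewrite eqxx; congr (_%:~R); case: (t) pt0 => // _ /=; lia.
  case: (eqVneq j n) => [_|j1]; last by decide_ifs.
  by decide_ifs; rewrite intrM mulrA -pmulrn pq mul1r.
have hbD j : (j <= n)%N -> hub D j = if j == 0%N then 0 else r%:~R.
  move=> jn; rewrite /ubco !DE (negPf nD) !eq_label; case: (eqVneq j 0%N) => [_|j0] //.
  case: (eqVneq j n) => [_|j1] //.
  by decide_ifs; rewrite intrM mulrA -pmulrn pq mul1r.
have PD l : Psi D l = if l == V 1 then r%:~R else if l == Vb 1 then ((p0 t)%:Z + r)%:~R else 0.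
  case: l => [j|j|] //; rewrite [LHS]/= !eq_label.
    case: (posnP j) => [->|j0] //=; case: (leqP j n) => jn; last by decide_ifs.
    rewrite !hbD ?(leq_trans (leq_pred _)) //.
    by case: (eqVneq j 1%N) => [->|j1]; decide_ifs; rewrite /= ?subr0 ?subrr.
  case: (posnP j) => [->|j0] //=; case: (leqP j n) => jn; last by decide_ifs.
  rewrite !hD ?(leq_trans (leq_pred _)) //.
  case: (eqVneq j 1%N) => [->|j1]; decide_ifs; rewrite /= ?subrr //.
  by rewrite !(intrD, intrM); ring.
have dE : d%:~R = Psi u (V 1) - Psi u (Vb 1) :> rat.
  by rewrite /d intrD mulrNz !tX_hu psiV ?psiVb /=; [ring|lia..].
have rE (m : int) : (m < d) = (m%:~R < Psi u (V 1) - Psi u (Vb 1)) by rewrite -dE ltr_int.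
have p12 : p0 t = 1%N \/ p0 t = 2%N by case: t pt0; auto.
have rJ : r = _ := line_jump d p12.
clearbody r d.
case: p12 => pE.
  have -> : Binf_ei tl n 0 (Psi u) = if 0 < d then add_at (Psi u) (V 1) (-1) else add_at (Psi u) (Vb 1) 1.
    by rewrite rE subr_gt0; case: t pE pt0.
  case: ifP => H; apply: funext => l; rewrite PD pE /add_at.
    have -> : r = -1.
      move: rJ H; rewrite pE; clear; do 2?case: ifP; lia.
    by case: (eqVneq l (V 1)) => [->|_] /=; rewrite ?(subrr, mulr0z, mulrN1z, eq_label, addr0, if_same, add0r).
  have -> : r = 0 by move: rJ H; rewrite pE; clear; do 2?case: ifP; lia.
  by case: (eqVneq l (V 1)) => [->|_] /=; rewrite ?(subrr, mulr0z, mulrN1z, eq_label, addr0, if_same, add0r).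
have -> : Binf_ei tl n 0 (Psi u) = if 1 < d then add_at (Psi u) (V 1) (-2)
   else if d == 1 then add_at (add_at (Psi u) (V 1) (-1)) (Vb 1) 1 else add_at (Psi u) (Vb 1) 2.
  rewrite rE ltrBrDl -(eqr_int rat) dE subr_eq [1%:~R + _]addrC.
  by case: t pE pt0.
case: ifP => H; last case: ifP => H'; apply: funext => l; rewrite PD pE /add_at.
- have -> : r = -2 by move: rJ H; rewrite pE; clear; do 2?case: ifP; lia.
  by case: (eqVneq l (V 1)) => [->|_] /=; rewrite ?(subrr, mulr0z, mulrN1z, eq_label, addr0, if_same, add0r).
- have -> : r = -1 by move: rJ H H'; rewrite pE; clear; do 2?case: ifP; lia.
  by case: (eqVneq l (V 1)) => [->|_] /=; rewrite ?(subrr, mulr0z, mulrN1z, eq_label, addr0, if_same, add0r).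
have -> : r = 0 by move: rJ H H'; rewrite pE; clear; do 2?case: ifP; lia.
by case: (eqVneq l (V 1)) => [->|_] /=; rewrite ?(subrr, mulr0z, mulrN1z, eq_label, addr0, if_same, add0r).
Qed.

End WtEps.

(** * The isomorphism outside type A *)

Section ClassicalIso.

Context (C : numClosedFieldType) (t : affine_type) (n : nat).
Hypothesis ad : admissible t n.
Hypothesis ct : classical_type t.
Local Notation L := (labels1 t n).
Local Notation k := (size (word1 t n)).
Local Notation ux := (coord L 0).
Local Notation dr := (down_rank t n).
Local Notation X := (tX t n).

Let n2 : (2 <= n)%N. Proof. exact: n_ge2 ad. Qed.
Let bij (e : ('I_k -> int) -> 'I_k -> int) : Prop :=
  injective e /\ forall eta, exists xi, e xi = eta.

(** The branch depends on X_{i+1} - X_i. The increments r and 1 - r at the two occurrences of i add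
    up to 1, so X_i grows by 1 in both branches and the form drops by 1. *)
Lemma e_inner_bij i : (1 <= i <= dr)%N ->
  bij (fun xi => ud_map (@e_rat C t n i) (cons_pt 1 xi)).
Proof.
move=> ni; have dn := down_rank_lt ad ct.
apply: (@shift_bij t n (fun u => X u i.+1 - X u i)
  (fun m l => let r := if 0 < m then 0 else 1 in
     if l == V i then r else if l == Vb i then 1 - r else 0) (-1)).
- move=> xi; have [-> _ _] := ud_inner C ad ct xi ni; congr (pt L _).
  by apply: funext => l; rewrite /D_inner max_cases subr_gt0.
- by move=> u v E; rewrite !(tX_ext ad ct E) //; lia.
- by move=> u v; rewrite !tX_add; ring.
- move=> m; rewrite /tX !eq_label; set r : int := if 0 < m then 0 else 1.
  have -> : (i.+1 == i) = false by lia.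
  have -> : (n == i) = false by lia.
  have -> : (is_D1 t && (i == n.-1)) = false.
    by move: ni; rewrite /down_rank; case: (is_D1 t) => //=; lia.
  have -> : (i == 0%N) = false by lia.
  by rewrite eqxx (_ : (i == n) = false) /= ?(mulr0, if_same, addr0); [ring|lia].
Qed.

Lemma e_single_bij i : (dr < i <= n)%N ->
  bij (fun xi => ud_map (@e_rat C t n i) (cons_pt 1 xi)).
Proof.
move=> ni; apply: (@shift_bij t n (fun=> 0) (fun=> D_single i) 0) => //.
by move=> xi; exact: ud_single.
Qed.

(** X_1 drops by 1 and X_2 by 2 in both branches, so X_2 - X_1 drops by 1. *)
Lemma e_fork_bij : p0 t = 0%N -> bij (fun xi => ud_map (@e_rat C t n 0) (cons_pt 1 xi)).
Proof.
move=> pE; have n3 : (3 <= n)%N by case: t ct ad pE => //=; lia.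
have n4 : is_D1 t -> (4 <= n)%N by move=> /isD1P D; move: ad; rewrite D.
apply: (@shift_bij t n (fun u => X u 2 - X u 1)
  (fun m l => let r := if 0 < m then 0 else 1 in
     if l == V 1 then r - 1 else if l == Vb 1 then - r
     else - ((if l == V n then 3 - pn t else 1)%N%:Z)) (-1)).
- move=> xi; have [-> _ _] := ud_fork C ad ct xi pE; congr (pt L _).
  by apply: funext => l; rewrite /D_fork max_cases subr_gt0.
- by move=> u v E; rewrite !(tX_ext ad ct E) //; lia.
- by move=> u v; rewrite !tX_add; ring.
- move=> m; rewrite /tX !eq_label; case D: (is_D1 t) n4 => /= n4; try have {}n4 := n4 isT;
    decide_ifs; case: (0 < m); lia.
Qed.

(** X_1 moves by 2 r and X_0 by [p0] + 2 r, so X_1 - X_0 drops by [p0] whatever r is. *)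
Lemma e_line_bij : (0 < p0 t)%N -> bij (fun xi => ud_map (@e_rat C t n 0) (cons_pt 1 xi)).
Proof.
move=> pE; have nD : is_D1 t = false by case: t pE.
have p12 : p0 t = 1%N \/ p0 t = 2%N by case: t pE; auto.
apply: (@shift_bij t n (fun u => X u 1 - X u 0)
  (fun m l => let r := Num.max (p0 t)%:Z m - (p0 t)%:Z - Num.max 0 m in
     if l == V 0 then 1 + (3 - p0 t)%N%:Z * r
     else if l == V n then (3 - pn t)%N%:Z * r else r) (- (p0 t)%:Z)).
- move=> xi; have [-> _ _] := ud_line C ad xi pE; congr (pt L _).
  apply: funext => l; rewrite /D_line; set a := X _ 0; set b := X _ 1.
  suff -> : Num.max ((p0 t)%:Z + a) b - ((p0 t)%:Z + Num.max a b) =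
    Num.max (p0 t)%:Z (b - a) - (p0 t)%:Z - Num.max 0 (b - a) by [].
  by rewrite !maxEle; clearbody a b; clear; do 4?case: ifP; lia.
- by move=> u v E; rewrite !(tX_ext ad ct E) //; lia.
- by move=> u v; rewrite !tX_add; ring.
- move=> m; set r := _ - Num.max 0 m; clearbody r; rewrite /tX nD !eq_label; decide_ifs.
  by case: p12 => ->; lia.
Qed.

Lemma UD_V_classical : crystal_iso (UD_V C t n) (Binf (langlands t) n).
Proof.
apply: (@crystal_iso_of n (UD_V C t n) (Binf (langlands t) n) (fun xi => psi t n (ux xi))) => //.
- exact: Psi_bij.
- move=> i; change (bij (fun xi => ud_map (@e_rat C t n i) (cons_pt 1 xi))).
  case: (posnP i) => [->|i0]; last first.
    case: (leqP i dr) => ni; first by apply: e_inner_bij; lia.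
    by apply: e_single_bij; rewrite ni -ltnS ltn_ord.
  by case: (posnP (p0 t)) => pE; [exact: e_fork_bij|exact: e_line_bij].
move=> i xi /=; have li := ltn_ord i; rewrite ltnS in li.
case: (posnP i) => [iE|i0].
  rewrite iE; case: (posnP (p0 t)) => pE.
    have [-> -> ->] := ud_fork C ad ct xi pE.
    by have [-> ->] := wt_eps_fork ad ct (ux xi) pE; rewrite e_fork.
  have [-> -> ->] := ud_line C ad xi pE.
  by have [-> ->] := wt_eps_line ad ct (ux xi) pE; rewrite e_line.
case: (leqP i dr) => ni.
  have ni' : (1 <= i <= dr)%N by rewrite i0.
  have [-> -> ->] := ud_inner C ad ct xi ni'.
  by have [-> ->] := wt_eps_inner ad ct (ux xi) ni'; rewrite e_inner.
rewrite (ud_single C ad ct xi) ?ni //.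
case: (boolP (is_D1 t)) => D.
  have iE : nat_of_ord i = n \/ nat_of_ord i = n.-1 by move: ni; rewrite /down_rank D; lia.
  have [-> ->] := ud_D1 C ad ct xi D iE.
  by have [-> ->] := wt_eps_D1 ad ct (ux xi) D iE; rewrite e_D1.
have -> : nat_of_ord i = n by move: ni; rewrite /down_rank (negPf D); lia.
have [-> ->] := ud_last C ad ct xi D.
by have [-> ->] := wt_eps_last ad ct (ux xi) D; rewrite e_last.
Qed.

End ClassicalIso.

(** * The isomorphism in type A *)

Section A1Iso.

Context (C : numClosedFieldType) (n : nat).
Hypothesis ad : admissible A1 n.
Local Notation L := (labels1 A1 n).
Local Notation k := (size (word1 A1 n)).
Local Notation ux := (coord L 0).
Implicit Types xi : 'I_k -> int.

Let wL := word1E A1 n.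
Let uL := uniq_labels1 A1 n.

(** The values u_0 = u_{n+1} = 0 outside the word make the n+1 differences sum to zero. *)
Definition psi_A1 (u : label -> int) (l : label) : rat :=
  if l is V i then if (1 <= i <= n.+1)%N then (u (V i) - u (V i.-1))%:~R else 0 else 0.

Lemma coord_A1_out xi i : ~~ (1 <= i <= n)%N -> ux xi (V i) = 0.
Proof. by move=> ni; rewrite coord_out // mem_labels_A1. Qed.

Lemma cub_psi_A1 xi i : (i <= n.+1)%N -> cub (psi_A1 (ux xi)) i = (ux xi (V i))%:~R.
Proof.
elim: i => [|i IH] ni; first by rewrite /cub big_geq // coord_A1_out.
by rewrite cubS IH ?(ltnW ni) // /= ni rmorphB /= addrC subrK.
Qed.

Lemma psi_A1_bij : set_bij setT (Binf_set A1 n) (fun xi => psi_A1 (ux xi)).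
Proof.
split.
- move=> xi _; split; last split.
  + move=> [i|i|] //; rewrite mem_label mem_iota /= => ni; rewrite ifF //; lia.
  + by move=> [i|i|] //=; case: ifP => // _; rewrite ?intr_int ?rpred0.
  + by have := cub_psi_A1 xi (leqnn _); rewrite coord_A1_out //; lia.
- move=> xi xi' _ _ E; rewrite -(coordK uL wL 0 xi) -(coordK uL wL 0 xi').
  apply/(pt_eq wL) => -[i|i|]; rewrite mem_labels_A1 // => ni.
  by apply: (@intr_inj rat); rewrite -!cub_psi_A1 ?E //; lia.
move=> b [B0 [BI BS]].
have cI i : cub b i \is a Num.int by rewrite /cub rpred_sum.
pose f l : int := if l is V i then Num.floor (cub b i) else 0.
exists (pt L f) => //; apply: funext => l.
have fE i : (i <= n.+1)%N -> (ux (pt L f : 'I_k -> int) (V i))%:~R = cub b i.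
  move=> ni; case: (boolP (1 <= i <= n)%N) => H.
    by rewrite coord_pt // ?mem_labels_A1 // floorK.
  rewrite coord_A1_out //; have [->|->] : i = 0%N \/ i = n.+1 by lia.
    by rewrite /cub big_geq.
  by rewrite /cub BS.
case: l => [i|i|] /=; [|by rewrite B0 // mem_label..].
case: ifP => ni; last by rewrite B0 // mem_label mem_iota /=; lia.
by case: i ni => // i ni; rewrite rmorphB /= !fE ?cubS //; [ring|lia].
Qed.

(** The increment is cut off outside the word, where the coordinates stay 0. For e_0, which lowers
    every u_i by 1, exactly this cut-off produces the changes of b_1 and b_{n+1}. *)
Lemma psi_A1_shift xi (D : label -> int) :
  psi_A1 (ux (pt L (fun l => ux xi l + D l) : 'I_k -> int)) =
  fun l => psi_A1 (ux xi) l + psi_A1 (fun l => if l \in L then D l else 0) l.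
Proof.
have E l : ux (pt L (fun l => ux xi l + D l) : 'I_k -> int) l =
    ux xi l + (if l \in L then D l else 0).
  by case: (boolP (l \in L)) => lL; [rewrite coord_pt|rewrite !coord_out ?addr0].
apply: funext => -[i|i|] /=; rewrite ?addr0 // !E; case: ifP => _; rewrite ?addr0 //.
by rewrite -rmorphD; congr (_%:~R); ring.
Qed.

Lemma UD_V_A1 : crystal_iso (UD_V C A1 n) (Binf A1 n).
Proof.
apply: (@crystal_iso_of n (UD_V C A1 n) (Binf A1 n) (fun xi => psi_A1 (ux xi))) => //.
- exact: psi_A1_bij.
- move=> i.
  (* In type A every e_i is a translation, so the zero form serves as [delta]. *)
  have [D DE] : exists D : label -> int, forall xi,
      ud_map (@e_rat C A1 n i) (cons_pt 1 xi) = pt L (fun l => ux xi l + D l).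
    case: (posnP i) => [->|i0].
      by exists (fun=> -1) => xi; have [-> _ _] := ud_A1_zero C ad xi.
    have ni : (1 <= i <= n)%N by rewrite i0 -ltnS ltn_ord.
    by exists (D_single i) => xi; have [-> _ _] := ud_A1 C ad xi ni.
  exact: (@shift_bij A1 n (fun=> 0) (fun=> D) 0).
move=> i xi /=; have li := ltn_ord i; rewrite ltnS in li.
have n2 : (2 <= n)%N by [].
case: (posnP i) => [->|i0].
  have [-> -> ->] := ud_A1_zero C ad xi.
  rewrite psi_A1_shift; split.
  + apply: funext => -[j|j|]; rewrite /Binf_ei /= /add_at /= ?addr0 //.
    rewrite !mem_labels_A1 !eq_label; case: (eqVneq j 1%N) => [->|j1].
      by decide_ifs; rewrite !addr0 mulrN1z.
    rewrite addr0; case: (eqVneq j n.+1) => [->|j2].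
      by decide_ifs.
    by congr (_ + _); case: ifP => ni //; decide_ifs.
  + rewrite /Binf_wt /= leqnn /= (@coord_A1_out xi n.+1) ?(@coord_A1_out xi 0) //; last lia.
    by rewrite -rmorphB /=; congr (_%:~R); ring.
  + by rewrite /= (@coord_A1_out xi 0) // subr0.
have ni : (1 <= i <= n)%N by rewrite i0.
have [-> -> ->] := ud_A1 C ad xi ni.
rewrite psi_A1_shift; split.
- apply: funext => -[j|j|]; rewrite /= /add_at /= ?addr0 //.
  rewrite !mem_labels_A1 /D_single !eq_label -addrA; congr (_ + _).
  case: (eqVneq j i) => [->|j1]; first by decide_ifs; rewrite if_same subr0 addr0.
  case: (eqVneq j i.+1) => [->|j2]; first by decide_ifs; rewrite ?if_same sub0r mulrN1z add0r.
  by rewrite addr0; decide_ifs; rewrite ?if_same.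
- by rewrite /= ltnS li (leqW li) -rmorphB /=; congr (_%:~R); ring.
- by rewrite /= ltnS li.
Qed.

End A1Iso.

Theorem theorem6p1 (R : realType) (t : affine_type) (n : nat)
  (Htn : admissible t n) :
  crystal_iso (UD_V R[i] t n) (Binf (langlands t) n).
Proof.
by case: t Htn => // ad; [exact: UD_V_A1|exact: UD_V_classical..].
Qed.
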